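(* Let $\beta\in\{1,2,4\}$, let $N$ be a positive integer and let $R>0$. Define $$J_N^{(\beta)}(R)=\int_{R>\sigma_1>\cdots>\sigma_N>0}\delta\Big(1-\prod_{l=1}^N\sigma_l\Big)\prod_{l=1}^N\sigma_l^{\beta-1}\prod_{1\le j<k\le N}(\sigma_j^2-\sigma_k^2)^{\beta}\,d\sigma_1\cdots d\sigma_N$$ and $$A_N^{(\beta)}(R)=\frac{2^{-N}}{N!}R^{N(\beta-1)+\beta N(N-1)}\prod_{j=0}^{N-1}\frac{\Gamma(1+j\beta/2)\,\Gamma(1+(j+1)\beta/2)}{\Gamma(1+\beta/2)}.$$ Then for every $c>0$, $$J_N^{(\beta)}(R)=\frac{A_N^{(\beta)}(R)}{2\pi i}\int_{c-i\infty}^{c+i\infty}R^{Ns}\prod_{j=0}^{N-1}\frac{\Gamma\big((s-1+(j+1)\beta)/2\big)}{\Gamma\big((s+1+(N+j)\beta)/2\big)}\,ds.$$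
   Context: $\Gamma$ is the gamma function and $\delta$ is the Dirac delta function. The delta-function integral of a function $F$ over a region $D\subset(0,\infty)^N$ is understood by integrating out one variable: $\int_D\delta(1-\prod_{l=1}^N\sigma_l)F(\sigma_1,\dots,\sigma_N)\,d\sigma_1\cdots d\sigma_N$ means $\int F(\sigma_1,\dots,\sigma_N)\,(\sigma_1\cdots\sigma_{N-1})^{-1}\,d\sigma_1\cdots d\sigma_{N-1}$ with $\sigma_N=1/(\sigma_1\cdots\sigma_{N-1})$, over those $(\sigma_1,\dots,\sigma_{N-1})\in(0,\infty)^{N-1}$ for which $(\sigma_1,\dots,\sigma_N)\in D$.
   Formalization: The single case N = 1, R = 1 is excluded: there the region is empty, so J = 0, while the contour integral of 2/(s-1+β) diverges (its principal value would make the right side 1/2). *)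

(* Defs.v *)
From HB Require Import structures.
From mathcomp Require Import all_boot all_order all_algebra.
From mathcomp Require Import complex.
From mathcomp Require Import all_classical all_reals all_analysis.

Set Implicit Arguments.
Unset Strict Implicit.
Unset Printing Implicit Defensive.

Import Order.TTheory GRing.Theory Num.Theory.
Import numFieldNormedType.Exports.

Local Open Scope classical_set_scope.
Local Open Scope ring_scope.
Local Open Scope complex_scope.

(* x ^ z = exp (z ln x), for a real base x > 0 *)
Definition cpow (R : realType) (x : R) (z : R[i]) : R[i] :=
  (expR (complex.Re z * ln x))%:C *
  (cos (complex.Im z * ln x) +i* sin (complex.Im z * ln x)).

Definition Cintegral (R : realType) (D : set R) (f : R -> R[i]) : R[i] :=
  (\int[lebesgue_measure]_(t in D) complex.Re (f t)) +i*
  (\int[lebesgue_measure]_(t in D) complex.Im (f t)).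

(* Euler's integral: the Gamma function on the half-plane Re z > 0 only (no
   analytic continuation). *)
Definition Gamma (R : realType) (z : R[i]) : R[i] :=
  Cintegral `]0, +oo[ (fun t => cpow t (z - 1) * (expR (- t))%:C).

(* l is the value of the improper integral of f along the upward line Re s = c,
   s = c + i t, ds = i dt, the two ends tending to infinity independently. *)
Definition vertical_integral_to (R : realType) (c : R) (f : R[i] -> R[i])
    (l : R[i]) : Prop :=
  (fun p : R * R => Cintegral `[p.1, p.2] (fun t => f (c +i* t) * 'i%C) : R[i]^o)
    @ filter_prod (ninfty_nbhs R) (pinfty_nbhs R) --> (l : R[i]^o).

(* The integral over (0, +oo)^n, as an iterated Lebesgue integral; it is meant
   for nonnegative F only, where this is the n-dimensional Lebesgue integral
   (Tonelli). *)
Fixpoint pos_integral (R : realType) (n : nat) :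
    (n.-tuple R -> \bar R) -> \bar R :=
  match n with
  | 0 => fun F => F [tuple]
  | m.+1 => fun F =>
      (\int[lebesgue_measure]_(x in `]0%R, +oo[)
         pos_integral (fun s : m.-tuple R => F [tuple of x :: s]))%E
  end.

(* The integral over D of delta(1 - prod_l sigma_l) F(sigma), for F >= 0 on
   D \subset (0, +oo)^(n+1), the last variable being integrated out. *)
Definition delta_integral (R : realType) (n : nat) (D : set (n.+1.-tuple R))
    (F : n.+1.-tuple R -> R) : \bar R :=
  pos_integral (fun s : n.-tuple R =>
    let p := \prod_(i < n) tnth s i in
    ((F \_ D) [tuple of rcons s p^-1] * p^-1)%:E).

Section Ensemble.
Variables (R : realType) (beta n : nat) (r : R).
Local Notation N := n.+1.

(* r > sigma_1 > ... > sigma_N > 0 *)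
Definition region : set (N.-tuple R) :=
  [set s | path >%R r (rcons s 0)].

Definition integrand (s : N.-tuple R) : R :=
  (\prod_(l < N) tnth s l ^+ (beta - 1)) *
  \prod_(j < N) \prod_(k < N | (j < k)%N)
     (tnth s j ^+ 2 - tnth s k ^+ 2) ^+ beta.

(* J_N and A_N with N = n + 1, indexed by n *)
Definition JN : \bar R := delta_integral region integrand.

Definition AN : R[i] :=
  (2 ^- N / N`!%:R * r ^+ (N * (beta - 1) + beta * N * (N - 1)))%:C *
  \prod_(j < N)
    (Gamma (1 + j%:R * (beta%:R / 2) : R)%:C *
     Gamma (1 + j.+1%:R * (beta%:R / 2) : R)%:C /
     Gamma (1 + beta%:R / 2 : R)%:C).

Definition line_integrand (s : R[i]) : R[i] :=
  cpow r (N%:R * s) *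
  \prod_(j < N)
    (Gamma ((s - 1 + (j.+1 * beta)%:R) / 2) /
     Gamma ((s + 1 + ((N + j) * beta)%:R) / 2)).

End Ensemble.

(* Main.v *)
(* Expand prod_(j<k) (sigma_j^2 - sigma_k^2)^beta into monomials. The
   delta-integral of a monomial over R > sigma_1 > ... > sigma_N > 0 is, by
   integrating one variable at a time, the inverse Mellin transform of a product
   of N simple poles; for two or more poles the transform converges absolutely,
   the first step from one pole to two being an Abel summation, and for N = 1 the
   conditionally convergent integral is reduced to a double pole by integration by
   parts. The sum over the monomials of the products of poles is the value of
   Selberg's integral over an ordered simplex (with one Gamma exponent equal to
   1), defined on monomials by their explicit rational integrals. Aomoto's
   argument, integration by parts against elementary symmetric polynomials, gives
   its recursion in z -> z + 1, and the residue at z = 0 the recursion in N. As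
   beta is 1, 2 or 4, the Gamma quotient is a rational function, so the two
   recursions determine it. *)

Require Import Defs.
From HB Require Import structures.
From mathcomp Require Import all_boot all_order all_algebra.
From mathcomp Require Import ring.
From mathcomp Require mpoly ssrcomplements.

Set Implicit Arguments.
Unset Strict Implicit.
Unset Printing Implicit Defensive.

Import Order.TTheory GRing.Theory Num.Theory.

(** Expanding into monomials loses positivity, but every monomial is integrable on its own.
    Integrating one variable divides by the exponent accumulated so far, so Selberg's integral
    becomes a sum of products of linear denominators, and integration by parts an identity of
    rational functions valid in any numeric field: Selberg's formula is proved without analysis. A
    rational function of period 1 is constant, so no growth estimate is needed to solve the
    recursion in z. Of Gamma only three facts enter: Gamma(1) = 1, the functional equation, and
    non-vanishing for Re z > 0, without which the quotients could not be cancelled; as Gamma is only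
    Euler's integral here, the last has its own elementary proof. On the analytic side all integrals
    are of real functions: a complex integrand f is handled as the family Re (u f), u complex. The
    constraint is carried as p s_0 ... s_m = 1 with a free p > 0, so that fixing the largest
    variable leaves a problem of the same kind. The two ends of the vertical line move
    independently, so no principal value can replace the convergence proof for N = 1. *)

Module Selberg.
Import mpoly ssrcomplements.
Local Open Scope ring_scope.

(** The derivation is abstract because the rule serves twice: for [deriv] on a generating polynomial
    and for the partial derivatives of the Vandermonde product. *)
Lemma derivation_prod (A : comNzRingType) (d : A -> A) (I : eqType)
    (s : seq I) (f : I -> A) :
  d 1 = 0 -> (forall a b, d (a * b) = d a * b + a * d b) -> uniq s ->
  d (\prod_(i <- s) f i) =
  \sum_(i <- s) d (f i) * \prod_(j <- s | j != i) f j.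
Proof.
move=> d1 dM; elim: s => [|a s IHs] /=; first by rewrite !big_nil.
case/andP=> nas us; rewrite !big_cons eqxx /= dM IHs // mulr_sumr.
congr (_ * _ + _).
  rewrite [RHS]big_seq_cond [LHS]big_seq; apply: eq_bigl => i.
  by case: eqVneq => [->|]; rewrite ?(negbTE nas) ?andbT.
apply: eq_big_seq => i si; rewrite big_cons ifT; last first.
  by apply: contraNneq nas => ->.
by rewrite mulrCA.
Qed.

(** * Elementary symmetric polynomials *)

Section Esym.
Variables (A : comNzRingType) (I : finType) (x : I -> A).
Implicit Types (S : {set I}) (k : nat).

Definition epoly S : {poly A} := \prod_(i in S) (1 + x i *: 'X).
Definition esym S k : A := (epoly S)`_k.
(** e_(k-1) with the convention e_(-1) = 0, so that removing a variable from e_k needs no case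
    distinction at k = 0. *)
Definition esym1 S k : A := if k is k'.+1 then esym S k' else 0.

Lemma epolyD1 S i : i \in S -> epoly S = (1 + x i *: 'X) * epoly (S :\ i).
Proof. by move=> Si; rewrite /epoly (big_setD1 i). Qed.

Lemma esymD1 S i k : i \in S ->
  esym S k = esym (S :\ i) k + x i * esym1 (S :\ i) k.
Proof.
move=> Si; rewrite /esym1 /esym (epolyD1 Si) mulrDl mul1r coefD -scalerAl coefZ.
by rewrite coefXM; case: k.
Qed.

Lemma deriv_epoly S : (epoly S)^`() = \sum_(i in S) x i *: epoly (S :\ i).
Proof.
rewrite /epoly -big_enum /= (@derivation_prod _ (fun p : {poly A} => p^`())).
- rewrite big_enum; apply: eq_bigr => i Si.
  rewrite derivD derivC add0r derivZ derivX big_enum_cond /=.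
  rewrite (eq_bigl (fun j => j \in S :\ i)); last first.
    by move=> j; rewrite !inE andbC.
  by rewrite -scalerAl mul1r.
- exact: derivC.
- by move=> p q; rewrite derivM.
- exact: enum_uniq.
Qed.

(** Coefficients of X^(k-1) in the derivative of the generating polynomial. *)
Lemma esym_sumX S k : \sum_(i in S) x i * esym1 (S :\ i) k = k%:R * esym S k.
Proof.
case: k => [|k]; first by rewrite mul0r big1 // => i _; rewrite mulr0.
have := congr1 (fun p : {poly A} => p`_k) (deriv_epoly S).
rewrite coef_deriv coef_sum -/(esym S k.+1) mulr_natl => ->.
by apply: eq_bigr => i _; rewrite coefZ.
Qed.

Lemma esym_sum S k :
  \sum_(i in S) esym (S :\ i) k = (#|S|%:R - k%:R) * esym S k.
Proof.
have -> : \sum_(i in S) esym (S :\ i) k =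
    \sum_(i in S) (esym S k - x i * esym1 (S :\ i) k).
  by apply: eq_bigr => i Si; rewrite (esymD1 k Si) addrK.
by rewrite sumrB esym_sumX sumr_const mulrBl !mulr_natl.
Qed.

Lemma esym0 S : esym S 0 = 1.
Proof.
rewrite /esym /epoly; apply: (big_ind (fun p : {poly A} => p`_0 = 1)).
- by rewrite coef1.
- by move=> p q p0 q0; rewrite coef0M p0 q0 mulr1.
- by move=> i _; rewrite coefD coef1 coefZ coefX /= mulr0 addr0.
Qed.

(** The top one, e_N, is the product of the variables; it ends the chain e_0, ..., e_N and becomes
    the shift of z by 1. *)
Lemma esym_card S k : (#|S| <= k)%N ->
  esym S k = if k == #|S| then \prod_(i in S) x i else 0.
Proof.
have [n] := ubnP #|S|; elim: n S k => // n IHn S k.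
have [->|/set0Pn [i Si]] := eqVneq S set0.
  by rewrite cards0 /esym /epoly !big_set0 coef1; case: eqP.
rewrite (cardsD1 i S) Si add1n ltnS => ltn; case: k => // k ltk.
rewrite (esymD1 _ Si) /= !IHn // 1?ltnW // eqSS.
rewrite (gtn_eqF ltk) add0r; case: eqP; rewrite ?mulr0 //.
by move=> _; rewrite [RHS](big_setD1 i).
Qed.

End Esym.

(** * Selberg's integral over an ordered simplex *)

Section LinearExtension.
Variables (K : nat) (F : numFieldType).
Implicit Types (p q : {mpoly int[K]}) (h : 'X_{1..K} -> F).

(** All dependence on z sits in [h], so polynomials keep integer coefficients and an identity
    between them applies to every z. *)
Definition Lx h p : F := \sum_(m <- msupp p) (p@_m)%:~R * h m.

Lemma LxE h p i : (msize p <= i)%N ->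
  Lx h p = \sum_(m : 'X_{1..K < i}) (p@_m)%:~R * h m.
Proof.
move=> le_pi; set I : subFinType _ := 'X_{1..K < i}.
rewrite /Lx (big_mksub I) ?msupp_uniq //=; first last.
  by move=> m /msize_mdeg_lt /leq_trans; apply.
by rewrite big_rmcond //= => j /memN_msupp_eq0 ->; rewrite mul0r.
Qed.

Lemma Lx_is_zmod_morphism h : zmod_morphism (Lx h).
Proof.
move=> p q /=.
pose i := (msize p + msize q + msize (p - q))%N.
have [ip iq ipq] : [/\ msize p <= i, msize q <= i & msize (p - q) <= i]%N.
  by rewrite /i leq_addl -addnA leq_addr addnCA leq_addr.
rewrite !(@LxE _ _ i) //.
by rewrite -sumrB; apply/eq_bigr => m _; rewrite mcoeffB rmorphB mulrBl.
Qed.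

HB.instance Definition _ h := GRing.isZmodMorphism.Build {mpoly int[K]} F (Lx h)
  (Lx_is_zmod_morphism h).

Lemma LxZ h (c : int) p : Lx h (c *: p) = c%:~R * Lx h p.
Proof.
pose i := (msize p + msize (c *: p))%N.
rewrite (@LxE _ (c *: p) i) ?leq_addl // (@LxE _ p i) ?leq_addr // mulr_sumr.
by apply/eq_bigr => m _; rewrite mcoeffZ rmorphM mulrA.
Qed.

Lemma LxX h m : Lx h 'X_[m] = h m.
Proof. by rewrite /Lx msuppX big_seq1 mcoeffX eqxx mul1r. Qed.

Lemma Lx_shift h m p : Lx h ('X_[m] * p) = Lx (fun k => h (m + k)%MM) p.
Proof.
elim/mpolyind: p => [|c k p _ _ IHp]; first by rewrite mulr0 !raddf0.
by rewrite mulrDr !raddfD /= IHp -scalerAr !LxZ -mpolyXD !LxX.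
Qed.

(** Weighting by an exponent is the Euler operator X_a d/dX_a. *)
Lemma Lx_mulnX h p (a : 'I_K) :
  Lx (fun m => (m a)%:R * h m) p = Lx h ('X_a * p^`M(a)).
Proof.
elim/mpolyind: p => [|c k p _ _ IHp]; first by rewrite !raddf0 mulr0 raddf0.
rewrite mderivD mderivZ mderivX mulrDr !raddfD /= IHp -!scalerAr !LxZ LxX.
rewrite rmorph_nat; congr (_ * _ + _).
have [->|ka] := eqVneq (k a) 0%N; first by rewrite !mul0r.
rewrite -mpolyXD LxX; congr (_ * h _).
by rewrite addmC submK //; apply/mnm_lepP => j; rewrite mnm1E; case: eqP => // <-; rewrite lt0n.
Qed.

Lemma eq_Lx h h' p : h =1 h' -> Lx h p = Lx h' p.
Proof. by move=> hh'; apply: eq_bigr => m _; rewrite hh'. Qed.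

Lemma Lx_diff0 h (a b : 'I_K) p :
  (forall m, h (U_(a) + m)%MM = h (U_(b) + m)%MM) ->
  Lx h (('X_a - 'X_b) * p) = 0.
Proof.
by move=> hab; rewrite mulrBl raddfB /= !Lx_shift (eq_Lx _ hab) subrr.
Qed.

Lemma Lx_1diff0 h (a : 'I_K) p :
  (forall m, h (U_(a) + m)%MM = h m) -> Lx h ((1 - 'X_a) * p) = 0.
Proof.
by move=> ha; rewrite mulrBl raddfB /= mul1r Lx_shift (eq_Lx _ ha) subrr.
Qed.

End LinearExtension.

Section Functional.
Variables (K : nat) (F : numFieldType).
Implicit Types (N i : nat) (z : F) (m : 'X_{1..K}) (p : {mpoly int[K]}).

(* simplex_mon N z m is the integral of x^m prod_i x_i^(z-1) over the simplex
   1 > x_0 > ... > x_(N-1) > 0, and face_mon N z i m the one over its face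
   x_(i-1) = x_i (x_0 = 1 if i = 0). *)
Definition tail N m i := (\sum_(k < K | (i <= k < N)%N) m k)%N.
Definition tden N z m i : F := (N - i)%:R * z + (tail N m i)%:R.
Definition simplex_mon N z m : F := \prod_(i < N) (tden N z m i)^-1.
Definition face_mon N z i0 m : F :=
  \prod_(i < N | i != i0 :> nat) (tden N z m i)^-1.
Local Notation simplex N z := (Lx (simplex_mon N z)).
Local Notation face N z i := (Lx (face_mon N z i)).

Lemma tailD N (a : 'I_K) m i : tail N (U_(a) + m)%MM i = ((i <= a < N) + tail N m i)%N.
Proof.
rewrite /tail; under eq_bigr do rewrite mnmDE mnm1E.
rewrite big_split /=; congr addn.
case: (boolP (i <= a < N)%N) => [Pa|nPa].
  by rewrite (bigD1 a) //= eqxx big1 ?addn0 // => k /andP[_ /negbTE]; rewrite eq_sym => ->.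
by rewrite big1 // => k Pk; case: eqP => // ak; rewrite -ak (negbTE nPa) in Pk.
Qed.

Lemma tail_recl N m (i : 'I_K) : (i < N)%N -> tail N m i = (m i + tail N m i.+1)%N.
Proof.
move=> iN; rewrite /tail (bigD1 i) ?leqnn //=; congr (_ + _)%N.
apply: eq_bigl => k.
rewrite -(inj_eq val_inj) /= (ltn_neqAle i) [in RHS]eq_sym.
by case: (_ == _); case: (i <= k)%N; case: (k < N)%N.
Qed.

Lemma tail_geq N m i : (N <= i)%N -> tail N m i = 0%N.
Proof.
move=> Ni; rewrite /tail big1 // => k /andP[ik kN].
by have := leq_ltn_trans (leq_trans Ni ik) kN; rewrite ltnn.
Qed.

(** No denominator [tden] vanishes. The case k = 0 is included, which excludes z = 0. *)
Definition generic z := forall l k : nat, (0 < l)%N -> l%:R * z + k%:R != 0.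

Lemma tden_neq0 N z m i : generic z -> (i < N)%N -> tden N z m i != 0.
Proof. by move=> gz iN; apply: gz; rewrite subn_gt0. Qed.

(* Integration by parts in x_i, which ranges over ]x_(i+1), x_(i-1)[. *)
Lemma simplex_euler N z (i : 'I_K) p : generic z -> (i < N)%N ->
  z * simplex N z p + simplex N z ('X_i * p^`M(i)) =
  face N z i p - (if (i.+1 < N)%N then face N z i.+1 p else 0).
Proof.
move=> gz iN.
rewrite -Lx_mulnX; set g := simplex_mon N z.
transitivity (Lx (fun m => (z + (m i)%:R) * g m) p).
  elim/mpolyind: p => [|c m p _ _ IHp]; first by rewrite !raddf0 mulr0 addr0.
  by rewrite !raddfD /= -IHp !LxZ !LxX; ring.
have cofac (j : nat) m : (j < N)%N ->
    face_mon N z j m = tden N z m j * g m.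
  move=> jN; rewrite /g /simplex_mon /face_mon [in RHS](bigD1 (Ordinal jN)) //= mulVKf //.
  exact: tden_neq0.
(* z + m_i is the difference of two consecutive denominators, so multiplying by it telescopes into
   two products with one factor missing: the two faces. *)
have stepD m : tden N z m i = z + (m i)%:R + tden N z m i.+1.
  by rewrite /tden (tail_recl m iN) natrD -(subnSK iN) -natr1; ring.
case: ifP => iN1; rewrite ?subr0.
  rewrite (@eq_Lx _ _ (fun m => (z + (m i)%:R) * g m)
    (fun m => face_mon N z i m - face_mon N z i.+1 m)); last first.
    by move=> m; rewrite !cofac // stepD; ring.
  elim/mpolyind: p => [|c m p _ _ IHp]; first by rewrite !raddf0 addr0.
  by rewrite !raddfD /= IHp !LxZ !LxX; ring.
(* Here i = N - 1: the lower end of x_i is 0 and [tden] at N is 0, so only the upper face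
   remains. *)
apply: eq_Lx => m; rewrite cofac // stepD.
by rewrite /tden tail_geq 1?leqNgt ?iN1 // (eqP (_ : (N - i.+1)%N == 0%N)) ?subn_eq0 1?leqNgt ?iN1 // mul0r !addr0.
Qed.

(** The only denominator that separates the exponents of x_i and x_(i+1), the one of index i + 1, is
    missing on the face x_i = x_(i+1). *)
Lemma face_diff0 N z (i j : 'I_K) p : j = i.+1 :> nat -> (j < N)%N ->
  face N z j (('X_i - 'X_j) * p) = 0.
Proof.
move=> ji jN; apply: Lx_diff0 => m; apply: eq_bigr => k kj.
rewrite /tden !tailD; do 3 f_equal; rewrite ji in jN kj *.
by rewrite jN (ltnW jN) !andbT [in RHS]leq_eqVlt (negbTE kj) ltnS.
Qed.

(** The exponent of x_0 occurs only in the denominator of index 0, which is absent from the face x_0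
    = 1. *)
Lemma face0_diff0 N z (i : 'I_K) p : i = 0%N :> nat -> face N z i ((1 - 'X_i) * p) = 0.
Proof.
move=> i0; apply: Lx_1diff0 => m; apply: eq_bigr => k ki.
by rewrite /tden tailD i0 leqn0 -i0 (negbTE ki).
Qed.

(** Raising N exponents by 1 adds N - i to the denominator of index i, exactly as z + 1 does. *)
Lemma simplex_shift N z p : (N <= K)%N ->
  simplex N z (\prod_(i in [set i : 'I_K | (i < N)%N]) 'X_i * p) = simplex N (z + 1) p.
Proof.
pose mu := [multinom (i < N : nat) | i < K].
have -> : \prod_(i in [set i : 'I_K | (i < N)%N]) 'X_i = 'X_[mu] :> {mpoly int[K]}.
  rewrite mpolyXE_id big_mkcond; apply: eq_bigr => i _.
  by rewrite inE mnmE; case: (i < N)%N.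
move=> NK; rewrite Lx_shift; apply: eq_Lx => m; apply: eq_bigr => i _; congr _^-1.
rewrite /tden mulrDr mulr1 -addrA -natrD; congr (_ + _%:R).
rewrite /tail; under eq_bigr do rewrite mnmDE.
rewrite big_split /=; congr addn.
rewrite (eq_bigr (fun=> 1%N)); last by move=> k /andP[_ kN]; rewrite mnmE kN.
rewrite -(big_ord_widen_cond K (fun k => (i <= k)%N) (fun=> 1%N)) //.
rewrite -(big_mkord (fun k => (i <= k)%N) (fun=> 1%N)).
have /ltnW iN := ltn_ord i.
rewrite (@big_cat_nat _ _ _ i) ?leq0n ?iN //= big_nat_cond big1 => [|k]; last by case/andP=> /andP[_ ?]; rewrite leqNgt => /negP.
rewrite add0n -[RHS]muln1 -sum_nat_const_nat [RHS]big_nat_cond.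
by rewrite big_nat_cond; apply: eq_bigl => k; case: (i <= k)%N.
Qed.
End Functional.

(** * Aomoto's recursion in z *)

Section Aomoto.
Variables (K : nat) (F : numFieldType) (N : nat).
Hypothesis NK : (N <= K)%N.
Implicit Types (i j : 'I_K) (k : nat) (z : F) (p q : 'I_K * 'I_K).
Local Notation mp := {mpoly int[K]}.
Local Notation L z := (Lx (@simplex_mon K F N z)).
Local Notation S := [set i : 'I_K | (i < N)%N].
Local Notation X := (fun i : 'I_K => 'X_i : mp).

(** The ring has K variables of which the first N occur, so that the induction on N stays in one
    ring. *)
Definition Vpair p := (p.1 < p.2 < N)%N.
Definition vandermonde : mp := \prod_(p | Vpair p) ('X_p.1 - 'X_p.2).
Definition Vcofactor p : mp := \prod_(q | Vpair q && (q != p)) ('X_q.1 - 'X_q.2).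
(** The quotient of the Vandermonde product by X_i - X_j, for either order of i and j, written as a
    signed product to avoid division. *)
Definition Vdiv i j : mp := if (i < j)%N then Vcofactor (i, j) else - Vcofactor (j, i).

Lemma Vdiv_anti i j : i != j -> Vdiv j i = - Vdiv i j.
Proof. by rewrite /Vdiv -(inj_eq val_inj) /=; case: ltngtP; rewrite ?opprK. Qed.

Lemma VdivP i j : i != j -> (i < N)%N -> (j < N)%N ->
  ('X_i - 'X_j) * Vdiv i j = vandermonde.
Proof.
move=> ij iN jN; rewrite /vandermonde /Vdiv.
move: ij; rewrite -(inj_eq val_inj) /=; case: ltngtP => // ij _.
  by rewrite [RHS](bigD1 (i, j)) // /Vpair /= ij.
by rewrite mulrN -mulNr opprB [RHS](bigD1 (j, i)) // /Vpair /= ij.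
Qed.

Lemma mderiv1 i : (1 : mp)^`M(i) = 0.
Proof. by rewrite -mpolyC1 mderivC. Qed.

Lemma mderivU i j : ('X_j : mp)^`M(i) = (j == i)%:R.
Proof.
rewrite mderivX mnm1E; case: eqP => [->|_]; last by rewrite scale0r.
have -> : (U_(i) - U_(i) = 0 :> 'X_{1..K})%MM by apply/mnmP => k; rewrite mnmBE mnm0E subnn.
by rewrite scale1r mpolyX0.
Qed.

Lemma mderivXn i (p : mp) n : (p ^+ n.+1)^`M(i) = n.+1%:R * p ^+ n * p^`M(i).
Proof.
elim: n => [|n IHn]; first by rewrite !expr1 !mul1r.
by rewrite exprS mderivM IHn exprS -[n.+2%:R]natr1; ring.
Qed.

(** Logarithmic derivative: each j other than i contributes the product divided by X_i - X_j. *)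
Lemma vandermonde_deriv i : (i < N)%N ->
  vandermonde^`M(i) = \sum_(j in S | j != i) Vdiv i j.
Proof.
move=> iN; rewrite /vandermonde.
transitivity (\sum_(p | Vpair p) ((p.1 == i)%:R - (p.2 == i)%:R) * Vcofactor p : mp).
  rewrite -[X in mderiv _ X]big_enum /= (@derivation_prod _ (mderiv i)).
  - rewrite big_enum /=; apply: eq_bigr => p _; rewrite big_enum_cond /=.
    by rewrite mderivB !mderivU.
  - exact: mderiv1.
  - by move=> p q; rewrite mderivM.
  - exact: enum_uniq.
transitivity (\sum_(j : 'I_K | (i < j < N)%N) Vcofactor (i, j)
              - \sum_(j : 'I_K | (j < i)%N) Vcofactor (j, i)).
  under eq_bigr do rewrite mulrBl; rewrite sumrB; congr (_ - _).
    rewrite (bigID (fun p => p.1 == i)) /= [X in _ + X]big1 ?addr0; last first.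
      by move=> p /andP[_ /negbTE ->]; rewrite mul0r.
    rewrite (reindex_onto (fun j => (i, j)) snd) /=; last first.
      by move=> [a b] /= /andP[_ /eqP ->].
    apply: eq_big => [j|j _]; rewrite !eqxx ?mul1r //.
    by rewrite /Vpair /= !andbT.
  rewrite (bigID (fun p => p.2 == i)) /= [X in _ + X]big1 ?addr0; last first.
    by move=> p /andP[_ /negbTE ->]; rewrite mul0r.
  rewrite (reindex_onto (fun j => (j, i)) fst) /=; last first.
    by move=> [a b] /= /andP[_ /eqP ->].
  apply: eq_big => [j|j _]; rewrite !eqxx ?mul1r //.
  by rewrite /Vpair /= !andbT iN andbT.
rewrite [RHS](bigID (fun j : 'I_K => (i < j)%N)) /=; congr (_ + _).
  apply: eq_big => [j|j /andP[ij _]]; last by rewrite /Vdiv ij.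
  by rewrite inE -(inj_eq val_inj) /=; case: ltngtP; rewrite ?andbF ?andbT.
rewrite -sumrN; apply: eq_big => [j|j ji]; last by rewrite /Vdiv ltnNge (ltnW ji).
rewrite inE -(inj_eq val_inj) /=; case: ltngtP => ji; rewrite ?andbF ?andbT //=.
by rewrite (ltn_trans ji iN).
Qed.

Lemma esym_mderiv0 i (T : {set 'I_K}) k : i \notin T -> (esym X T k)^`M(i) = 0.
Proof.
have [n] := ubnP #|T|; elim: n T k => // n IHn T k.
have [->|/set0Pn [j Tj]] := eqVneq T set0.
  by rewrite /esym /epoly !big_set0 coef1; case: eqP; rewrite ?mderiv1 ?mderiv0.
rewrite (cardsD1 j T) Tj add1n ltnS => ltn niT.
have niTj : i \notin T :\ j by rewrite !inE negb_and niT orbT.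
have ji : j == i = false by apply: contraNF niT => /eqP <-.
rewrite (esymD1 _ _ Tj) mderivD mderivM mderivU ji mul0r add0r IHn // add0r.
by case: k => [|k] /=; rewrite ?mderiv0 ?IHn ?mulr0.
Qed.

Lemma card_S : #|S| = N.
Proof.
rewrite cardsE -sum1_card -(big_ord_widen_cond K xpredT (fun=> 1%N)) //.
by rewrite sum1_card card_ord.
Qed.

Lemma simplexMn z n (p : mp) : L z (n%:R * p) = n%:R * L z p.
Proof. by rewrite !mulr_natl raddfMn. Qed.

Variables (b : nat) (z : F).
Hypothesis gz : generic z.
Local Notation V := vandermonde.
Local Notation Q := (V ^+ b.+1).
Local Notation e k := (esym X S k).
Local Notation P k i := ((1 - 'X_i) * esym X (S :\ i) k * Q).

(* The boundary terms vanish because P k i does on each face. *)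
Lemma simplex_stokes i k : (i < N)%N ->
  z * L z (P k i) + L z ('X_i * (P k i)^`M(i)) = 0.
Proof.
move=> iN; rewrite simplex_euler //.
(* The exponent b + 1 is positive, so any one factor X_j - X_j' can be split off. *)
have QE j j' : j != j' -> (j < N)%N -> (j' < N)%N ->
    P k i = ('X_j - 'X_j') * ((1 - 'X_i) * esym X (S :\ i) k * V ^+ b * Vdiv j j').
  by move=> jj' jN j'N; rewrite exprSr -(VdivP jj') //; ring.
have -> : Lx (@face_mon K F N z i) (P k i) = 0.
  case i0 : (i : nat) => [|i'].
    by rewrite -i0 -mulrA face0_diff0.
  have i'K : (i' < K)%N by rewrite (ltn_trans _ (ltn_ord i)) // i0.
  have i'i : (i' < N)%N by rewrite (ltn_trans _ iN) // i0.
  by rewrite -i0 (QE (Ordinal i'K) i) ?face_diff0 // -(inj_eq val_inj) /= i0 neq_ltn ltnSn.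
case: ifP => [iN1|_]; last by rewrite subr0.
have iK1 : (i.+1 < K)%N := leq_trans iN1 NK.
rewrite (QE i (Ordinal iK1)) //; last by rewrite -(inj_eq val_inj) /= neq_ltn ltnSn.
by rewrite (@face_diff0 _ _ _ _ i (Ordinal iK1)) // subr0.
Qed.

Lemma sum_stokes1 k :
  \sum_(i in S) P k i = ((N%:R - k%:R) * e k - k.+1%:R * e k.+1) * Q.
Proof.
rewrite -mulr_suml; congr (_ * _).
rewrite -[N in N%:R]card_S -esym_sum -(esym_sumX X S k.+1) -sumrB.
by apply: eq_bigr => i _ /=; ring.
Qed.

Lemma esym_swap i j k : esym X (S :\ i :\ j) k = esym X (S :\ j :\ i) k.
Proof. by rewrite !setDDl setUC. Qed.

Lemma esym1_swap i j k : esym1 X (S :\ i :\ j) k = esym1 X (S :\ j :\ i) k.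
Proof. by rewrite !setDDl setUC. Qed.

Lemma sumD1 (G : 'I_K -> 'I_K -> mp) :
  \sum_(i in S) \sum_(j in S | j != i) G i j =
  \sum_(i in S) \sum_(j in S :\ i) G i j.
Proof. by apply: eq_bigr => i _; apply: eq_bigl => j; rewrite !inE andbC. Qed.

Lemma card_SD1 i : i \in S -> #|S :\ i|%:R = N%:R - 1 :> mp.
Proof. by move=> Si; rewrite -[N in RHS]card_S (cardsD1 i S) Si natrD addrC addKr. Qed.

(** Both sides are doubled because symmetrising the double sum over i and j produces a 2, which has
    no inverse among integer polynomials. *)
Lemma sum_stokes2 k :
  2%:R * \sum_(i in S) 'X_i * (P k i)^`M(i) =
  (b.+1%:R * ((N%:R - k%:R) * (N%:R - 1 - k%:R) * e k
              - k.+1%:R * (2%:R * (N%:R - 1 - k%:R) + k%:R) * e k.+1)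
   - 2%:R * k.+1%:R * e k.+1) * Q.
Proof.
pose T i := (1 - 'X_i) * 'X_i * esym X (S :\ i) k : mp.
have -> : \sum_(i in S) 'X_i * (P k i)^`M(i) =
   - (k.+1%:R * e k.+1) * Q
   + b.+1%:R * V ^+ b * \sum_(i in S) \sum_(j in S | j != i) T i * Vdiv i j.
  rewrite -(esym_sumX X S k.+1) -sumrN mulr_suml mulr_sumr -big_split /=.
  apply: eq_bigr => i; rewrite inE => iN.
  rewrite !mderivM mderivXn esym_mderiv0 ?setD11 // mderivB mderiv1 mderivU eqxx.
  rewrite vandermonde_deriv // -mulr_sumr /T /=. set E := esym _ _ _; set s0 := bigop _ _ _; rewrite exprS; move: V E s0 => V0 E s0; ring.
(* [Vdiv] is antisymmetric, so i and j together contribute (T i - T j) / (X_i - X_j) times the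
   Vandermonde product, and this quotient is a polynomial. *)
have sw : 2%:R * \sum_(i in S) \sum_(j in S | j != i) T i * Vdiv i j =
    \sum_(i in S) \sum_(j in S | j != i)
      ((1 - 'X_i - 'X_j) * esym X (S :\ i :\ j) k
       - 'X_i * 'X_j * esym1 X (S :\ i :\ j) k) * V.
  rewrite mulr_natl mulr2n.
  rewrite [X in _ + X](exchange_big_dep (mem S)) /=; last by move=> i j _ /andP[].
  rewrite -big_split /=; apply: eq_bigr => i Si.
  rewrite [X in _ + X](eq_bigl (fun j => (j \in S) && (j != i))); last first.
    by move=> j; rewrite Si /= eq_sym.
  rewrite -big_split /=; apply: eq_bigr => j /andP[Sj ji].
  have [iN jN] : (i < N)%N /\ (j < N)%N by move: Si Sj; rewrite !inE.
  have ij : i != j by rewrite eq_sym.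
  rewrite (Vdiv_anti ij) -(VdivP ij iN jN) /T.
  rewrite (@esymD1 _ _ X (S :\ i) j k) ?(@esymD1 _ _ X (S :\ j) i k) ?inE ?ji ?ij //.
  rewrite (esym_swap j i) (esym1_swap j i); ring.
rewrite [LHS]mulrDr [X in _ + X]mulrCA sw sumD1; under eq_bigr do rewrite -mulr_suml.
rewrite -mulr_suml.
(* The sum over j, and after it the sum over i, collapse by [esym_sum] and [esym_sumX]. *)
have -> : \sum_(i in S) \sum_(j in S :\ i)
      ((1 - 'X_i - 'X_j) * esym X (S :\ i :\ j) k
       - 'X_i * 'X_j * esym1 X (S :\ i :\ j) k) =
   \sum_(i in S) ((1 - 'X_i) * ((N%:R - 1 - k%:R) * esym X (S :\ i) k)
     - k.+1%:R * esym X (S :\ i) k.+1 - 'X_i * (k%:R * esym X (S :\ i) k)).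
  apply: eq_bigr => i Si.
  rewrite -(card_SD1 Si) -esym_sum -(esym_sumX X (S :\ i) k.+1) -(esym_sumX X (S :\ i) k).
  rewrite !mulr_sumr -!sumrB; apply: eq_bigr => j _ /=; ring.
have -> : \sum_(i in S) ((1 - 'X_i) * ((N%:R - 1 - k%:R) * esym X (S :\ i) k)
     - k.+1%:R * esym X (S :\ i) k.+1 - 'X_i * (k%:R * esym X (S :\ i) k)) =
   (N%:R - 1 - k%:R) * ((N%:R - k%:R) * e k) - k.+1%:R * ((N%:R - k.+1%:R) * e k.+1)
   - (N%:R - 1) * (k.+1%:R * e k.+1).
  rewrite -[N in (N%:R - k%:R) * _]card_S -[N in (N%:R - k.+1%:R) * _]card_S.
  rewrite -!esym_sum -(esym_sumX X S k.+1) !mulr_sumr -!sumrB.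
  apply: eq_bigr => i _ /=; ring.
rewrite -!natr1 exprS; ring.
Qed.

(** Summing the identities [simplex_stokes] over i symmetrises them, and only e_k and e_(k+1)
    survive. *)
Lemma aomoto k : (k < N)%N ->
  (N - k)%:R * (z + b.+1%:R / 2 * (N - k.+1)%:R) * L z (e k * Q) =
  k.+1%:R * (z + 1 + b.+1%:R / 2 * (N - 1 + (N - k.+1))%:R) * L z (e k.+1 * Q).
Proof.
move=> kN.
have : z * L z (2%:R * \sum_(i in S) P k i) +
       L z (2%:R * \sum_(i in S) 'X_i * (P k i)^`M(i)) = 0.
  rewrite !simplexMn !raddf_sum /= mulrCA -mulrDr mulr_sumr -big_split /=.
  by rewrite big1 ?mulr0 // => i; rewrite inE => iN; apply: simplex_stokes.
rewrite sum_stokes1 sum_stokes2.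
(* Writing N = k + 1 + n removes the truncated subtractions, which [ring] cannot treat. *)
have [n NE] : exists n, N = (k.+1 + n)%N by exists (N - k.+1)%N; rewrite subnKC.
have -> : (N - k = n.+1)%N by rewrite NE addSnnS addKn.
have -> : (N - k.+1 = n)%N by rewrite NE addKn.
have -> : (N - 1 = k + n)%N by rewrite NE addSn subn1.
set a := e k * Q; set c := e k.+1 * Q.
have -> : 2%:R * (((N%:R - k%:R) * e k - k.+1%:R * e k.+1) * Q) =
    (2 * n.+1)%:R * a - (2 * k.+1)%:R * c.
  by rewrite /a /c; move: (e k) (e k.+1) Q => u v q; rewrite NE !(natrM, natrD) -!natr1; ring.
have -> : (b.+1%:R * ((N%:R - k%:R) * (N%:R - 1 - k%:R) * e k
              - k.+1%:R * (2%:R * (N%:R - 1 - k%:R) + k%:R) * e k.+1)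
   - 2%:R * k.+1%:R * e k.+1) * Q =
    (b.+1 * n.+1 * n)%:R * a - (b.+1 * k.+1 * (2 * n + k) + 2 * k.+1)%:R * c.
  by rewrite /a /c; move: (e k) (e k.+1) Q => u v q; rewrite NE !(natrM, natrD) -!natr1; ring.
rewrite !raddfB /= !simplexMn => E; apply/eqP; rewrite -subr_eq0.
(* The factor 2 is undone here, where the values lie in the field F. *)
rewrite -[X in X == _](_ : (z * ((2 * n.+1)%:R * L z a - (2 * k.+1)%:R * L z c) +
     ((b.+1 * n.+1 * n)%:R * L z a -
      (b.+1 * k.+1 * (2 * n + k) + 2 * k.+1)%:R * L z c)) / 2 = _).
  by rewrite E mul0r.
by rewrite !(natrM, natrD); field.
Qed.

(** The N steps of [aomoto] lead from e_0 = 1 to the product of the variables, that is from z to z +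
    1; the integer factors N - i and i + 1 both multiply to N! and cancel. *)
Lemma simplex_succ :
  (\prod_(j < N) (z + b.+1%:R / 2 * j%:R)) * L z Q =
  (\prod_(j < N) (z + 1 + b.+1%:R / 2 * (N - 1 + j)%:R)) * L (z + 1) Q.
Proof.
have step k : (k <= N)%N ->
  (\prod_(i < k) ((N - i)%:R * (z + b.+1%:R / 2 * (N - i.+1)%:R))) * L z Q =
  (\prod_(i < k) (i.+1%:R * (z + 1 + b.+1%:R / 2 * (N - 1 + (N - i.+1))%:R)))
    * L z (e k * Q).
  elim: k => [|k IHk] kN; first by rewrite !big_ord0 esym0 !mul1r.
  rewrite !big_ord_recr /= mulrAC IHk 1?ltnW // -[LHS]mulrA -[RHS]mulrA.
  by congr (_ * _); rewrite mulrC aomoto.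
have := step N (leqnn N).
rewrite !big_split /=.
have -> : \prod_(i < N) (N - i)%:R = \prod_(i < N) i.+1%:R :> F.
  rewrite [RHS](reindex_inj rev_ord_inj) /=; apply: eq_bigr => i _.
  by rewrite subnSK.
rewrite -!mulrA => /mulfI H.
have {H}/H : \prod_(i < N) (i.+1%:R : F) != 0.
  by apply/prodf_neq0 => i _; rewrite pnatr_eq0.
rewrite esym_card ?card_S // eqxx simplex_shift //.
rewrite [X in X * _ = _](reindex_inj rev_ord_inj) /=.
rewrite [X in _ = X * _](reindex_inj rev_ord_inj) /= => E.
rewrite (eq_bigr (fun i : 'I_N => z + b.+1%:R / 2 * (N - (N - i.+1).+1)%:R)) => [|i _]; last first.
  by rewrite subnSK // subKn // ltnW.
rewrite {}E; congr (_ * _); apply: eq_bigr => i _.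
by rewrite subnSK // subKn // ltnW.
Qed.

End Aomoto.

(** * Functions that are rational on a domain *)

Section Ratfun.
Variable F : numFieldType.
Implicit Types (D : F -> Prop) (f g : F -> F) (x : F).

(** The denominator must not vanish on D, so a value there is never the default value of a division
    by 0. *)
Definition ratfun D f :=
  exists p q : {poly F}, forall x, D x -> q.[x] != 0 /\ f x = p.[x] / q.[x].

Lemma ratfun_ext D f g : (forall x, D x -> f x = g x) -> ratfun D g -> ratfun D f.
Proof. by move=> fg [p [q H]]; exists p, q => x Dx; rewrite fg //; apply: H. Qed.

Lemma ratfun_poly D (p : {poly F}) : ratfun D (horner p).
Proof. by exists p, 1 => x _; rewrite hornerC oner_neq0 divr1. Qed.

Lemma ratfunD D f g : ratfun D f -> ratfun D g -> ratfun D (fun x => f x + g x).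
Proof.
move=> [p [q H]] [p' [q' H']]; exists (p * q' + p' * q), (q * q') => x Dx.
have [q0 ->] := H x Dx; have [q'0 ->] := H' x Dx.
by rewrite !hornerE mulf_neq0 //; split=> //; field; rewrite q0 q'0.
Qed.

Lemma ratfunM D f g : ratfun D f -> ratfun D g -> ratfun D (fun x => f x * g x).
Proof.
move=> [p [q H]] [p' [q' H']]; exists (p * p'), (q * q') => x Dx.
have [q0 ->] := H x Dx; have [q'0 ->] := H' x Dx.
by rewrite !hornerM mulf_neq0 // mulf_div.
Qed.

Lemma ratfunV D f : (forall x, D x -> f x != 0) -> ratfun D f ->
  ratfun D (fun x => (f x)^-1).
Proof.
move=> f0 [p [q H]]; exists q, p => x Dx.
have [q0 E] := H x Dx; have := f0 x Dx; rewrite E mulf_eq0 negb_or => /andP[p0 _].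
by rewrite p0 invf_div.
Qed.

Lemma ratfun_sum D (I : Type) (s : seq I) (f : I -> F -> F) :
  (forall i, ratfun D (f i)) -> ratfun D (fun x => \sum_(i <- s) f i x).
Proof.
move=> H; elim: s => [|i s IHs].
  by apply: (@ratfun_ext _ _ (horner 0)) (ratfun_poly _ _) => x _; rewrite big_nil horner0.
by apply: (@ratfun_ext _ _ _ _ (ratfunD (H i) IHs)) => x _; rewrite big_cons.
Qed.

Lemma ratfun_prod D (I : Type) (s : seq I) (P : pred I) (f : I -> F -> F) :
  (forall i, P i -> ratfun D (f i)) -> ratfun D (fun x => \prod_(i <- s | P i) f i x).
Proof.
move=> H; elim: s => [|i s IHs].
  by apply: (@ratfun_ext _ _ (horner 1)) (ratfun_poly _ _) => x _; rewrite big_nil hornerC.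
case Pi : (P i).
  by apply: (@ratfun_ext _ _ _ _ (ratfunM (H i Pi) IHs)) => x _; rewrite big_cons Pi.
by apply: (@ratfun_ext _ _ _ _ IHs) => x _; rewrite big_cons Pi.
Qed.

(** A nonzero numerator has fewer roots than its size, while every positive integer is a root. *)
Lemma ratfun_eq0 D f : ratfun D f -> (forall n, D n.+1%:R) ->
  (forall n, f n.+1%:R = 0) -> forall x, D x -> f x = 0.
Proof.
move=> [p [q H]] Dn fn x Dx.
suff -> : f x = 0 by [].
have [_ ->] := H x Dx.
suff -> : p = 0 by rewrite horner0 mul0r.
apply: contraTeq isT => p0.
pose s := [seq n.+1%:R | n <- iota 0 (size p)] : seq F.
have : (size s < size p)%N.
  apply: max_poly_roots => //; last first.
    rewrite map_inj_uniq ?iota_uniq // => m n /eqP.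
    by rewrite eqr_nat eqSS => /eqP.
  apply/allP => _ /mapP[n _ ->]; have [qn0 E] := H _ (Dn n).
  move: (fn n); rewrite E => /eqP; rewrite mulf_eq0 invr_eq0 (negbTE qn0) orbF.
  by [].
by rewrite size_map size_iota ltnn.
Qed.

Lemma ratfun_eq D f g : ratfun D f -> ratfun D g -> (forall n, D n.+1%:R) ->
  (forall n, f n.+1%:R = g n.+1%:R) -> forall x, D x -> f x = g x.
Proof.
move=> rf rg Dn fg x Dx; apply/eqP; rewrite -subr_eq0; apply/eqP.
apply: (@ratfun_eq0 D (fun x => f x - g x)) Dx => //; last first.
  by move=> n; rewrite fg subrr.
apply: ratfunD => //; apply: (@ratfun_ext _ _ (fun x => (-1)%:P.[x] * g x)).
  by move=> y _; rewrite hornerC mulN1r.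
exact/ratfunM/rg/ratfun_poly.
Qed.

Lemma ratfun_lin D (a c : F) : ratfun D (fun x => a * x + c).
Proof.
apply: (@ratfun_ext _ _ (horner (a *: 'X + c%:P))) (ratfun_poly _ _) => x _.
by rewrite !hornerE.
Qed.

End Ratfun.

(** * The pole at z = 0 and the passage from M to M + 1 variables *)

Section Residue.
Variables (K : nat) (F : numFieldType) (b : nat).
Local Notation mp := {mpoly int[K]}.
Local Notation L N z := (Lx (@simplex_mon K F N z)).
Local Notation Q N := (vandermonde K N ^+ b.+1).

(** Only k > 0 is required, so z = 0 is allowed: the residue is read off by evaluating at 0 a
    function that is rational on this domain. *)
Definition generic0 (z : F) :=
  forall l k : nat, (0 < l)%N -> (0 < k)%N -> l%:R * z + k%:R != 0.

Lemma generic0_nat n : generic0 n%:R.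
Proof. by move=> l k l0 k0; rewrite -natrM -natrD pnatr_eq0 addn_eq0 (gtn_eqF k0) andbF. Qed.

Lemma generic_succ z : generic0 z -> generic (z + 1).
Proof.
move=> gz l k l0; rewrite mulrDr mulr1 -addrA -natrD; apply: gz => //.
by rewrite addn_gt0 l0.
Qed.

Lemma ratfun_simplex N (D : F -> Prop) p : (forall z, D z -> generic z) ->
  ratfun D (fun z => L N z p).
Proof.
move=> Dg; apply: ratfun_sum => m; apply: ratfunM.
  by apply: (@ratfun_ext _ _ _ (horner (p@_m)%:~R%:P)) (ratfun_poly _ _) => z _; rewrite hornerC.
apply: ratfun_prod => i _; apply: ratfunV; last exact: ratfun_lin.
by move=> z Dz; apply: tden_neq0 => //; apply: Dg.
Qed.

Lemma msupp_mderiv0 (i : 'I_K) (p : mp) m : p^`M(i) = 0 -> m \in msupp p -> m i = 0%N.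
Proof.
move=> dp; rewrite mcoeff_msupp; apply: contraNeq => mi0.
have : (p^`M(i))@_(m - U_(i))%MM = 0 by rewrite dp mcoeff0.
rewrite mcoeff_mderiv submK; last first.
  by apply/mnm_lepP => j; rewrite mnm1E; case: eqP => // <-; rewrite lt0n.
by move/eqP; rewrite mulrn_eq0.
Qed.

Lemma vandermonde_mderiv0 N (i : 'I_K) : (N <= i)%N -> (vandermonde K N)^`M(i) = 0.
Proof.
move=> Ni; rewrite /vandermonde.
apply: (big_ind (fun p : mp => p^`M(i) = 0)); first exact: mderiv1.
  by move=> p q dp dq; rewrite mderivM dp dq mul0r mulr0 addr0.
move=> [a c] /andP[/= ac cN]; rewrite mderivB !mderivU.
have ci := leq_trans cN Ni; have ai := ltn_trans ac ci.
by rewrite -!(inj_eq val_inj) /= !ltn_eqF // subrr.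
Qed.

(** The new factors X_i - X_M reduce to X_i modulo X_M. The cofactor is kept explicit because its
    contribution has to be shown free of a pole at 0. *)
Lemma vandermonde_recr M (MK : (M < K)%N) :
  exists C : mp, Q M.+1 =
    (\prod_(i : 'I_K | (i < M)%N) 'X_i) ^+ b.+1 * Q M + 'X_(Ordinal MK) * C.
Proof.
set a := Ordinal MK.
have [C ->] : exists C : mp, vandermonde K M.+1 =
    (\prod_(i : 'I_K | (i < M)%N) 'X_i) * vandermonde K M + 'X_a * C.
  have -> : vandermonde K M.+1 =
      (\prod_(i : 'I_K | (i < M)%N) ('X_i - 'X_a)) * vandermonde K M.
    rewrite /vandermonde (bigID (fun p : 'I_K * 'I_K => p.2 == a)) /=; congr (_ * _).
      rewrite (reindex_onto (fun i => (i, a)) fst) /=; last first.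
        by move=> [c d] /= /andP[_ /eqP ->].
      by apply: eq_bigl => i; rewrite /Vpair /= !eqxx !andbT ltnSn andbT.
    apply: eq_bigl => [[c d]]; rewrite /Vpair /= -(inj_eq val_inj) /= ltnS.
    by rewrite (ltn_neqAle d) -andbA; congr (_ && _); rewrite andbC.
  have [C ->] : exists C : mp, \prod_(i : 'I_K | (i < M)%N) ('X_i - 'X_a) =
      \prod_(i : 'I_K | (i < M)%N) 'X_i + 'X_a * C.
    apply: (big_ind2 (fun x y : mp => exists C, x = y + 'X_a * C)).
    - by exists 0; rewrite mulr0 addr0.
    - move=> x1 x2 y1 y2 [C1 ->] [C2 ->].
      by exists (C1 * y2 + x2 * C2 + 'X_a * C1 * C2); ring.
    - by move=> i _; exists (-1); ring.
  by exists (C * vandermonde K M); ring.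
rewrite -exprMn; set u := (X in (X + _) ^+ _).
elim: b => [|k [C' IHk]]; first by exists C; rewrite !expr1.
exists (u * C' + C * (u ^+ k.+1 + 'X_a * C')).
rewrite exprS IHk (exprS u k.+1); move: (u ^+ k.+1) => w; ring.
Qed.

(* Modulo X_M, Q_(M+1) is prod_(i<M) X_i^beta Q_M, and the other terms have no
   pole at z = 0. *)
Lemma simplex_residue M : (M < K)%N ->
  exists f : F -> F, [/\ ratfun generic0 f,
    f 0 = L M b.+1%:R (Q M) &
    forall z, generic0 z -> z != 0 -> f z = z * L M.+1 z (Q M.+1)].
Proof.
move=> MK; have [C QE] := vandermonde_recr MK.
set a := Ordinal MK in QE.
pose mu := [multinom (b.+1 * (i < M))%N | i < K].
have muE : (\prod_(i : 'I_K | (i < M)%N) 'X_i) ^+ b.+1 = 'X_[mu] :> mp.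
  rewrite mpolyXE_id -prodrXl [LHS]big_mkcond; apply: eq_bigr => i _.
  by rewrite mnmE; case: (i < M)%N; rewrite ?muln1 ?muln0.
(* [tden] for M + 1 variables after the exponents are raised by [mu]. At z = 0 it is [tden] for M
   variables at b + 1, whence the value f 0. The index M, whose denominator is z itself, is left out
   of the product. *)
pose den z (m : 'X_{1..K}) i : F :=
  (M.+1 - i)%:R * z + (b.+1 * (M - i) + tail M m i)%:R.
pose f1 z := \sum_(m <- msupp (Q M)) ((Q M)@_m)%:~R * \prod_(i < M) (den z m i)^-1.
(* The factor X_M puts a positive integer into every denominator, so none vanishes at z = 0. *)
pose f2 z := L M.+1 z ('X_a * C).
have tailM (m : 'X_{1..K}) (i : nat) : m a = 0%N -> tail M.+1 m i = tail M m i.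
  move=> ma; rewrite /tail big_mkcond [RHS]big_mkcond; apply: eq_bigr => k _.
  rewrite ltnS (leq_eqVlt k M); case: (altP (k =P M :> nat)) => [kM|] //=.
  have -> : k = a by apply: val_inj.
  by rewrite ma ltnn andbF; case: ifP.
have supp0 (m : 'X_{1..K}) : m \in msupp (Q M) -> m a = 0%N.
  apply: msupp_mderiv0; rewrite mderivXn vandermonde_mderiv0 ?mulr0 //.
have tailmu (m : 'X_{1..K}) (i : nat) : (i <= M)%N -> tail M (mu + m)%MM i = (b.+1 * (M - i) + tail M m i)%N.
  move=> iM; rewrite /tail; under eq_bigr do rewrite mnmDE.
  rewrite big_split /=; congr addn.
  rewrite (eq_bigr (fun=> b.+1)); last by move=> k /andP[_ kM]; rewrite mnmE kM muln1.
  rewrite -(big_ord_widen_cond K (fun k => (i <= k)%N) (fun=> b.+1)) 1?ltnW //.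
  rewrite -(big_mkord (fun k => (i <= k)%N) (fun=> b.+1)).
  rewrite (@big_cat_nat _ _ _ i) ?leq0n ?iM //= big_nat_cond big1 => [|k]; last first.
    by case/andP=> /andP[_ ?]; rewrite leqNgt => /negP.
  rewrite add0n [RHS]mulnC -sum_nat_const_nat [RHS]big_nat_cond.
  by rewrite big_nat_cond; apply: eq_bigl => k; case: (i <= k)%N.
exists (fun z => f1 z + z * f2 z); split.
- apply: ratfunD; last apply: ratfunM.
  + apply: ratfun_sum => m; apply: ratfunM.
      by apply: (@ratfun_ext _ _ _ (horner ((Q M)@_m)%:~R%:P)) (ratfun_poly _ _) => z _; rewrite hornerC.
    apply: ratfun_prod => i _; apply: ratfunV; last exact: ratfun_lin.
    move=> z gz; apply: gz; first by rewrite subn_gt0 ltnS ltnW.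
    by rewrite addn_gt0 muln_gt0 subn_gt0 ltn_ord.
  + by apply: (@ratfun_ext _ _ _ (horner 'X)) (ratfun_poly _ _) => z _; rewrite hornerX.
  rewrite /f2.
  apply: (@ratfun_ext _ _ _ (fun z => Lx (fun m => simplex_mon M.+1 z (U_(a) + m)%MM) C)).
    by move=> z _; rewrite Lx_shift.
  apply: ratfun_sum => m; apply: ratfunM.
    by apply: (@ratfun_ext _ _ _ (horner (C@_m)%:~R%:P)) (ratfun_poly _ _) => z _; rewrite hornerC.
  apply: ratfun_prod => i _; apply: ratfunV; last exact: ratfun_lin.
  move=> z gz; apply: gz; first by rewrite subn_gt0.
  by rewrite tailD /= ltnSn -(ltnS i) ltn_ord addn_gt0.
- rewrite mul0r addr0; apply: eq_bigr => m _; congr (_ * _).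
  apply: eq_bigr => i _; rewrite /den /tden mulr0 add0r natrD natrM mulrC.
  by [].
move=> z gz z0; rewrite QE raddfD mulrDr /=; congr (_ + _).
rewrite muE Lx_shift /f1 /Lx mulr_sumr; apply: eq_big_seq => m /supp0 ma.
rewrite mulrCA; congr (_ * _).
have mua : (mu + m)%MM a = 0%N by rewrite mnmDE ma mnmE ltnn muln0.
rewrite /simplex_mon big_ord_recr /= mulrCA.
rewrite /tden subSnn mul1r tailM // tail_geq // addr0 mulfV // mulr1.
by apply: eq_bigr => i _; rewrite /den tailM // tailmu // ltnW.
Qed.

End Residue.

(** * Solving the two recursions by Gamma factors *)

Section GammaFormula.
Variables (F : numFieldType) (Gam : F -> F) (dom : F -> Prop) (b : nat).
Hypothesis dom_half : forall z n, dom z -> dom (z + n%:R / 2).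
Hypothesis dom_pos : forall n, dom (n.+1%:R / 2).
Hypothesis dom_generic : forall z, dom z -> generic z.
Hypothesis Gam1 : Gam 1 = 1.
Hypothesis GamS : forall z, dom z -> Gam (z + 1) = z * Gam z.
Hypothesis Gam_neq0 : forall z, dom z -> Gam z != 0.
Hypothesis b_val : b.+1 \in [:: 1; 2; 4]%N.

Let dom_nat z n : dom z -> dom (z + n%:R).
Proof.
move=> dz; have -> : n%:R = (2 * n)%:R / 2 :> F by rewrite natrM; field.
exact: dom_half.
Qed.

Let dom_posn n : dom n.+1%:R.
Proof.
have -> : n.+1%:R = n.*2.+2%:R / 2 :> F by rewrite -doubleS -muln2 natrM mulfK ?pnatr_eq0.
exact: dom_pos.
Qed.

Lemma Gam_addn z k : dom z -> Gam (z + k%:R) = (\prod_(i < k) (z + i%:R)) * Gam z.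
Proof.
move=> dz; elim: k => [|k IHk]; first by rewrite addr0 big_ord0 mul1r.
by rewrite -natr1 addrA GamS ?IHk ?big_ord_recr /=; [ring|apply: dom_nat].
Qed.

(** The quotients needed below are polynomials because the arguments in f exceed those in g by
    natural numbers. *)
Definition ratpoly (f g : F -> F) :=
  exists q : {poly F}, forall z, dom z -> f z = q.[z] * g z.

Lemma ratpoly_shift a k : ratpoly (fun z => Gam (z + (a + 2 * k)%:R / 2))
  (fun z => Gam (z + a%:R / 2)).
Proof.
exists (\prod_(i < k) ('X + (a%:R / 2 + i%:R)%:P)) => z dz.
have -> : z + (a + 2 * k)%:R / 2 = z + a%:R / 2 + k%:R by rewrite natrD natrM; field.
rewrite Gam_addn; last exact: dom_half.
rewrite horner_prod; congr (_ * _); apply: eq_bigr => i _.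
by rewrite hornerD hornerX hornerC addrA.
Qed.

Lemma ratpoly_prod n (f g : nat -> F -> F) : (forall i, ratpoly (f i) (g i)) ->
  ratpoly (fun z => \prod_(i < n) f i z) (fun z => \prod_(i < n) g i z).
Proof.
move=> H; elim: n => [|n [q IHn]].
  by exists 1 => z _; rewrite !big_ord0 hornerC mulr1.
have [q' H'] := H n; exists (q * q') => z dz.
by rewrite !big_ord_recr /= IHn // H' // hornerM mulrACA.
Qed.

Definition Gam_num N z := \prod_(j < N) Gam (z + (b.+1 * j)%:R / 2).
Definition Gam_den N z := \prod_(j < N) Gam (z + (2 + b.+1 * (N - 1 + j))%:R / 2).

(* The arguments in numerator and denominator agree modulo 1 up to a
   permutation; only beta = 1 with N even needs a nontrivial one. *)
Lemma ratpoly_Gam N : ratpoly (Gam_den N) (Gam_num N).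
Proof.
have even_case (g : nat) : b.+1 = (2 * g)%N -> ratpoly (Gam_den N) (Gam_num N).
  move=> bg; apply: (@ratpoly_prod N (fun j z => Gam (z + (2 + b.+1 * (N - 1 + j))%:R / 2))
    (fun j z => Gam (z + (b.+1 * j)%:R / 2))) => j.
  have -> : (2 + b.+1 * (N - 1 + j) = b.+1 * j + 2 * (1 + g * (N - 1)))%N.
    by rewrite bg; ring.
  exact: ratpoly_shift.
move: b_val; rewrite !inE => /or3P[/eqP b1|/eqP b2|/eqP b4]; last 2 first.
- exact: (even_case 1%N).
- exact: (even_case 2%N).
rewrite /Gam_den /Gam_num b1.
have [Nodd|] := boolP (odd N).
  have [M NE] : exists M, N = M.*2.+1.
    by exists N./2; rewrite -[LHS]odd_double_half Nodd.
  apply: (@ratpoly_prod N (fun j z => Gam (z + (2 + 1 * (N - 1 + j))%:R / 2))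
    (fun j z => Gam (z + (1 * j)%:R / 2))) => j.
  have -> : (2 + 1 * (N - 1 + j) = 1 * j + 2 * (1 + M))%N.
    by rewrite NE subn1 /= -mul2n; ring.
  exact: ratpoly_shift.
case: N even_case => [|N'] _ Neven.
  by exists 1 => z _; rewrite !big_ord0 hornerC mulr1.
have [M NE] : exists M, N' = M.*2.+1.
  by exists N'./2; rewrite -[LHS]odd_double_half; move: Neven; rewrite /= negbK => ->.
(* N = N' + 1 is even: a cyclic shift matches the denominator factor j with the numerator factor j +
   1, and the last denominator factor with the numerator factor 0. *)
have [q1 H1] := ratpoly_prod N' (fun j => ratpoly_shift j.+1 M.+1).
have [q2 H2] := ratpoly_shift 0 N'.+1.
exists (q1 * q2) => z dz.
rewrite big_ord_recr big_ord_recl /= hornerM.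
have -> : (2 + 1 * (N'.+1 - 1 + N') = 0 + 2 * N'.+1)%N by rewrite subn1 /=; ring.
rewrite H2 // (eq_bigr (fun j : 'I_N' => Gam (z + (j.+1 + 2 * M.+1)%:R / 2))).
  rewrite H1 // muln0 [X in _ = _ * (_ * X)](eq_bigr (fun j : 'I_N' => Gam (z + j.+1%:R / 2))).
    by ring.
  by move=> j _; rewrite mul1n.
move=> j _; congr (Gam (z + _%:R / 2)); move: (nat_of_ord j) => i.
by rewrite subn1 NE /= -mul2n; ring.
Qed.

Section Levels.
Variable K : nat.
Local Notation L N z := (Lx (@simplex_mon K F N z)).
Local Notation Q N := (vandermonde K N ^+ b.+1).
Local Notation a j := (Gam ((2 + b.+1 * j)%:R / 2)).

Let gammaE j : b.+1%:R / 2 * j%:R = (b.+1 * j)%:R / 2 :> F.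
Proof. by rewrite natrM; field. Qed.

Let domh (n : nat) : (0 < n)%N -> dom (n%:R / 2).
Proof. by case: n => // n _; apply: dom_pos. Qed.

Let aE j : a j = Gam (1 + b.+1%:R / 2 * j%:R).
Proof. by rewrite gammaE natrD; congr Gam; field. Qed.

Lemma Gam_num_succ N z : dom z ->
  Gam_num N (z + 1) = (\prod_(j < N) (z + b.+1%:R / 2 * j%:R)) * Gam_num N z.
Proof.
move=> dz; rewrite -big_split; apply: eq_bigr => j _ /=.
by rewrite gammaE addrAC GamS //; apply: dom_half.
Qed.

Lemma Gam_den_succ N z : dom z ->
  Gam_den N (z + 1) =
  (\prod_(j < N) (z + 1 + b.+1%:R / 2 * (N - 1 + j)%:R)) * Gam_den N z.
Proof.
move=> dz; rewrite -big_split; apply: eq_bigr => j _ /=.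
rewrite addrAC GamS; last exact: dom_half.
by congr (_ * _); rewrite gammaE natrD; field.
Qed.

Lemma Gam_num_neq0 N z : dom z -> Gam_num N z != 0.
Proof. by move=> dz; apply/prodf_neq0 => i _; apply/Gam_neq0/dom_half. Qed.

Lemma Gam_den_neq0 N z : dom z -> Gam_den N z != 0.
Proof. by move=> dz; apply/prodf_neq0 => i _; apply/Gam_neq0/dom_half. Qed.

(** The integral times the polynomial quotient of Gamma factors is a rational function of period 1
    by [simplex_succ], hence constant; z is compared with 1. *)
Lemma simplex_Gam_ratio N z : (N <= K)%N -> dom z ->
  L N z (Q N) * Gam_den N z * Gam_num N 1 =
  L N 1 (Q N) * Gam_den N 1 * Gam_num N z.
Proof.
move=> NK dz; have [q qE] := ratpoly_Gam N.
pose f z := L N z (Q N) * q.[z].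
have d1 : dom 1 := dom_posn 0.
have fS y : dom y -> f (y + 1) = f y.
  move=> dy; have := simplex_succ NK b (dom_generic dy).
  have dy1 : dom (y + 1) := dom_nat 1 dy.
  have := qE _ dy1; rewrite Gam_den_succ // Gam_num_succ // qE //.
  have n0 := Gam_num_neq0 N dy.
  have p0 : \prod_(j < N) (y + b.+1%:R / 2 * j%:R) != 0.
    by have := Gam_num_neq0 N dy1; rewrite Gam_num_succ // mulf_eq0 negb_or => /andP[].
  rewrite !mulrA => /(mulIf n0) E1 E2; apply: (mulIf p0).
  by rewrite /f -mulrA -E1 mulrA [_ * \prod_(_ < _) _]mulrC -E2; ring.
have fn n : f n.+1%:R = f 1.
  by elim: n => // n IHn; rewrite -[n.+2%:R]natr1 fS.
have rf : ratfun dom f.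
  by apply: ratfunM; [exact: ratfun_simplex|exact: ratfun_poly].
have f1 : f z = f 1.
  apply: (@ratfun_eq _ dom f (fun=> f 1)) => //.
  by apply: (@ratfun_ext _ _ _ (horner (f 1)%:P)) (ratfun_poly _ _) => y _; rewrite hornerC.
by rewrite !qE //; move: f1; rewrite /f => E; rewrite mulrA E; ring.
Qed.

(** The limit z -> 0 of [simplex_succ] for M + 1 variables: the factor j = 0 on its left is z and
    turns the integral into a residue. The limit is an evaluation, since both sides are rational on
    [generic0] and agree at the positive integers. *)
Lemma simplex_at1 M : (M < K)%N ->
  (\prod_(j < M.+1) (1 + b.+1%:R / 2 * (M + j)%:R)) * L M.+1 1 (Q M.+1) =
  (\prod_(j < M) (b.+1%:R / 2 * j.+1%:R)) * L M b.+1%:R (Q M).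
Proof.
move=> MK; have [f [rf f0 fE]] := @simplex_residue K F b M MK.
pose g1 z := f z * \prod_(j < M) (z + b.+1%:R / 2 * j.+1%:R).
pose g2 z := (\prod_(j < M.+1) (z + 1 + b.+1%:R / 2 * (M + j)%:R)) * L M.+1 (z + 1) (Q M.+1).
have lin (c : F) : ratfun (@generic0 F) (fun z => z + c).
  by apply: (@ratfun_ext _ _ _ _ _ (ratfun_lin _ 1 c)) => z _; rewrite mul1r.
suff : g1 0 = g2 0.
  rewrite /g1 /g2 f0 => E; rewrite [RHS]mulrC.
  transitivity (\prod_(j < M.+1) (0 + 1 + b.+1%:R / 2 * (M + j)%:R) *
                L M.+1 (0 + 1) (Q M.+1)).
    by congr (_ * _); [apply: eq_bigr => j _; rewrite add0r|rewrite add0r].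
  by rewrite -E; congr (_ * _); apply: eq_bigr => j _; rewrite add0r.
apply: (@ratfun_eq _ (@generic0 F) g1 g2).
- by apply: ratfunM => //; apply: ratfun_prod => j _; apply: lin.
- apply: ratfunM.
    apply: ratfun_prod => j _.
    by apply: (@ratfun_ext _ _ _ _ _ (lin _)) => z _; rewrite -addrA.
  have [p [q H]] := @ratfun_simplex K F M.+1 (@generic F) (Q M.+1) (fun z gz => gz).
  exists (p \Po ('X + 1)), (q \Po ('X + 1)) => z /generic_succ /H.
  by rewrite !horner_comp !hornerE.
- by move=> n; apply: generic0_nat.
- move=> n; rewrite /g1 /g2 fE ?pnatr_eq0 //; last exact: generic0_nat.
  have := simplex_succ MK b (dom_generic (dom_posn n)).
  rewrite big_ord_recl mulr0 addr0 subn1 /= => <-.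
  by rewrite mulrAC.
- exact: (generic0_nat F 0).
Qed.

(** N! compares the ordered simplex with the cube. [simplex_at1] lowers the number of variables and
    leaves the parameter b + 1, where the induction hypothesis applies. *)
Lemma selberg_simplex N z : (N <= K)%N -> dom z ->
  N`!%:R * L N z (Q N) * Gam_den N z * a 1 ^+ N =
  Gam_num N z * \prod_(j < N) (a j * a j.+1).
Proof.
elim: N z => [|M IHM] z NK dz.
  rewrite /Gam_den /Gam_num !big_ord0 !mulr1 mul1r.
  rewrite /vandermonde big1 ?expr1n; last by move=> p /andP[_]; rewrite ltn0.
  by rewrite -[1]mpolyX0 LxX /simplex_mon big_ord0.
have d1 : dom 1 := dom_posn 0.
(* This factor makes [simplex_Gam_ratio] applicable, so that only the value at z = 1 is left. *)
apply: (mulfI (Gam_num_neq0 M.+1 d1)).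
suff key : (M.+1)`!%:R * a 1 ^+ M.+1 * L M.+1 1 (Q M.+1) * Gam_den M.+1 1 =
    Gam_num M.+1 1 * \prod_(j < M.+1) (a j * a j.+1).
  transitivity ((M.+1)`!%:R * a 1 ^+ M.+1 *
      (L M.+1 z (Q M.+1) * Gam_den M.+1 z * Gam_num M.+1 1)); first by ring.
  rewrite simplex_Gam_ratio //.
  transitivity (Gam_num M.+1 z *
    ((M.+1)`!%:R * a 1 ^+ M.+1 * L M.+1 1 (Q M.+1) * Gam_den M.+1 1)); first by ring.
  by rewrite key; ring.
have -> : Gam_num M.+1 1 = \prod_(j < M.+1) a j.
  by apply: eq_bigr => j _; rewrite aE gammaE.
have -> : Gam_den M.+1 1 =
    (\prod_(j < M.+1) (1 + b.+1%:R / 2 * (M + j)%:R)) * \prod_(j < M.+1) a (M + j)%N.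
  rewrite -big_split; apply: eq_bigr => j _ /=; rewrite subn1 /= aE.
  rewrite -GamS; last by rewrite gammaE; apply: dom_half.
  by congr Gam; rewrite gammaE natrD; field.
have E1 := simplex_at1 NK.
have db : dom b.+1%:R := dom_posn b.
have := IHM _ (ltnW NK) db.
pose P2 := \prod_(j < M) (b.+1%:R / 2 * j.+2%:R) : F.
have -> : Gam_den M b.+1%:R = \prod_(j < M) a (M + j.+1)%N.
  apply: eq_bigr => -[i iM] _ /=; congr Gam.
  have -> : (M + i.+1 = (M - 1 + i) + 2)%N.
    by move: iM; case: (M) => // M' _; rewrite subn1 /= addn2 addnS.
  by rewrite !(natrD, natrM); field.
move=> IH.
have E2 : P2 * Gam_num M b.+1%:R = \prod_(j < M) a j.+2.
  rewrite -big_split; apply: eq_bigr => j _ /=; rewrite aE.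
  have -> : b.+1%:R + (b.+1 * j)%:R / 2 = b.+1%:R / 2 * j.+2%:R :> F.
    by rewrite natrM -[j.+2%:R]natr1 -natr1; field.
  rewrite -GamS; first by rewrite addrC.
  by rewrite gammaE; apply: domh.
(* The factor M + 1 of the factorial shifts j + 1 to j + 2, the form in which the product is
   absorbed by the functional equation in [E2]. *)
have E3 : (M.+1)`!%:R * \prod_(j < M) (b.+1%:R / 2 * j.+1%:R) = M`!%:R * P2.
  rewrite factS natrM mulrAC mulrC; congr (_ * _).
  rewrite /P2 !big_split /= mulrCA; congr (_ * _).
  transitivity (\prod_(j < M.+1) j.+1%:R : F); first by rewrite big_ord_recr /= mulrC.
  by rewrite big_ord_recl mul1r; apply: eq_bigr.
have a0 : a 0 = 1 by rewrite aE mulr0 addr0.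
have E4 : (\prod_(j < M.+1) a j) * a M.+1 = a 1 * \prod_(j < M) a j.+2.
  transitivity (\prod_(j < M.+2) a j); first by rewrite [RHS]big_ord_recr.
  by rewrite !big_ord_recl a0 mul1r.
have E5 : \prod_(j < M.+1) a (M + j)%N = a M * \prod_(j < M) a (M + j.+1)%N.
  by rewrite big_ord_recl addn0.
have E6 : \prod_(j < M.+1) (a j * a j.+1) =
    \prod_(j < M) (a j * a j.+1) * (a M * a M.+1) by rewrite big_ord_recr.
rewrite E5 E6 exprS.
transitivity (M`!%:R * P2 * L M b.+1%:R (Q M) * (\prod_(j < M) a (M + j.+1)%N) * a 1 ^+ M * (a M * a 1)).
  rewrite -E3.
  transitivity ((M.+1)`!%:R * (a 1 * a 1 ^+ M) * (a M * \prod_(j < M) a (M + j.+1)%N) *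
     ((\prod_(j < M.+1) (1 + b.+1%:R / 2 * (M + j)%:R)) * L M.+1 1 (Q M.+1))).
    by ring.
  by rewrite E1; ring.
transitivity (P2 * (M`!%:R * L M b.+1%:R (Q M) * (\prod_(j < M) a (M + j.+1)%N) * a 1 ^+ M) * (a M * a 1)).
  by ring.
rewrite IH.
transitivity (P2 * Gam_num M b.+1%:R * \prod_(j < M) (a j * a j.+1) * (a M * a 1)).
  by ring.
rewrite E2.
transitivity (\prod_(j < M) (a j * a j.+1) * a M * (a 1 * \prod_(j < M) a j.+2)); first by ring.
by rewrite -E4; ring.
Qed.

End Levels.

End GammaFormula.

(** The expansion as a plain list of coefficients and exponents, the form in which the integrals
    below use it. *)
Definition terms (n b : nat) : seq (int * {ffun 'I_n -> nat}) :=
  [seq ((vandermonde n n ^+ b)@_m, [ffun i => m i]) | m <- msupp (vandermonde n n ^+ b)].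

(** The point x is arbitrary because the expansion is applied to the squares of the variables. *)
Lemma termsE n b (A : comNzRingType) (x : 'I_n -> A) :
  \prod_(j < n) \prod_(k < n | (j < k)%N) (x j - x k) ^+ b =
  \sum_(t <- terms n b) t.1%:~R * \prod_i x i ^+ t.2 i.
Proof.
transitivity (mmap intr x (vandermonde n n ^+ b)); last first.
  rewrite /terms big_map /=; apply: eq_bigr => m _; congr (_ * _).
  by apply: eq_bigr => i _; rewrite ffunE.
rewrite rmorphXn rmorph_prod -prodrXl pair_big_dep /=.
apply: eq_big => [[j k]|[j k] _]; first by rewrite /Vpair /= ltn_ord andbT.
by rewrite rmorphB /= !mmapX !mmap1U.
Qed.

(** Homogeneity: it makes the power of R common to all monomials. *)
Lemma terms_degree n b t : t \in terms n b ->
  (2 * \sum_i t.2 i = b * (n * n.-1))%N.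
Proof.
move=> /mapP[m mQ ->] /=.
have hV : vandermonde n n \is (\sum_(p : 'I_n * 'I_n | (p.1 < p.2)%N) 1).-homog.
  rewrite /vandermonde (eq_bigl (fun p : 'I_n * 'I_n => Vpair n p)); last by [].
  rewrite [X in X.-homog](eq_bigl (Vpair n)); last first.
    by move=> p; rewrite /Vpair ltn_ord andbT.
  elim/big_ind2: _ => [|p d q e hp hq|p _]; first exact: dhomog1.
    exact: dhomogM.
  by rewrite rpredB // dhomogX /= mdeg1.
have := dhomog_mf (dhomogMn b hV) mQ => /= dm.
have -> : \sum_i [ffun i => m i] i = mdeg m.
  by rewrite mdegE; apply: eq_bigr => i _; rewrite ffunE.
rewrite dm mulnA [RHS]mulnC; congr (_ * _)%N.
rewrite -(bin1 n.-1) mul_bin_diag -bin2_sum big_mkord; congr (_ * _)%N.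
transitivity (\sum_(j < n) \sum_(k < n | (j < k)%N) 1)%N; first by rewrite pair_big_dep.
rewrite (exchange_big_dep xpredT) //=; apply: eq_bigr => k _.
by rewrite -(big_ord_widen n (fun=> 1%N) (ltnW (ltn_ord k))) sum1_card card_ord.
Qed.

Lemma terms_simplex (F : numFieldType) (n b : nat) (z : F) :
  \sum_(t <- terms n b) t.1%:~R *
    \prod_(i < n) ((n - i)%:R * z + (\sum_(k < n | (i <= k)%N) t.2 k)%:R)^-1 =
  Lx (@simplex_mon n F n z) (vandermonde n n ^+ b).
Proof.
rewrite /terms big_map /=; apply: eq_bigr => m _; congr (_ * _).
apply: eq_bigr => i _; congr (_ + _%:R)^-1; rewrite /tail.
by apply: eq_big => [k|k _]; rewrite ?ffunE // ltn_ord andbT.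
Qed.

End Selberg.

From mathcomp Require Import complex lra.
From mathcomp Require Import all_classical all_reals all_analysis.
From mathcomp Require Import measurable_realfun.

Import numFieldNormedType.Exports.

Local Open Scope classical_set_scope.
Local Open Scope ring_scope.
Local Open Scope complex_scope.

(** * Improper integrals on the real line *)

Section IsInt.
Variable R : realType.
Local Notation mu := lebesgue_measure.
Local Notation msr := (@measurable _ (measurableTypeR R)).
Local Notation msr_fun := (@measurable_fun _ _ (measurableTypeR R) R).
Implicit Types (D : set R) (f g F : R -> R) (l k : R).

(** Integrability is bundled with the value, since linearity needs it and the integral of any
    function has some value. *)
Definition is_int D f l :=
  mu.-integrable D (EFin \o f) /\ (\int[mu]_(x in D) (f x)%:E)%E = l%:E.

Lemma is_int_ext D f g l : msr D -> (forall x, D x -> f x = g x) -> is_int D f l -> is_int D g l.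
Proof.
move=> mD fg [If E]; split.
  by apply: eq_integrable If => // x; rewrite inE => Dx /=; rewrite fg.
by rewrite -E; apply: eq_integral => x; rewrite inE => Dx; rewrite fg.
Qed.

Lemma is_int_eq D f l k : l = k -> is_int D f l -> is_int D f k.
Proof. by move=> ->. Qed.

Lemma is_int_unique D f l k : is_int D f l -> is_int D f k -> l = k.
Proof. by move=> [_ E] [_]; rewrite E => -[]. Qed.

Lemma is_intZ D f l k : msr D -> is_int D f l -> is_int D (fun x => k * f x) (k * l).
Proof.
move=> mD [If E]; split.
  by apply: (eq_integrable mD _ _ _ (integrableZl mD k If)) => x _ /=; rewrite EFinM.
by rewrite EFinM -E -(integralZl mD If); apply: eq_integral => x _; rewrite EFinM.
Qed.

Lemma is_intD D f g l k : msr D -> is_int D f l -> is_int D g k ->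
  is_int D (fun x => f x + g x) (l + k).
Proof.
move=> mD [If Ef] [Ig Eg]; split.
  by apply: (eq_integrable mD _ _ _ (integrableD mD If Ig)) => x _ /=; rewrite EFinD.
by rewrite EFinD -Ef -Eg -(integralD mD If Ig); apply: eq_integral => x _; rewrite EFinD.
Qed.

Lemma is_int0 D : msr D -> is_int D (fun=> 0) 0.
Proof. by move=> mD; split; [exact: integrable0|rewrite integral0]. Qed.

Lemma is_int_sum D (I : eqType) (T : seq I) (f : I -> R -> R) (l : I -> R) :
  msr D -> (forall i, i \in T -> is_int D (f i) (l i)) ->
  is_int D (fun x => \sum_(i <- T) f i x) (\sum_(i <- T) l i).
Proof.
move=> mD; elim: T => [|i T IHT] H.
  by rewrite big_nil; apply: is_int_ext (is_int0 mD) => // x _; rewrite big_nil.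
rewrite big_cons; apply: is_int_ext (is_intD mD (H i (mem_head i T)) (IHT _)) => //.
  by move=> x _; rewrite big_cons.
by move=> j jT; apply: H; rewrite inE jT orbT.
Qed.

Lemma is_int_Rintegral D f : mu.-integrable D (EFin \o f) -> msr D ->
  is_int D f (\int[mu]_(x in D) f x).
Proof.
move=> If mD; split=> //; rewrite /Rintegral fineK //.
exact: (integrable_fin_num mD If).
Qed.

Lemma is_int_RintegralE D f l : is_int D f l -> \int[mu]_(x in D) f x = l.
Proof. by move=> [_ E]; rewrite /Rintegral E. Qed.

Lemma ftc_segment f F (a b : R) : a < b ->
  (forall x, x \in `[a, b] -> is_derive x 1 F (f x)) ->
  (forall x, x \in `[a, b] -> derivable f x 1) ->
  is_int `[a, b] f (F b - F a).
Proof.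
move=> ab dF df.
have cf : {within `[a, b], continuous f}.
  by apply: derivable_within_continuous.
split; first exact/continuous_compact_integrable/cf/segment_compact.
rewrite (@continuous_FTC2 R f F a b) // ?EFinB //.
- have [_ cFa cFb] : derivable_oo_LRcontinuous F a b.
    split=> [x xab||].
    + by apply: ex_derive; apply: dF; apply: subset_itv_oo_cc xab.
    + apply: cvg_at_right_filter.
      have [dFa _] : is_derive a 1 F (f a) by apply: dF; rewrite in_itv /= lexx ltW.
      exact/differentiable_continuous/derivable1_diffP.
    + apply: cvg_at_left_filter.
      have [dFb _] : is_derive b 1 F (f b) by apply: dF; rewrite in_itv /= lexx ltW.
      exact/differentiable_continuous/derivable1_diffP.
  split=> // x xab; apply: ex_derive; apply: dF; exact: subset_itv_oo_cc xab.
- move=> x xab; rewrite derive1E.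
  have := dF x (subset_itv_oo_cc xab) => dFx; exact: derive_val.
Qed.

(** Exhaustion by segments; the truncations of f are dominated by its absolute value. *)
Lemma ftc_improper D f F (a b : nat -> R) l : msr D ->
  mu.-integrable D (EFin \o f) ->
  (forall n, a n < b n) ->
  (forall n x, x \in `[a n, b n] -> D x) ->
  (forall x, D x -> \forall n \near \oo, x \in `[a n, b n]) ->
  (forall x, D x -> is_derive x 1 F (f x)) ->
  (forall x, D x -> derivable f x 1) ->
  F (b n) - F (a n) @[n --> \oo] --> l ->
  is_int D f l.
Proof.
move=> mD If ab abD Dab dF df cF; split=> //.
pose g n : R -> \bar R := (EFin \o f) \_ `[a n, b n]%classic.
have mg n : measurable_fun D (g n).
  have /integrableP[mf _] := If.
  by apply/(measurable_restrict _ _ _).1 => //; apply: (measurable_funS mD _ mf) => x [].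
have cg x : D x -> g ^~ x @ \oo --> (f x)%:E.
  move=> Dx; apply: cvg_near_cst; near=> n; rewrite /g patchE ifT //.
  by rewrite inE /=; near: n; exact: Dab.
have bg n x : D x -> (`|g n x| <= `|(f x)%:E|)%E.
  by move=> Dx; rewrite /g patchE; case: ifP => // _; rewrite abse0.
have E n : (\int[mu]_(x in D) g n x)%E = (F (b n) - F (a n))%:E.
  rewrite /g -integral_mkcondr setIidr; last by move=> x /= /abD.
  by have [_ ->] := ftc_segment (ab n) (fun x xn => dF x (abD n x xn))
                     (fun x xn => df x (abD n x xn)).
have cint : (\int[mu]_(x in D) g n x)%E @[n --> \oo] --> (\int[mu]_(x in D) (f x)%:E)%E.
  by apply: (dominated_cvg mD mg cg _ (integrable_abse If)).
apply: (cvg_unique _ cint) => //.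
rewrite (_ : (fun n => _) = (fun n => (F (b n) - F (a n))%:E)); last exact/funext.
by apply: cvg_EFin; [near=> n|].
Unshelve. all: end_near.
Qed.

Lemma open_msr D : open D -> msr D.
Proof. by move=> oD; exact: (open_measurable oD). Qed.

Lemma derivable_measurable D f : open D -> (forall x, D x -> derivable f x 1) ->
  msr_fun D f.
Proof.
move=> oD df; apply: open_continuous_measurable_fun => // x; rewrite inE => Dx.
exact/differentiable_continuous/derivable1_diffP/df.
Qed.

(** For f >= 0, Fatou's lemma on the truncations turns convergence of the primitive into
    integrability. *)
Lemma ftc_improper_ge0 D f F (a b : nat -> R) l : open D ->
  (forall x, D x -> 0 <= f x) ->
  (forall n, a n < b n) ->
  (forall n x, x \in `[a n, b n] -> D x) ->
  (forall x, D x -> \forall n \near \oo, x \in `[a n, b n]) ->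
  (forall x, D x -> is_derive x 1 F (f x)) ->
  (forall x, D x -> derivable f x 1) ->
  F (b n) - F (a n) @[n --> \oo] --> l ->
  is_int D f l.
Proof.
move=> oD f0 ab abD Dab dF df cF.
have mD := open_msr oD.
have mf := derivable_measurable oD df.
apply: (@ftc_improper D f F a b l) => //.
pose g n : R -> \bar R := (EFin \o f) \_ `[a n, b n]%classic.
have mg n : measurable_fun D (g n).
  have mEf : measurable_fun D (EFin \o f) by apply/measurable_EFinP.
  by apply/(measurable_restrict _ _ _).1 => //; apply: (measurable_funS mD _ mEf) => x [].
have g0 n x : D x -> (0 <= g n x)%E.
  by move=> Dx; rewrite /g patchE; case: ifP => // _; rewrite lee_fin f0.
have E n : (\int[mu]_(x in D) g n x)%E = (F (b n) - F (a n))%:E.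
  rewrite /g -integral_mkcondr setIidr; last by move=> x /= /abD.
  by have [_ ->] := ftc_segment (ab n) (fun x xn => dF x (abD n x xn))
                     (fun x xn => df x (abD n x xn)).
have := fatou mu mD mg g0.
have -> : (\int[mu]_(x in D) limn_einf (g^~ x) = \int[mu]_(x in D) (f x)%:E)%E.
  apply: eq_integral => x; rewrite inE => Dx.
  suff /cvg_limn_einf_sup[] : g ^~ x @ \oo --> (f x)%:E by [].
  apply: cvg_near_cst; near=> n; rewrite /g patchE ifT //.
  by rewrite inE /=; near: n; exact: Dab.
have -> : limn_einf (fun n => \int[mu]_(x in D) g n x)%E = l%:E.
  suff /cvg_limn_einf_sup[] : (fun n => \int[mu]_(x in D) g n x)%E @ \oo --> l%:E by [].
  rewrite (_ : (fun n => _) = (fun n => (F (b n) - F (a n))%:E)); last exact/funext.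
  by apply: cvg_EFin; [near=> n|].
move=> fl; apply/integrableP; split; first exact/measurable_EFinP.
apply: le_lt_trans (ltry l); apply: le_trans fl.
apply: ge0_le_integral => //.
- by apply: measurableT_comp => //; exact/measurable_EFinP.
- exact/measurable_EFinP.
- by move=> x Dx /=; rewrite lee_fin ger0_norm ?f0.
Unshelve. all: end_near.
Qed.

(** The shift is by 2 and not 1 so that the two cut points are distinct already at n = 0. *)
Lemma natV2_lt (n : nat) : n.+2%:R^-1 < n.+2%:R :> R.
Proof.
rewrite (@lt_trans _ _ 1) // ?invf_lt1 ?ltr0n ?ltr1n //.
Qed.

Lemma itv0y_exhaust (x : R) : x \in `]0, +oo[ ->
  \forall n \near \oo, x \in `[n.+2%:R^-1, n.+2%:R].
Proof.
rewrite in_itv /= andbT => x0; near=> n; rewrite in_itv /=; apply/andP; split.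
  rewrite invf_ple ?posrE // ltW //.
  apply: (@lt_trans _ _ n%:R); last by rewrite ltr_nat.
  by near: n; exact: nbhs_infty_gtr.
apply/ltW/(@lt_trans _ _ n%:R); last by rewrite ltr_nat.
by near: n; exact: nbhs_infty_gtr.
Unshelve. all: end_near.
Qed.

Lemma itv0y_sub n (x : R) : x \in `[n.+2%:R^-1, n.+2%:R] -> x \in `]0, +oo[.
Proof.
by rewrite !in_itv /= andbT => /andP[nx _]; apply: lt_le_trans nx; rewrite invr_gt0.
Qed.

Lemma cvg_nat2_pinfty : (n.+2%:R : R) @[n --> \oo] --> +oo.
Proof.
apply/cvgryPge => A; near=> n; apply: (@le_trans _ _ n%:R); last by rewrite ler_nat -addn2 leq_addr.
by near: n; exact: nbhs_infty_ger.
Unshelve. all: end_near.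
Qed.

Lemma cvg_nat2V : (n.+2%:R^-1 : R) @[n --> \oo] --> (0 : R).
Proof.
apply/cvgrPdist_lt => e e0; near=> n; rewrite sub0r normrN ger0_norm //.
apply: (@lt_trans _ _ n.+1%:R^-1); first by rewrite ltf_pV2 ?posrE // ltr_nat.
by near: n; exact: (near_infty_natSinv_lt (PosNum e0)).
Unshelve. all: end_near.
Qed.

Lemma itv0y_open : open (`]0, +oo[%classic : set R).
Proof. exact: interval_open. Qed.

Lemma ftc0y_cvg F (la lb : R) : F x @[x --> 0^'+] --> la -> F x @[x --> +oo] --> lb ->
  F n.+2%:R - F n.+2%:R^-1 @[n --> \oo] --> lb - la.
Proof.
move=> /cvg_at_rightP Fa /cvg_pinftyP Fb; apply: cvgB.
  by apply: Fb; exact: cvg_nat2_pinfty.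
by apply: Fa; split=> [n|]; [rewrite invr_gt0|exact: cvg_nat2V].
Qed.

Lemma ftc0y f F (la lb : R) : mu.-integrable `]0, +oo[ (EFin \o f) ->
  (forall x : R, 0 < x -> is_derive x 1 F (f x)) ->
  (forall x : R, 0 < x -> derivable f x 1) ->
  F x @[x --> 0^'+] --> la -> F x @[x --> +oo] --> lb ->
  is_int `]0, +oo[ f (lb - la).
Proof.
move=> If dF df Fa Fb.
apply: (ftc_improper (open_msr itv0y_open) If (F := F) natV2_lt).
- by move=> n x /itv0y_sub.
- by move=> x; exact: itv0y_exhaust.
- by move=> x; rewrite /= in_itv /= andbT => /dF.
- by move=> x; rewrite /= in_itv /= andbT => /df.
- exact: ftc0y_cvg.
Qed.

Lemma ftc0y_ge0 f F (la lb : R) : (forall x : R, 0 < x -> 0 <= f x) ->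
  (forall x : R, 0 < x -> is_derive x 1 F (f x)) ->
  (forall x : R, 0 < x -> derivable f x 1) ->
  F x @[x --> 0^'+] --> la -> F x @[x --> +oo] --> lb ->
  is_int `]0, +oo[ f (lb - la).
Proof.
move=> f0 dF df Fa Fb.
apply: (ftc_improper_ge0 itv0y_open (F := F) _ natV2_lt).
- by move=> x; rewrite /= in_itv /= andbT => /f0.
- by move=> n x /itv0y_sub.
- by move=> x; exact: itv0y_exhaust.
- by move=> x; rewrite /= in_itv /= andbT => /dF.
- by move=> x; rewrite /= in_itv /= andbT => /df.
- exact: ftc0y_cvg.
Qed.

Lemma itv0r_cut_gt0 (r : R) (n : nat) : 0 < r -> 0 < r / 2 * n.+2%:R^-1.
Proof. by move=> r0; rewrite mulr_gt0 ?divr_gt0 ?invr_gt0. Qed.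

Lemma itv0r_cut_lt (r : R) (n : nat) : 0 < r ->
  r / 2 * n.+2%:R^-1 < r - r / 2 * n.+2%:R^-1.
Proof.
move=> r0; have : r / 2 * n.+2%:R^-1 < r / 2.
  by rewrite gtr_pMr ?divr_gt0 // invf_lt1 ?ltr1n.
by move: (r / 2 * _) => d; lra.
Qed.

Lemma itv0r_cut_sub (r x : R) (n : nat) : 0 < r ->
  x \in `[r / 2 * n.+2%:R^-1, r - r / 2 * n.+2%:R^-1] -> x \in `]0, r[.
Proof.
move=> r0; have dn0 := itv0r_cut_gt0 n r0; rewrite !in_itv /= => /andP[xl xr].
by rewrite (lt_le_trans dn0 xl) (le_lt_trans xr) // ltrBlDr ltrDl.
Qed.

Lemma cvg_itv0r_cut (r : R) : r / 2 * n.+2%:R^-1 @[n --> \oo] --> (0 : R).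
Proof.
rewrite -[X in _ --> X](mulr0 (r / 2)).
by apply: cvgM; [exact: cvg_cst|exact: cvg_nat2V].
Qed.

Lemma itv0r_cut_exhaust (r x : R) : x \in `]0, r[ ->
  \forall n \near \oo, x \in `[r / 2 * n.+2%:R^-1, r - r / 2 * n.+2%:R^-1].
Proof.
rewrite in_itv /= => /andP[x0 xr]; near=> n.
have h1 : r / 2 * n.+2%:R^-1 < x.
  by near: n; apply: (cvgr_lt (0 : R)) => //; exact: cvg_itv0r_cut.
have h2 : r / 2 * n.+2%:R^-1 < r - x.
  by near: n; apply: (cvgr_lt (0 : R)); [exact: cvg_itv0r_cut|rewrite subr_gt0].
by rewrite in_itv /= (ltW h1) lerBrDr -lerBrDl ltW.
Unshelve. all: end_near.
Qed.

Lemma ftc0r_cvg F (r la lb : R) : 0 < r ->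
  F x @[x --> 0^'+] --> la -> F x @[x --> r^'-] --> lb ->
  F (r - r / 2 * n.+2%:R^-1) - F (r / 2 * n.+2%:R^-1) @[n --> \oo] --> lb - la.
Proof.
move=> r0 /cvg_at_rightP Fa /cvg_at_leftP Fb; apply: cvgB.
  apply: Fb; split=> [n|]; first by rewrite ltrBlDr ltrDl itv0r_cut_gt0.
  by rewrite -[X in _ --> X]subr0; apply: cvgB; [exact: cvg_cst|exact: cvg_itv0r_cut].
by apply: Fa; split=> [n|]; [exact: itv0r_cut_gt0|exact: cvg_itv0r_cut].
Qed.

Lemma ftc0r f F (r la lb : R) : 0 < r -> mu.-integrable `]0, r[ (EFin \o f) ->
  (forall x : R, 0 < x < r -> is_derive x 1 F (f x)) ->
  (forall x : R, 0 < x < r -> derivable f x 1) ->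
  F x @[x --> 0^'+] --> la -> F x @[x --> r^'-] --> lb ->
  is_int `]0, r[ f (lb - la).
Proof.
move=> r0 If dF df Fa Fb.
apply: (@ftc_improper `]0, r[%classic f F (fun n => r / 2 * n.+2%:R^-1)
  (fun n => r - r / 2 * n.+2%:R^-1)) => //.
- by move=> n; exact: itv0r_cut_lt.
- by move=> n x; exact: itv0r_cut_sub.
- by move=> x; exact: itv0r_cut_exhaust.
- exact: ftc0r_cvg.
Qed.

Lemma ftc0r_ge0 f F (r la lb : R) : 0 < r ->
  (forall x : R, 0 < x < r -> 0 <= f x) ->
  (forall x : R, 0 < x < r -> is_derive x 1 F (f x)) ->
  (forall x : R, 0 < x < r -> derivable f x 1) ->
  F x @[x --> 0^'+] --> la -> F x @[x --> r^'-] --> lb ->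
  is_int `]0, r[ f (lb - la).
Proof.
move=> r0 f0 dF df Fa Fb.
apply: (@ftc_improper_ge0 `]0, r[%classic f F (fun n => r / 2 * n.+2%:R^-1)
  (fun n => r - r / 2 * n.+2%:R^-1)) => //.
- by move=> n; exact: itv0r_cut_lt.
- by move=> n x; exact: itv0r_cut_sub.
- by move=> x; exact: itv0r_cut_exhaust.
- exact: ftc0r_cvg.
Qed.

End IsInt.

(** * Exponential and trigonometric integrals *)

Section ExpTrig.
Variable R : realType.
Local Notation mu := lebesgue_measure.
Local Notation msr := (@measurable _ (measurableTypeR R)).
Local Notation msr_fun := (@measurable_fun _ _ (measurableTypeR R) R).
Implicit Types (u s w z : R[i]) (x t : R).

Lemma dom_integrable (D : set R) (f g : R -> R) (l : R) : msr D -> msr_fun D f ->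
  (forall x, D x -> `|f x| <= g x) -> is_int D g l -> mu.-integrable D (EFin \o f).
Proof.
move=> mD mf fg [Ig _]; apply: (le_integrable mD _ _ Ig); first exact/measurable_EFinP.
by move=> x Dx /=; rewrite lee_fin (le_trans (fg x Dx)) // ler_norm.
Qed.

(** 1 / (1 + t^2) is the common majorant of the integrals over t. *)
Lemma is_int_cauchy : is_int [set: R] (fun t => (1 + t ^+ 2)^-1) pi.
Proof.
have -> : (pi : R) = pi / 2 - - (pi / 2) by lra.
apply: (@ftc_improper_ge0 R _ _ (@atan R) (fun n => - n.+2%:R) (fun n => n.+2%:R)) => //.
- exact: openT.
- by move=> x _; rewrite invr_ge0 addr_ge0 // sqr_ge0.
- by move=> n; rewrite lt_neqAle; apply/andP; split; [rewrite lt_eqF //; apply: (@lt_trans _ _ 0); rewrite ?oppr_lt0|rewrite ge0_cp].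
- move=> x _; near=> n; rewrite in_itv /= -ler_norml ltW //.
  apply: (@lt_trans _ _ n%:R); last by rewrite ltr_nat.
  by near: n; exact: nbhs_infty_gtr.
- move=> x _; apply: derivableV; last by [].
  by rewrite gt_eqF // ltr_pwDl // sqr_ge0.
- under eq_fun do rewrite atanN.
  apply: cvgB; last apply: cvgN; (have /cvg_pinftyP H := @cvgy_atan R); apply: H; exact: cvg_nat2_pinfty.
Unshelve. all: end_near.
Qed.

(* tr u x = Re (u e^(ix)) and ce u s x = Re (u e^(sx)). *)
Definition tr u x := complex.Re u * cos x - complex.Im u * sin x.

Definition ce u s x := expR (complex.Re s * x) * tr u (complex.Im s * x).

Lemma ler_tr u x : `|tr u x| <= `|complex.Re u| + `|complex.Im u|.
Proof.
rewrite /tr (le_trans (ler_normB _ _)) // !normrM lerD // ler_piMr //.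
  by rewrite ler_norml cos_geN1 cos_le1.
by rewrite ler_norml sin_geN1 sin_le1.
Qed.

Lemma ler_ce u s x :
  `|ce u s x| <= (`|complex.Re u| + `|complex.Im u|) * expR (complex.Re s * x).
Proof.
rewrite /ce normrM (ger0_norm (expR_ge0 _)) mulrC ler_wpM2r ?expR_ge0 //.
exact: ler_tr.
Qed.

Lemma is_derive_ce u s x : is_derive x 1 (ce u s) (ce (u * s) s x).
Proof.
case: u => a b; case: s => c d; rewrite /ce /tr /=.
by apply: is_derive_eq; rewrite /GRing.scale /=; ring.
Qed.

Lemma derivable_ce u s x : derivable (ce u s) x 1.
Proof. exact: (@ex_derive _ _ _ _ _ _ _ (is_derive_ce u s x)). Qed.

Lemma measurable_ce u s : msr_fun [set: R] (ce u s).
Proof. by apply: derivable_measurable => [|x _]; [exact: openT|exact: derivable_ce]. Qed.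

Lemma is_derive_ce_ln u s t : 0 < t ->
  is_derive t 1 (fun t => ce u s (ln t)) (ce (u * s) (s - 1) (ln t)).
Proof.
move=> t0.
have -> : ce (u * s) (s - 1) (ln t) = ce (u * s) s (ln t) * t^-1.
  case: s => c d; rewrite /ce /= subr0 mulrBl mul1r expRB lnK ?posrE //.
  by rewrite mulrAC.
have dl := is_derive1_ln t0; have dc := is_derive_ce u s (ln t).
exact: (is_derive1_comp dc dl).
Qed.

Lemma derivable_ce_ln u s t : 0 < t -> derivable (fun t => ce u s (ln t)) t 1.
Proof. by move=> t0; exact: (@ex_derive _ _ _ _ _ _ _ (is_derive_ce_ln u s t0)). Qed.

Lemma cvgr_expRM (a : R) : 0 < a -> expR (- a * x) @[x --> +oo] --> (0 : R).
Proof.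
move=> a0.
have -> : (fun x => expR (- a * x)) = (fun x => expR (- x)) \o (fun x => a * x).
  by apply/funext => x /=; rewrite mulNr.
by apply: (cvg_comp _ _ _ (@cvgr_expR R)); apply: gt0_cvgMry.
Qed.

Lemma cvgr_expRln (a : R) : 0 < a -> expR (a * ln t) @[t --> 0^'+] --> (0 : R).
Proof.
move=> a0.
have -> : (fun t => expR (a * ln t)) = (fun x => expR (- a * x)) \o (fun t : R => - ln t).
  by apply/funext => x /=; rewrite mulrNN.
apply: (cvg_comp _ _ _ (cvgr_expRM a0)); apply/cvgNry.
exact: lnNy.
Qed.

Lemma squeeze0_near (T : Type) (F : set_system T) (FF : Filter F) (f g : T -> R) (C : R) :
  (\forall i \near F, `|f i| <= C * g i) -> g i @[i --> F] --> (0 : R) ->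
  f i @[i --> F] --> (0 : R).
Proof.
move=> fg g0; apply/cvgr0Pnorm_le => //.
have Cg : C * g i @[i --> F] --> (0 : R).
  by rewrite -[X in _ --> X](mulr0 C); apply: cvgM => //; exact: cvg_cst.
move=> e e0; near=> i; apply: (@le_trans _ _ (C * g i)); first by near: i.
by near: i; apply: (cvgr_le (0 : R)).
Unshelve. all: end_near.
Qed.

Lemma squeeze0 (T : Type) (F : set_system T) (FF : Filter F) (f g : T -> R) (C : R) :
  (forall i, `|f i| <= C * g i) -> g i @[i --> F] --> (0 : R) ->
  f i @[i --> F] --> (0 : R).
Proof. by move=> fg; apply: squeeze0_near; exact: nearW. Qed.

Lemma is_int_expR (a : R) : 0 < a -> is_int `]0, +oo[ (fun x => expR (- a * x)) a^-1.
Proof.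
move=> a0.
have -> : a^-1 = 0 - (- a^-1 * expR (- a * 0)) by rewrite mulr0 expR0; ring.
apply: (@ftc0y_ge0 R _ (fun x => - a^-1 * expR (- a * x))).
- by move=> x _; exact: expR_ge0.
- move=> x _; apply: is_derive_eq; rewrite /GRing.scale /=; field; exact: lt0r_neq0.
- by move=> x _; apply: ex_derive.
- apply: cvg_at_right_filter; apply: cvgM; first exact: cvg_cst.
  apply: continuous_cvg; first exact: continuous_expR.
  exact: mulrl_continuous.
- rewrite -[X in _ --> X](mulr0 (- a^-1)); apply: cvgM; [exact: cvg_cst|exact: cvgr_expRM].
Qed.

Lemma is_int_ce u s : complex.Re s < 0 ->
  is_int `]0, +oo[ (ce u s) (- complex.Re (u / s)).
Proof.
move=> s0; have a0 : 0 < - complex.Re s by rewrite oppr_gt0.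
have m0y := open_msr (@itv0y_open R).
have Iu : mu.-integrable `]0, +oo[ (EFin \o ce u s).
  apply: (dom_integrable m0y _ _ (is_intZ (`|complex.Re u| + `|complex.Im u|) m0y (is_int_expR a0))).
    by apply: measurable_funTS; exact: measurable_ce.
  by move=> x _; rewrite opprK; exact: ler_ce.
have sn0 : s != 0 by apply: contraTneq s0 => ->; rewrite /= ltxx.
have ce0 : ce (u / s) s 0 = complex.Re (u / s).
  by rewrite /ce /tr !mulr0 expR0 cos0 sin0; ring.
rewrite -ce0 -sub0r; apply: (ftc0y (F := ce (u / s) s) Iu).
- by move=> x _; have := is_derive_ce (u / s) s x; rewrite mulfVK.
- by move=> x _; exact: derivable_ce.
- apply: cvg_at_right_filter; apply: differentiable_continuous.
  exact/derivable1_diffP/derivable_ce.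
- apply: (squeeze0 _ (ler_ce _ _)); rewrite -[complex.Re s]opprK; exact: cvgr_expRM.
Qed.

Lemma is_int_setT_split (f : R -> R) (l1 l2 : R) : mu.-integrable [set: R] (EFin \o f) ->
  is_int `]-oo, 0[ f l1 -> is_int `]0, +oo[ f l2 -> is_int [set: R] f (l1 + l2).
Proof.
move=> If /is_int_RintegralE E1 /is_int_RintegralE E2.
have ET : [set: R] = `]-oo, 0[ `|` `[0, +oo[ :> set R.
  by apply/seteqP; split=> x //= _; rewrite !in_itv /= andbT; case: (ltP x 0); [left|right].
have mT : msr setT by [].
apply: is_int_eq (is_int_Rintegral If mT).
rewrite -E1 -E2 ET Rintegral_setU.
- congr (_ + _); rewrite -Rintegral_itv_obnd_cbnd //.
  exact: (integrableS mT _ _ If).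
- exact: measurable_itv.
- exact: measurable_itv.
- by rewrite -ET.
- by apply/disj_setPS => x [/=]; rewrite !in_itv /= andbT => ?; rewrite leNgt => /negP.
Qed.

Lemma ler_exp_cauchy (e t : R) : 0 < e ->
  expR (- e * `|t|) <= (1 + 2 / e) ^+ 2 * (1 + t ^+ 2)^-1.
Proof.
(* This k satisfies k >= 1 and 2 / k <= e; squaring 1 + |t| <= k e^(|t|/k) then gives (1 + |t|)^2 <=
   k^2 e^(e|t|). *)
move=> e0; set k := 1 + 2 / e.
have k1 : 1 <= k by rewrite lerDl divr_ge0 // ltW.
have k0 : 0 < k by apply: lt_le_trans k1.
have H : 1 + `|t| <= k * expR (`|t| / k).
  have := expR_ge1Dx (`|t| / k) => /(ler_wpM2l (ltW k0)).
  by rewrite mulrDr mulr1 mulrCA divff ?gt_eqF // mulr1; apply: le_trans; rewrite lerD2r.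
have t0 : 0 < 1 + t ^+ 2 by rewrite ltr_pwDl // sqr_ge0.
rewrite ler_pdivlMr // mulNr expRN mulrC ler_pdivrMr ?expR_gt0 //.
apply: (@le_trans _ _ ((1 + `|t|) ^+ 2)).
  by rewrite sqrrD expr1n mul1r real_normK ?num_real // lerD2r lerDl mulrn_wge0.
apply: (@le_trans _ _ ((k * expR (`|t| / k)) ^+ 2)).
  by rewrite lerXn2r ?nnegrE // mulr_ge0 // ?expR_ge0 ltW.
rewrite exprMn ler_wpM2l ?sqr_ge0 // -expRM_natl ler_expR.
rewrite mulrCA mulrC ler_wpM2r //.
rewrite ler_pdivrMr // /k mulrDr mulr1 mulrCA divff ?gt_eqF // mulr1.
by rewrite lerDr ltW.
Qed.

Lemma measurable_tr (w : R -> R[i]) (y : R) :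
  msr_fun setT (fun t => complex.Re (w t)) -> msr_fun setT (fun t => complex.Im (w t)) ->
  msr_fun setT (fun t => tr (w t) (t * y)).
Proof.
move=> mRe mIm; rewrite /tr.
have my : msr_fun setT (fun t => t * y) by apply: measurable_funM.
apply: measurable_funB; apply: measurable_funM => //.
- by apply: (measurableT_comp _ my); apply: continuous_measurable_fun; exact: continuous_cos.
- by apply: (measurableT_comp _ my); apply: continuous_measurable_fun; exact: continuous_sin.
Qed.

Lemma measurable_expNabs (e : R) : msr_fun setT (fun t => expR (- e * `|t|)).
Proof.
apply: measurableT_comp; first exact: measurable_expR.
by apply: measurable_funM => //; apply: measurableT_comp.
Qed.

Lemma is_int_ce_neg u s : 0 < complex.Re s ->
  mu.-integrable `]-oo, 0[ (EFin \o ce u s) ->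
  is_int `]-oo, 0[ (ce u s) (complex.Re (u / s)).
Proof.
move=> s0 Iu.
have sn0 : s != 0 by apply: contraTneq s0 => ->; rewrite /= ltxx.
have ce0 : ce (u / s) s 0 = complex.Re (u / s).
  by rewrite /ce /tr !mulr0 expR0 cos0 sin0; ring.
have mD : msr `]-oo, 0[ by exact: measurable_itv.
apply: (@ftc_improper R `]-oo, 0[%classic (ce u s) (ce (u / s) s)
  (fun n => - n.+2%:R) (fun n => - n.+2%:R^-1) (complex.Re (u / s)) mD Iu).
- by move=> n; rewrite ltrN2; exact: natV2_lt.
- by move=> n x; rewrite /= !in_itv /= => /andP[_] /le_lt_trans -> //; rewrite oppr_lt0 invr_gt0.
- move=> x; rewrite /= in_itv /= => x0; have : - x \in `]0, +oo[.
    by rewrite in_itv /= andbT oppr_gt0.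
  move=> /itv0y_exhaust; apply: filterS => n.
  by rewrite !in_itv /= => /andP[h1 h2]; rewrite lerNl h2 lerNr h1.
- by move=> x _; have := is_derive_ce (u / s) s x; rewrite mulfVK.
- by move=> x _; exact: derivable_ce.
- rewrite -[X in _ --> X]subr0; apply: cvgB.
    rewrite -ce0; apply: continuous_cvg.
      exact/differentiable_continuous/derivable1_diffP/derivable_ce.
    by rewrite -oppr0; apply: cvgN; exact: cvg_nat2V.
  apply: (squeeze0 _ (fun n => ler_ce _ _ (- n.+2%:R))).
  have -> : (fun n => expR (complex.Re s * - n.+2%:R)) =
      (fun x => expR (- complex.Re s * x)) \o (fun n => n.+2%:R).
    by apply/funext => n /=; rewrite mulrN mulNr.
  by apply: (cvg_comp _ _ _ (cvgr_expRM s0)); exact: cvg_nat2_pinfty.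
Qed.

(** The Poisson kernel, obtained from the two half-lines, on each of which the integrand is a pure
    exponential. *)
Lemma is_int_abel (e y : R) u : 0 < e ->
  is_int [set: R] (fun t => expR (- e * `|t|) * tr u (t * y))
    (complex.Re u * (2 * e / (e ^+ 2 + y ^+ 2))).
Proof.
move=> e0; have mT : msr setT by [].
set f := (fun t => _).
have If : mu.-integrable [set: R] (EFin \o f).
  apply: (dom_integrable mT _ _
    (is_intZ ((`|complex.Re u| + `|complex.Im u|) * (1 + 2 / e) ^+ 2) mT is_int_cauchy)).
    apply: measurable_funM; first exact: measurable_expNabs.
    by apply: (measurable_tr (w := fun=> u)).
  move=> t _; rewrite /f normrM mulrC (ger0_norm (expR_ge0 _)) -mulrA.
  by apply: ler_pM; rewrite ?expR_ge0 // ?ler_tr // ler_exp_cauchy.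
have d0 : e ^+ 2 + y ^+ 2 != 0 by rewrite gt_eqF // ltr_pwDl ?sqr_ge0 // exprn_gt0.
have -> : complex.Re u * (2 * e / (e ^+ 2 + y ^+ 2)) =
    complex.Re (u / (e +i* y)) + - complex.Re (u / (- e +i* y)).
  case: u {f If} => a b /=; rewrite sqrrN; field.
  by rewrite d0.
apply: is_int_setT_split => //.
  apply: (@is_int_ext _ _ (ce u (e +i* y))); first exact: measurable_itv.
    by move=> t; rewrite /= in_itv /= /f /ce => t0; rewrite ltr0_norm //= mulrNN [y * t]mulrC.
  apply: is_int_ce_neg => //.
  have mD : msr `]-oo, 0[ by exact: measurable_itv.
  have IfD : mu.-integrable `]-oo, 0[ (EFin \o f) by exact: (integrableS mT _ _ If).
  apply: (eq_integrable mD _ _ _ IfD) => t.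
  by rewrite inE /= in_itv /= /f /ce => t0; rewrite ltr0_norm //= mulrNN [y * t]mulrC.
apply: (@is_int_ext _ _ (ce u (- e +i* y))); first exact: measurable_itv.
  by move=> t; rewrite /= in_itv /= andbT /f /ce => t0; rewrite gtr0_norm //= [y * t]mulrC.
by apply: is_int_ce; rewrite /= oppr_lt0.
Qed.

(** x^z / z is a primitive of x^(z-1); this 1 / z is the pole that each further integration adds. *)
Lemma is_int_power (r : R) u z : 0 < r -> 0 < complex.Re z ->
  is_int `]0, r[ (fun x => ce u (z - 1) (ln x)) (ce (u / z) z (ln r)).
Proof.
move=> r0 z0; set k := complex.Re z in z0 *.
have zn0 : z != 0 by apply: contraTneq z0 => z0; rewrite /k z0 /= ltxx.
have mD : msr `]0, r[ by exact: measurable_itv.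
have Ipow : is_int `]0, r[ (fun x => expR ((k - 1) * ln x)) (k^-1 * expR (k * ln r) - 0).
  apply: (@ftc0r_ge0 R (fun x => expR ((k - 1) * ln x)) (fun x => k^-1 * expR (k * ln x))
    r 0 (k^-1 * expR (k * ln r)) r0).
  - by move=> x _; exact: expR_ge0.
  - move=> x /andP[x0 _]; have dl := is_derive1_ln x0; apply: is_derive_eq.
    rewrite /GRing.scale /= mulrBl mul1r expRB lnK ?posrE //; field.
    by rewrite !gt_eqF.
  - move=> x /andP[x0 _]; have dl := is_derive1_ln x0; exact: ex_derive.
  - rewrite -[X in _ --> X](mulr0 k^-1); apply: cvgM; [exact: cvg_cst|exact: cvgr_expRln].
  - apply: cvg_at_left_filter; have dl := is_derive1_ln r0.
    have : derivable (fun x => k^-1 * expR (k * ln x)) r 1 by exact: ex_derive.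
    by move/derivable1_diffP/differentiable_continuous.
have mf : msr_fun setT (fun x => ce u (z - 1) (ln x)).
  by apply: measurableT_comp; [exact: measurable_ce|exact: measurable_ln].
have If : mu.-integrable `]0, r[ (EFin \o (fun x => ce u (z - 1) (ln x))).
  apply: (dom_integrable mD _ _
    (is_intZ (`|complex.Re u| + `|complex.Im u|) mD Ipow)).
    exact: measurable_funTS.
  move=> x _; have := ler_ce u (z - 1) (ln x).
  by rewrite (_ : complex.Re (z - 1) = k - 1) // /k; case: (z).
rewrite -[X in is_int _ _ X]subr0.
apply: (ftc0r (F := fun x => ce (u / z) z (ln x)) r0 If).
- by move=> x /andP[x0 _]; have := is_derive_ce_ln (u / z) z x0; rewrite mulfVK.
- by move=> x /andP[x0 _]; exact: derivable_ce_ln.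
- by apply: (squeeze0 _ (fun x => ler_ce _ _ (ln x))); exact: cvgr_expRln.
- apply: cvg_at_left_filter.
  by have /derivable1_diffP/differentiable_continuous := @derivable_ce_ln (u / z) z r r0.
Qed.

End ExpTrig.

(** * The inverse Mellin transform of a product of poles *)

Section Fubini.
Variable R : realType.
Local Notation mu := lebesgue_measure.
Local Notation RT := (measurableTypeR R).
Local Notation msr := (@measurable _ RT).
Local Notation msr_fun := (@measurable_fun _ _ RT R).

(** |a(x)| W(t) is an integrable majorant on the product, because the oscillating factor is bounded
    by the size of [w]. The common value c of the two iterated integrals is the form in which
    Fubini's theorem is passed on. *)
Lemma fubini_osc (D : set R) (a l : R -> R) (w : R -> R[i]) (W : R -> R) (lW : R)
    (U G : R -> R) :
  msr D -> mu.-integrable D (EFin \o a) -> msr_fun setT l ->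
  msr_fun setT (fun t => complex.Re (w t)) -> msr_fun setT (fun t => complex.Im (w t)) ->
  (forall t, `|complex.Re (w t)| + `|complex.Im (w t)| <= W t) ->
  is_int [set: R] W lW ->
  (forall x, D x -> is_int [set: R] (fun t => tr (w t) (t * l x)) (U x)) ->
  (forall t, is_int D (fun x => a x * tr (w t) (t * l x)) (G t)) ->
  exists c, is_int D (fun x => a x * U x) c /\ is_int [set: R] G c.
Proof.
move=> mD Ia ml mRe mIm wW IW HU HG.
have mT : msr setT by [].
(* Extension by 0, so that Fubini's theorem is used on the whole plane. *)
pose a' := a \_ D.
pose g (p : RT * RT) : R := a' p.1 * tr (w p.2) (p.2 * l p.1).
pose f (p : RT * RT) : \bar R := (g p)%:E.
have ma' : msr_fun setT a'.
  have /integrableP[/measurable_EFinP ma _] := Ia.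
  by apply/(measurable_restrict _ _ _).1 => //; rewrite setTI.
have Ia' : mu.-integrable [set: R] (EFin \o a').
  have H : mu.-integrable [set: R] ((EFin \o a) \_ D).
    exact: (integrable_mkcond _ mD).1.
  apply: (eq_integrable mT _ _ _ H) => x _; rewrite /a' /= !patchE.
  by case: ifP.
have mg : measurable_fun [set: RT * RT] g.
  rewrite /g; apply: measurable_funM; first exact: measurableT_comp.
  have mp : measurable_fun [set: RT * RT] (fun p => p.2 * l p.1).
    by apply: measurable_funM => //; exact: measurableT_comp.
  rewrite /tr; apply: measurable_funB; apply: measurable_funM.
  - exact: (measurableT_comp mRe).
  - by apply: measurableT_comp mp; apply: continuous_measurable_fun; exact: continuous_cos.
  - exact: (measurableT_comp mIm).
  - by apply: measurableT_comp mp; apply: continuous_measurable_fun; exact: continuous_sin.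
have mf : measurable_fun [set: RT * RT] f by apply/measurable_EFinP.
have mtr x : msr_fun setT (fun t => tr (w t) (t * l x)) by exact: measurable_tr.
have fint x : (\int[mu]_t `|f (x, t)| <= (`|a' x| * lW)%:E)%E.
  have [IaW EaW] := is_intZ (`|a' x|) mT IW.
  rewrite -EaW; apply: ge0_le_integral => //.
  - apply: measurableT_comp => //; apply/measurable_EFinP.
    by rewrite /g /=; apply: measurable_funM.
  - by have /integrableP[] := IaW.
  - move=> t _; rewrite /f /g /= lee_fin normrM ler_wpM2l //.
    by apply: le_trans (wW t); exact: ler_tr.
have If : ((mu : {sigma_finite_measure set RT -> \bar R}) \x
           (mu : {sigma_finite_measure set RT -> \bar R}))%E.-integrable [set: RT * RT] f.
  apply/integrable12ltyP => //.
  have Ia2 : is_int [set: R] (fun x => `|a' x| * lW) (\int[mu]_(x in [set: R]) (`|a' x| * lW)).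
    apply: is_int_Rintegral => //.
    have H : mu.-integrable [set: R] (fun x => lW%:E * `|(a' x)%:E|)%E.
      by apply: integrableZl => //; apply: integrable_abse Ia'.
    by apply: (eq_integrable mT _ _ _ H) => x _ /=; rewrite mulrC EFinM.
  have [I2 E2] := Ia2.
  apply: (@le_lt_trans _ _ (\int[mu]_x (`|a' x| * lW)%:E)%E); last by rewrite E2 ltry.
  apply: ge0_le_integral => //.
  - by move=> x _; exact: integral_ge0.
  - apply: (measurable_fun_fubini_tonelli_F (fun p => `|f p|%E)) => //.
    exact: measurableT_comp.
  - by have /integrableP[] := I2.
have FE x : (\int[mu]_t f (x, t) = (((fun x => (a x * U x)%:E) \_ D) x))%E.
  rewrite patchE; case: ifP => [|/negP Dx].
    rewrite inE => Dx; have [_ E] := is_intZ (a x) mT (HU x Dx).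
    by rewrite -E; apply: eq_integral => t _; rewrite /f /g /a' /= patchE mem_set.
  transitivity (\int[mu]_(t in [set: R]) (0 : \bar R))%E; last by rewrite integral0.
  apply: eq_integral => t _.
  by rewrite /f /g /a' /= patchE; case: ifP => [/Dx //|_]; rewrite mul0r.
have GE t : (\int[mu]_x f (x, t) = (G t)%:E)%E.
  have [_ <-] := HG t; rewrite [RHS]integral_mkcond; apply: eq_integral => x _.
  by rewrite /f /g /a' /= !patchE; case: ifP => // _; rewrite mul0r.
have IF := integrable_fubini_F If.
have IaU : mu.-integrable D (fun x => (a x * U x)%:E).
  apply/(integrable_mkcond _ mD); apply: (eq_integrable mT _ _ _ IF) => x _.
  by rewrite /fubini_F FE.
have c_fin : (\int[mu]_(x in D) (a x * U x)%:E)%E \is a fin_num.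
  exact: integrable_fin_num.
exists (fine (\int[mu]_(x in D) (a x * U x)%:E)%E); split.
  by split=> //; rewrite fineK.
split; last first.
  rewrite fineK // [RHS]integral_mkcond.
  transitivity (\int[mu]_t \int[mu]_x f (x, t))%E.
    by apply: eq_integral => t _; rewrite GE.
  by rewrite -(Fubini If); apply: eq_integral => x _; rewrite FE.
have mG : msr_fun setT G.
  apply/measurable_EFinP; have := measurable_fubini_G If.
  by apply: eq_measurable_fun => t _; rewrite /fubini_G GE.
have [Inorm Enorm] : is_int D (fun x => `|a x|) (\int[mu]_(x in D) `|a x|).
  by apply: is_int_Rintegral => //; exact: integrable_norm.
apply: (dom_integrable mT mG _ (is_intZ (\int[mu]_(x in D) `|a x|) mT IW)) => t _.
have [It Et] := is_intZ (W t) mD (conj Inorm Enorm).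
have [IG EG] := HG t.
rewrite -lee_fin mulrC -Et -abse_EFin -EG.
apply: (le_trans (le_abse_integral _ _ _)) => //; first by have /integrableP[] := IG.
apply: ge0_le_integral => //.
- by apply: measurableT_comp => //; have /integrableP[] := IG.
- by have /integrableP[] := It.
- move=> x _ /=; rewrite lee_fin normrM mulrC ler_wpM2r //.
  by apply: le_trans (wW t); exact: ler_tr.
Qed.

End Fubini.

(** * Abel summation of the transform of one pole *)

Section AbelPole.
Variable R : realType.
Local Notation mu := lebesgue_measure.
Local Notation RT := (measurableTypeR R).
Local Notation msr := (@measurable _ RT).
Local Notation msr_fun := (@measurable_fun _ _ RT R).
Implicit Types (u v w s z : R[i]) (a e x y t L : R).

Lemma is_int_restrict (D D' : set R) (f : R -> R) (l : R) : msr D -> msr D' ->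
  D' `<=` D -> is_int D' f l -> is_int D (f \_ D') l.
Proof.
move=> mD mD' D'D [If Ef].
have E : EFin \o (f \_ D') = (EFin \o f) \_ D'.
  by apply/funext => x; rewrite /= !patchE; case: ifP.
split.
  rewrite E; have := (integrable_mkcond _ mD').1 If.
  exact: integrableS.
rewrite -Ef -{2}(setIidr D'D) integral_mkcondr; apply: eq_integral => x _.
by rewrite -[LHS]/((EFin \o (f \_ D')) x) E.
Qed.

Definition cis x : R[i] := cos x +i* sin x.

Lemma trD u x y : tr u (x + y) = tr (u * cis x) y.
Proof. by case: u => a b; rewrite /tr /= cosD sinD; ring. Qed.

Lemma Re_cis u x : complex.Re (u * cis x) = tr u x.
Proof. by case: u. Qed.

Lemma tr0 u : tr u 0 = complex.Re u.
Proof. by rewrite /tr cos0 sin0; ring. Qed.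

Lemma trZ (k : R) u x : tr (k%:C * u) x = k * tr u x.
Proof. by case: u => a b; rewrite /tr /=; ring. Qed.

Lemma ler_atan2 x : `|2 * atan x| <= pi :> R.
Proof.
rewrite ler_norml; have := atan_ltpi2 x; have := atan_gtNpi2 x; lra.
Qed.

Lemma measurable_atan : msr_fun setT (@atan R).
Proof. by apply: continuous_measurable_fun; exact: continuous_atan. Qed.

Let m0y : msr `]0, +oo[. Proof. exact: open_msr (@itv0y_open R). Qed.

Lemma integrable_exp_bounded a (f : R -> R) (C : R) : 0 < a -> msr_fun setT f ->
  (forall x, `|f x| <= C) ->
  mu.-integrable `]0, +oo[ (EFin \o (fun x => expR (- a * x) * f x)).
Proof.
move=> a0 mf fC; apply: (dom_integrable m0y _ _ (is_intZ C m0y (is_int_expR a0))).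
  apply: measurable_funTS; apply: measurable_funM => //.
  by apply: measurableT_comp; [exact: measurable_expR|exact: measurable_funM].
by move=> x _; rewrite normrM (ger0_norm (expR_ge0 _)) mulrC ler_wpM2r ?expR_ge0.
Qed.

Definition abelJ a e L := \int[mu]_(x in `]0, +oo[) (expR (- a * x) * (2 * atan ((x - L) / e))).
(* The value of the integral of e^(-e|t|) e^(itL) / (a + it) over t. *)
Definition abelq a e L := 2 * atan (L / e) + a * abelJ a e L.

Lemma measurable_atan_shift e L : msr_fun setT (fun x => 2 * atan ((x - L) / e)).
Proof.
apply: measurable_funM => //; apply: measurableT_comp; first exact: measurable_atan.
by apply: measurable_funM => //; exact: measurable_funB.
Qed.

Lemma is_int_abelJ a e L : 0 < a ->
  is_int `]0, +oo[ (fun x => expR (- a * x) * (2 * atan ((x - L) / e))) (abelJ a e L).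
Proof.
move=> a0; apply: is_int_Rintegral => //.
apply: (@integrable_exp_bounded _ _ pi a0); first exact: measurable_atan_shift.
by move=> x; exact: ler_atan2.
Qed.

Lemma ler_abelq a e L : 0 < a -> `|abelq a e L| <= 2 * pi.
Proof.
move=> a0; rewrite mulr2n mulrDl !mul1r (le_trans (ler_normD _ _)) // lerD ?ler_atan2 //.
rewrite normrM (gtr0_norm a0) mulrC -ler_pdivlMr //.
have [IJ EJ] := is_int_abelJ e L a0.
rewrite -lee_fin -abse_EFin -EJ.
apply: (le_trans (le_abse_integral _ _ _)) => //; first by have /integrableP[] := IJ.
have [Ib Eb] := is_intZ pi m0y (is_int_expR a0).
rewrite -Eb; apply: ge0_le_integral => //.
- by apply: measurableT_comp => //; have /integrableP[] := IJ.
- by have /integrableP[] := Ib.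
- move=> x _ /=; rewrite lee_fin normrM (ger0_norm (expR_ge0 _)) mulrC.
  by rewrite ler_wpM2r ?expR_ge0 // ler_atan2.
Qed.

Lemma measurable_cauchy e L : 0 < e -> msr_fun setT (fun x => 2 * e / (e ^+ 2 + (L - x) ^+ 2)).
Proof.
move=> e0; apply: continuous_measurable_fun => x.
apply: cvgM; first exact: cvg_cst.
apply: cvgV; first by rewrite gt_eqF // ltr_pwDl ?sqr_ge0 // exprn_gt0.
have : derivable (fun x => e ^+ 2 + (L - x) ^+ 2) x 1 by exact: ex_derive.
by move/derivable1_diffP/differentiable_continuous.
Qed.

(** Integration by parts, 2 atan ((x - L) / e) being a primitive of the kernel. The kernel reaches 2
    / e at x = L, whereas the form with atan is bounded uniformly in e, as dominated convergence for
    e -> 0 requires. *)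
Lemma is_int_poisson a e L : 0 < a -> 0 < e ->
  is_int `]0, +oo[ (fun x => expR (- a * x) * (2 * e / (e ^+ 2 + (L - x) ^+ 2))) (abelq a e L).
Proof.
move=> a0 e0.
have d0 x : 0 < e ^+ 2 + (L - x) ^+ 2 by rewrite ltr_pwDl ?sqr_ge0 // exprn_gt0.
pose F x := expR (- a * x) * (2 * atan ((x - L) / e)).
pose f x := expR (- a * x) * (2 * e / (e ^+ 2 + (L - x) ^+ 2)).
have If : mu.-integrable `]0, +oo[ (EFin \o f).
  apply: (@integrable_exp_bounded _ _ (2 / e) a0); first exact: measurable_cauchy.
  move=> x; rewrite ger0_norm; last by rewrite divr_ge0 ?mulr_ge0 // ltW.
  rewrite ler_pdivrMr // mulrDr (_ : 2 / e * e ^+ 2 = 2 * e).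
    by rewrite lerDl mulr_ge0 ?sqr_ge0 // divr_ge0 // ltW.
  by field; rewrite gt_eqF.
have [IJ _] := is_intZ (- a) m0y (is_int_abelJ e L a0).
have IF' : mu.-integrable `]0, +oo[ (EFin \o (fun x => f x - a * F x)).
  have H := integrableD m0y If IJ.
  by apply: (eq_integrable m0y _ _ _ H) => x _ /=; rewrite -EFinD /F mulNr.
have : is_int `]0, +oo[ (fun x => f x - a * F x) (0 - F 0).
  apply: (ftc0y (F := F) IF').
  - move=> x _; have da := is_derive1_atan ((x - L) / e).
    rewrite /F /f; apply: is_derive_eq; rewrite /GRing.scale /=; field.
    rewrite !gt_eqF //= -?sqrrN ?opprB //.
  - move=> x _; have da := is_derive1_atan ((x - L) / e); apply: derivableB.
      apply: derivableM; first exact: ex_derive.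
      apply: derivableM; first exact: ex_derive.
      by apply: derivableV; [rewrite gt_eqF|exact: ex_derive].
    by apply: derivableM; exact: ex_derive.
  - apply: cvg_at_right_filter; have da := is_derive1_atan ((0 - L) / e).
    have : derivable F 0 1 by exact: ex_derive.
    by move/derivable1_diffP/differentiable_continuous.
  - apply: (@squeeze0 _ _ +oo _ _ _ pi _ (cvgr_expRM a0)) => x.
    by rewrite /F normrM (ger0_norm (expR_ge0 _)) mulrC ler_wpM2r ?expR_ge0 // ler_atan2.
move=> H; have := is_intD m0y H (is_intZ a m0y (is_int_abelJ e L a0)).
rewrite (_ : 0 - F 0 + a * abelJ a e L = abelq a e L); last first.
  by rewrite /F /abelq mulr0 expR0 (_ : (0 - L) / e = - (L / e)) ?atanN; ring.
by apply: is_int_ext => // x _; rewrite /f /F subrK.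
Qed.

(** 1 / (a + it) is the integral of e^(-(a + it) x) over x > 0; after Fubini the integral over t is
    the Poisson kernel at L - x. *)
Lemma abel_pole a e L u : 0 < a -> 0 < e ->
  is_int [set: R] (fun t => expR (- e * `|t|) * tr (u / (a +i* t)) (t * L))
    (complex.Re u * abelq a e L).
Proof.
move=> a0 e0; have mT : msr setT by [].
pose w t : R[i] := (expR (- e * `|t|))%:C * u.
have n1w t : `|complex.Re (w t)| + `|complex.Im (w t)| =
    expR (- e * `|t|) * (`|complex.Re u| + `|complex.Im u|).
  rewrite /w; case: u {w} => b d /=; rewrite !mul0r subr0 addr0 !normrM.
  by rewrite ger0_norm ?expR_ge0 // mulrDr.
have [] := @fubini_osc R `]0, +oo[ (fun x => expR (- a * x)) (fun x => L - x) w
  (fun t => (`|complex.Re u| + `|complex.Im u|) * (1 + 2 / e) ^+ 2 * (1 + t ^+ 2)^-1)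
  ((`|complex.Re u| + `|complex.Im u|) * (1 + 2 / e) ^+ 2 * pi)
  (fun x => complex.Re u * (2 * e / (e ^+ 2 + (L - x) ^+ 2)))
  (fun t => expR (- e * `|t|) * tr (u / (a +i* t)) (t * L)) => //.
- by have [] := is_int_expR a0.
- exact: measurable_funB.
- rewrite (_ : (fun t => _) = (fun t => complex.Re u * expR (- e * `|t|))).
    by apply: measurable_funM => //; exact: measurable_expNabs.
  by apply/funext => t; rewrite /w; case: (u) => b d /=; rewrite mul0r subr0 mulrC.
- rewrite (_ : (fun t => _) = (fun t => complex.Im u * expR (- e * `|t|))).
    by apply: measurable_funM => //; exact: measurable_expNabs.
  by apply/funext => t; rewrite /w; case: (u) => b d /=; rewrite mul0r addr0 mulrC.
- move=> t; rewrite n1w mulrC -mulrA ler_wpM2l ?addr_ge0 //; exact: ler_exp_cauchy.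
- by apply: is_intZ => //; exact: is_int_cauchy.
- move=> x _; apply: (is_int_ext mT _ (is_int_abel (L - x) u e0)) => t _.
  by rewrite /w trZ.
- move=> t.
  have : is_int `]0, +oo[ (ce (u * cis (t * L)) (- a -i* t)) (tr (u / (a +i* t)) (t * L)).
    have -> : tr (u / (a +i* t)) (t * L) = - complex.Re (u * cis (t * L) / (- a -i* t)).
      have -> : (- a -i* t) = - (a +i* t) by [].
      by rewrite invrN mulrN -Re_cis [u / _ * _]mulrAC; case: (u * _ / _) => b d; rewrite /= opprK.
    by apply: is_int_ce; rewrite /= oppr_lt0.
  move=> /(is_intZ (expR (- e * `|t|)) m0y); apply: is_int_ext => // x _.
  rewrite /ce /w trZ /= (_ : t * (L - x) = t * L + - t * x); last by ring.
  by rewrite trD; ring.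
move=> c [H1 H2].
apply: is_int_eq H2; apply: is_int_unique H1 _.
apply: (is_int_ext m0y _ (is_intZ (complex.Re u) m0y (is_int_poisson L a0 e0))) => x _.
by ring.
Qed.

Lemma cvg_atan_scale (x : R) : x != 0 ->
  2 * atan (x / n.+1%:R^-1) @[n --> \oo] --> (if 0 < x then pi else - pi).
Proof.
have H y : 0 < y -> 2 * atan (y / n.+1%:R^-1) @[n --> \oo] --> (pi : R).
  move=> y0; have -> : (pi : R) = 2 * (pi / 2) by field.
  apply: cvgM; first exact: cvg_cst.
  have /cvg_pinftyP := @cvgy_atan R; apply.
  apply/cvgryPge => A; near=> n; rewrite invrK mulrC -ler_pdivrMr //.
  apply: (@le_trans _ _ n%:R); last by rewrite ler_nat.
  by near: n; exact: nbhs_infty_ger.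
case: (ltgtP 0 x) => // x0 _; first exact: H.
rewrite (_ : (fun n : nat => _) = (fun n : nat => - (2 * atan (- x / n.+1%:R^-1)))).
  by apply: cvgN; apply: H; rewrite oppr_gt0.
by apply/funext => n; rewrite mulNr atanN; ring.
Unshelve. all: end_near.
Qed.

(** The inverse Fourier transform of 1 / (a + it). At the jump L = 0 the value 0 fits the strict
    bound r > sigma_1. *)
Definition pole_fun a L : R := if 0 < L then expR (- a * L) else 0.

Lemma cvg_abelq a L : 0 < a -> L != 0 ->
  abelq a n.+1%:R^-1 L @[n --> \oo] --> 2 * pi * pole_fun a L.
Proof.
move=> a0 L0.
(* The limit of the integrand of [abelJ] away from x = L, where 2 atan tends to -pi on the left and
   to pi on the right. *)
pose s x : R := expR (- a * x) * (if x < L then - pi else pi).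
suff [l [Il El]] : exists l, is_int `]0, +oo[ s l /\
    (if 0 < L then pi else - pi) + a * l = 2 * pi * pole_fun a L.
  rewrite -El; apply: cvgD; first exact: cvg_atan_scale.
  apply: cvgM; first exact: cvg_cst.
  pose fn (n : nat) x := (expR (- a * x) * (2 * atan ((x - L) / n.+1%:R^-1)))%:E.
  have [Is Es] := Il.
  have [] := @dominated_convergence _ _ _ mu `]0, +oo[%classic m0y fn (EFin \o s)
    (fun x => (pi * expR (- a * x))%:E).
  - by move=> n; have [/integrableP[] ] := is_int_abelJ n.+1%:R^-1 L a0.
  - by have /integrableP[] := Is.
  - exists [set L]; split; [exact: measurable_set1|exact: lebesgue_measure_set1|].
    move=> x /=; apply: contra_notP => /eqP xL _; apply: cvg_EFin; first by near=> n.
    apply: cvgM; first exact: cvg_cst.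
    have xL' : x - L != 0 by rewrite subr_eq0.
    have := cvg_atan_scale xL'; rewrite subr_gt0.
    by case: (ltgtP x L) xL => // ->; rewrite eqxx.
  - by have [] := is_intZ pi m0y (is_int_expR a0).
  - apply: aeW => x n _; rewrite /fn /= lee_fin normrM (ger0_norm (expR_ge0 _)) mulrC.
    by rewrite ler_wpM2r ?expR_ge0 // ler_atan2.
  move=> _ _; rewrite Es => H.
  have E n : (\int[mu]_(x in `]0%R, +oo[) fn n x)%E = (abelJ a n.+1%:R^-1 L)%:E.
    by have [_ ->] := is_int_abelJ n.+1%:R^-1 L a0.
  have : (abelJ a n.+1%:R^-1 L)%:E @[n --> \oo] --> l%:E.
    by apply: cvg_trans H; apply: near_eq_cvg; near=> n; rewrite /= E.
  by move/fine_cvgP => [].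
have Iexp := is_int_expR a0.
have [L0'|L0'] := ltP 0 L; last first.
  exists (pi * a^-1); split; last first.
    by rewrite /pole_fun ltNge L0' /= mulr0; field; rewrite gt_eqF.
  apply: (is_int_ext m0y _ (is_intZ pi m0y Iexp)) => x.
  by rewrite /= in_itv /= andbT /s => x0; rewrite ltNge (le_trans L0' (ltW x0)) /= mulrC.
(* On ]0, L[ the sign is negative, hence the correction by -2 pi times the integral over ]0, L[. *)
exists (pi * a^-1 + - (2 * pi) * ((1 - expR (- a * L)) / a)); split; last first.
  by rewrite /pole_fun L0'; field; rewrite gt_eqF.
have mL : msr `]0, L[ by exact: measurable_itv.
have I0L : is_int `]0, L[ (fun x => expR (- a * x)) ((1 - expR (- a * L)) / a).
  have -> : (1 - expR (- a * L)) / a = - a^-1 * expR (- a * L) - - a^-1 * expR (- a * 0).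
    by rewrite mulr0 expR0; field; rewrite gt_eqF.
  have dF x : is_derive x 1 (fun x => - a^-1 * expR (- a * x)) (expR (- a * x)).
    by apply: is_derive_eq; rewrite /GRing.scale /=; field; rewrite gt_eqF.
  apply: (@ftc0r_ge0 R (fun x => expR (- a * x)) (fun x => - a^-1 * expR (- a * x)) L
     (- a^-1 * expR (- a * 0)) (- a^-1 * expR (- a * L)) L0').
  - by move=> x _; exact: expR_ge0.
  - by move=> x _; exact: ex_derive.
  - apply: cvg_at_right_filter.
    by have /derivable1_diffP/differentiable_continuous := @ex_derive _ _ _ _ _ _ _ (dF 0).
  - apply: cvg_at_left_filter.
    by have /derivable1_diffP/differentiable_continuous := @ex_derive _ _ _ _ _ _ _ (dF L).
have L0y : (`]0, L[%classic : set R) `<=` `]0, +oo[%classic.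
  by move=> x; rewrite /= !in_itv /= andbT => /andP[].
have Ires := is_int_restrict m0y mL L0y I0L.
have := is_intD m0y (is_intZ pi m0y Iexp) (is_intZ (- (2 * pi)) m0y Ires).
apply: is_int_ext => // x; rewrite /= in_itv /= andbT /s patchE => x0.
case: ifP => [|/negP H]; rewrite ?inE /= ?in_itv /=.
  by move=> /andP[_ ->] /=; move: (expR _) (@pi R) => E P; ring.
rewrite ifF; first by rewrite [X in _ + _ * X](_ : _ = 0) // mulr0 addr0 mulrC.
by apply/negP => xL; apply: H; rewrite inE /= in_itv /= x0.
Unshelve. all: end_near.
Qed.

End AbelPole.

(** * One more pole for each integration *)

Section Poles.
Variable R : realType.
Local Notation mu := lebesgue_measure.
Local Notation RT := (measurableTypeR R).
Local Notation msr := (@measurable _ RT).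
Local Notation msr_fun := (@measurable_fun _ _ RT R).
Implicit Types (u v z : R[i]) (a x y t k nu lam r : R) (w : R -> R[i]).

(** This norm bounds [tr] directly, is submultiplicative and involves no square root. *)
Definition l1norm z := `|complex.Re z| + `|complex.Im z|.

Lemma l1norm_ge0 z : 0 <= l1norm z. Proof. by rewrite addr_ge0. Qed.

Lemma l1normM u v : l1norm (u * v) <= l1norm u * l1norm v.
Proof.
case: u => a b; case: v => c d; rewrite /l1norm /=.
apply: (@le_trans _ _ (`|a * c| + `|b * d| + (`|a * d| + `|b * c|))).
  by rewrite lerD ?ler_normB ?ler_normD.
by rewrite !normrM le_eqVlt; apply/orP; left; apply/eqP; ring.
Qed.

Lemma invC a y : (a +i* y)^-1 = (a / (a ^+ 2 + y ^+ 2)) -i* (y / (a ^+ 2 + y ^+ 2)) :> R[i].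
Proof. by []. Qed.

Definition cmeasurable w := msr_fun setT (fun t => complex.Re (w t)) /\
  msr_fun setT (fun t => complex.Im (w t)).

Lemma cmeasurable_M w w' : cmeasurable w -> cmeasurable w' -> cmeasurable (fun t => w t * w' t).
Proof.
move=> [mR mI] [mR' mI']; split.
  have -> : (fun t => complex.Re (w t * w' t)) =
     (fun t => complex.Re (w t) * complex.Re (w' t) - complex.Im (w t) * complex.Im (w' t)).
    by apply/funext => t; case: (w t) => ? ?; case: (w' t).
  by apply: measurable_funB; apply: measurable_funM.
have -> : (fun t => complex.Im (w t * w' t)) =
   (fun t => complex.Re (w t) * complex.Im (w' t) + complex.Im (w t) * complex.Re (w' t)).
  by apply/funext => t; case: (w t) => ? ?; case: (w' t).
by apply: measurable_funD; apply: measurable_funM.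
Qed.

Lemma cmeasurable_cst u : cmeasurable (fun=> u).
Proof. by split; exact: measurable_cst. Qed.

Lemma cmeasurable_real (f : R -> R) : msr_fun setT f -> cmeasurable (fun t => (f t)%:C).
Proof. by move=> mf; split=> //; exact: measurable_cst. Qed.

Definition pole k nu t : R[i] := (k +i* (nu * t))^-1.

Lemma cmeasurable_pole k nu : 0 < k -> cmeasurable (pole k nu).
Proof.
move=> k0.
have d0 t : k ^+ 2 + (nu * t) ^+ 2 != 0 by rewrite gt_eqF // ltr_pwDl ?sqr_ge0 // exprn_gt0.
have md : msr_fun setT (fun t => (k ^+ 2 + (nu * t) ^+ 2)^-1).
  apply: continuous_measurable_fun => t; apply: cvgV; first exact: d0.
  have : derivable (fun t => k ^+ 2 + (nu * t) ^+ 2) t 1 by exact: ex_derive.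
  by move/derivable1_diffP/differentiable_continuous.
split.
  by apply: measurable_funM => //; exact: measurable_cst.
have -> : (fun t => complex.Im (pole k nu t)) =
    (fun t => - nu * t * (k ^+ 2 + (nu * t) ^+ 2)^-1).
  by apply/funext => t; rewrite /pole invC /= !mulNr.
by apply: measurable_funM => //; apply: measurable_funM.
Qed.

Lemma l1norm_pole k nu : 0 < k -> 0 < nu ->
  exists2 C : R, 0 <= C & forall t, l1norm (pole k nu t) <= C / (1 + `|t|).
Proof.
(* The constant 2 / m comes from m (1 + |t|) <= k + nu |t| and (k + nu |t|)^2 <= 2 (k^2 + nu^2
   t^2). *)
move=> k0 nu0; pose m := Num.min k nu.
have m0 : 0 < m by rewrite lt_min k0.
exists (2 / m) => [|t]; first by rewrite divr_ge0 // ltW.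
rewrite /l1norm /pole invC /= normrN !normrM (gtr0_norm k0) (gtr0_norm nu0).
have d0 : 0 < k ^+ 2 + (nu * t) ^+ 2 by rewrite ltr_pwDl ?sqr_ge0 // exprn_gt0.
rewrite (@gtr0_norm _ _^-1) ?invr_gt0 // -mulrDl.
have t0 := normr_ge0 t.
rewrite ler_pdivrMr // mulrAC ler_pdivlMr ?ltr_pwDl //.
have mk : m <= k by rewrite ge_min lexx.
have mnu : m <= nu by rewrite ge_min lexx orbT.
rewrite exprMn -[t ^+ 2]real_normK ?num_real //.
set s := `|t| in t0 *.
have ms : m * (1 + s) <= k + nu * s.
  by rewrite mulrDr mulr1 lerD // ler_wpM2r.
rewrite mulrAC ler_pdivlMr //.
apply: (@le_trans _ _ ((k + nu * s) * (k + nu * s))).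
  by rewrite -mulrA [_ * m]mulrC ler_wpM2l // addr_ge0 ?mulr_ge0 // ltW.
have := sqr_ge0 (k - nu * s); rewrite -subr_ge0 => H; rewrite -subr_ge0.
by apply: le_trans H _; rewrite le_eqVlt; apply/orP; left; apply/eqP; ring.
Qed.

(** The integral of x^(k - 1 + i nu t) over ]0, r[ is r^(k + i nu t) / (k + i nu t): a new pole
    appears and the phase passes from ln x to ln r. *)
Lemma is_int_inner k nu lam r t v : 0 < r -> 0 < k ->
  is_int `]0, r[ (fun x => expR ((k - 1) * ln x) * tr v (t * (lam + nu * ln x)))
    (expR (k * ln r) * tr (v * pole k nu t) (t * (lam + nu * ln r))).
Proof.
move=> r0 k0; have mD : msr `]0, r[ by exact: measurable_itv.
have k0' : 0 < complex.Re (k +i* (nu * t)) by [].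
have := is_int_power (v * cis (t * lam)) r0 k0'.
rewrite [X in is_int _ _ X](_ : _ =
    expR (k * ln r) * tr (v * pole k nu t) (t * (lam + nu * ln r))); last first.
  rewrite /ce /= [t * (lam + _)]mulrDr trD -/(pole k nu t) [v * _ * _]mulrAC.
  by congr (_ * tr _ _); ring.
apply: is_int_ext => // x _; rewrite /ce /= [t * (lam + _)]mulrDr trD subr0.
by congr (_ * tr _ _); ring.
Qed.

Lemma integrable_power k r : 0 < r -> 0 < k ->
  mu.-integrable `]0, r[ (EFin \o (fun x => expR ((k - 1) * ln x))).
Proof.
move=> r0 k0; have mD : msr `]0, r[ by exact: measurable_itv.
have [I _] := is_int_inner 0 0 0 1 r0 k0.
by apply: (eq_integrable mD _ _ _ I) => x _; rewrite /= mul0r tr0 /= mulr1.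
Qed.

Lemma measurable_log_phase lam nu : msr_fun setT (fun x => lam + nu * ln x).
Proof.
apply: measurable_funD; first exact: measurable_cst.
by apply: measurable_funM; [exact: measurable_cst|exact: measurable_ln].
Qed.

(** For an absolutely integrable [w] with inverse transform U: integrating U against x^(k-1)
    multiplies [w] by one more pole. *)
Lemma fubini_step k nu lam r w (W : R -> R) (lW : R) (U : R -> R) : 0 < r -> 0 < k ->
  cmeasurable w -> (forall t, l1norm (w t) <= W t) -> is_int [set: R] W lW ->
  (forall L, is_int [set: R] (fun t => tr (w t) (t * L)) (U L)) ->
  exists c, is_int `]0, r[ (fun x => expR ((k - 1) * ln x) * U (lam + nu * ln x)) c /\
    is_int [set: R] (fun t => expR (k * ln r) *
      tr (w t * pole k nu t) (t * (lam + nu * ln r))) c.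
Proof.
move=> r0 k0 [mR mI] wW IW HU; have mD : msr `]0, r[ by exact: measurable_itv.
apply: (@fubini_osc R `]0, r[%classic (fun x => expR ((k - 1) * ln x))
  (fun x => lam + nu * ln x) w W lW (fun x => U (lam + nu * ln x))) => //.
- exact: integrable_power.
- exact: measurable_log_phase.
- by move=> t; exact: is_int_inner.
Qed.

Lemma is_int_cauchyZ (C : R) : is_int [set: R] (fun t => C * (1 + t ^+ 2)^-1) (C * pi).
Proof. by apply: is_intZ; [exact: measurableT|exact: is_int_cauchy]. Qed.

Lemma inv_sqr_le t : (1 + `|t|)^-1 ^+ 2 <= (1 + t ^+ 2)^-1.
Proof.
have t0 := normr_ge0 t.
rewrite exprVn lef_pV2 ?posrE ?exprn_gt0 ?ltr_pwDl ?sqr_ge0 //.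
by rewrite sqrrD expr1n mul1r real_normK ?num_real // lerD2r lerDl mulrn_wge0.
Qed.

Lemma measurable_pole_fun a : msr_fun setT (pole_fun a).
Proof.
rewrite /pole_fun; apply: measurable_fun_ifT => //.
- by apply: measurable_fun_ltr => //; exact: measurable_cst.
- by apply: measurableT_comp; [exact: measurable_expR|exact: measurable_funM].
Qed.

(* The transform of a single pole is not absolutely convergent: Fubini is applied
   with the factor e^(-e|t|), and e tends to 0 by dominated convergence. *)
Lemma two_poles a k nu lam r u : 0 < a -> 0 < k -> 0 < nu -> 0 < r ->
  exists c, is_int `]0, r[ (fun x => expR ((k - 1) * ln x) *
      (complex.Re u * (2 * pi * pole_fun a (lam + nu * ln x)))) c /\
    is_int [set: R] (fun t => expR (k * ln r) *
      tr (u * pole a 1 t * pole k nu t) (t * (lam + nu * ln r))) c.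
Proof.
move=> a0 k0 nu0 r0.
have mD : msr `]0, r[ by exact: measurable_itv.
have mT : msr setT by [].
have [C1 C10 H1] := l1norm_pole a0 (ltr01 : 0 < 1 :> R).
have [C2 C20 H2] := l1norm_pole k0 nu0.
pose w e t : R[i] := (expR (- e * `|t|))%:C * (u * pole a 1 t).
have mw e : cmeasurable (w e).
  exact: (cmeasurable_M (cmeasurable_real (measurable_expNabs e)) (cmeasurable_M (cmeasurable_cst u) (cmeasurable_pole 1 a0))).
have l1normE e t v : l1norm ((expR (- e * `|t|))%:C * v) = expR (- e * `|t|) * l1norm v.
  case: v => b d; rewrite /l1norm /= !mul0r subr0 addr0 !normrM.
  by rewrite ger0_norm ?expR_ge0 // mulrDr.
have l1norm_p t : l1norm (pole a 1 t) <= C1.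
  apply: (le_trans (H1 t)); rewrite ler_pdivrMr ?ltr_pwDl //.
  by rewrite mulrDr mulr1 lerDl mulr_ge0.
have step e : 0 < e -> exists c, is_int `]0, r[ (fun x => expR ((k - 1) * ln x) *
      (complex.Re u * abelq a e (lam + nu * ln x))) c /\
    is_int [set: R] (fun t => expR (k * ln r) *
      tr (w e t * pole k nu t) (t * (lam + nu * ln r))) c.
  move=> e0; apply: (@fubini_step k nu lam r (w e)
    (fun t => l1norm u * C1 * (1 + 2 / e) ^+ 2 * (1 + t ^+ 2)^-1)
    (l1norm u * C1 * (1 + 2 / e) ^+ 2 * pi)
    (fun L => complex.Re u * abelq a e L) r0 k0 (mw e)).
  - move=> t; rewrite /w l1normE mulrC -mulrA; apply: ler_pM; rewrite ?l1norm_ge0 ?expR_ge0 //.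
      by apply: (le_trans (l1normM _ _)); rewrite ler_wpM2l ?l1norm_ge0.
    exact: ler_exp_cauchy.
  - exact: is_int_cauchyZ.
  - move=> L; apply: (is_int_ext mT _ (abel_pole L u a0 e0)) => t _.
    by rewrite /w trZ /pole mul1r.
pose en (n : nat) : R := n.+1%:R^-1.
have en0 n : 0 < en n by rewrite invr_gt0.
have [c cP] := choice (fun n => step (en n) (en0 n)).
pose fx n x := (expR ((k - 1) * ln x) * (complex.Re u * abelq a (en n) (lam + nu * ln x)))%:E.
pose gx x := (expR ((k - 1) * ln x) *
   (complex.Re u * (2 * pi * pole_fun a (lam + nu * ln x))))%:E.
have mgx : measurable_fun (`]0, r[%classic : set RT) gx.
  apply/measurable_EFinP; apply: measurable_funTS; apply: measurable_funM.
    by apply: measurableT_comp; [exact: measurable_expR|apply: measurable_funM => //; exact: measurable_ln].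
  apply: measurable_funM => //; apply: measurable_funM => //.
  by apply: measurableT_comp; [exact: measurable_pole_fun|exact: measurable_log_phase].
have Ipow := is_int_Rintegral (integrable_power r0 k0) mD.
have [Ig cx] : mu.-integrable `]0, r[ gx /\
    (\int[mu]_(x in `]0%R, r[) fx n x)%E @[n --> \oo] --> (\int[mu]_(x in `]0%R, r[) gx x)%E.
  have [] // := @dominated_convergence _ _ _ mu `]0, r[%classic mD fx gx
    (fun x => (`|complex.Re u| * (2 * pi) * expR ((k - 1) * ln x))%:E).
  - by move=> n; have [[/integrableP[]]] := cP n.
  (* The only x with lam + nu ln x = 0, where [cvg_abelq] does not apply; one point is
     negligible. *)
  - exists [set expR (- lam / nu)]; split;
      [exact: measurable_set1|exact: lebesgue_measure_set1|].
    move=> x /=; apply: contra_notP => xL; rewrite in_itv /= => /andP[x0 _].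
    have L0 : lam + nu * ln x != 0.
      apply/negP => /eqP E; apply: xL; rewrite -[LHS]lnK ?posrE //; congr expR.
      apply: (mulfI (lt0r_neq0 nu0)).
      by rewrite mulrCA divff ?gt_eqF // mulr1 -[RHS]add0r -E; ring.
    apply: cvg_EFin; first by near=> n.
    apply: cvgM; first exact: cvg_cst.
    by apply: cvgM; [exact: cvg_cst|exact: cvg_abelq].
  - by have [] := is_intZ (`|complex.Re u| * (2 * pi)) mD Ipow.
  - apply: aeW => x n _; rewrite /fx /= lee_fin normrM (ger0_norm (expR_ge0 _)) mulrC.
    by rewrite ler_wpM2r ?expR_ge0 // normrM ler_wpM2l // ler_abelq.
pose ft n t := (expR (k * ln r) * tr (w (en n) t * pole k nu t) (t * (lam + nu * ln r)))%:E.
pose gt t := (expR (k * ln r) * tr (u * pole a 1 t * pole k nu t) (t * (lam + nu * ln r)))%:E.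
have mgt : measurable_fun [set: RT] gt.
  apply/measurable_EFinP; apply: measurable_funM => //.
  have [mR mI] : cmeasurable (fun t => u * pole a 1 t * pole k nu t).
    exact: (cmeasurable_M (cmeasurable_M (cmeasurable_cst u) (cmeasurable_pole 1 a0)) (cmeasurable_pole nu k0)).
  exact: measurable_tr.
have [It ct] : mu.-integrable [set: R] gt /\
    (\int[mu]_(t in [set: R]) ft n t)%E @[n --> \oo] --> (\int[mu]_(t in [set: R]) gt t)%E.
  have [] // := @dominated_convergence _ _ _ mu [set: R] mT ft gt
    (fun t => (expR (k * ln r) * l1norm u * C1 * C2 * (1 + t ^+ 2)^-1)%:E).
  - by move=> n; have [_ [/integrableP[]]] := cP n.
  - apply: aeW => t _; apply: cvg_EFin; first by near=> n.
    apply: cvgM; first exact: cvg_cst.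
    have -> : (fun n => tr (w (en n) t * pole k nu t) (t * (lam + nu * ln r))) =
      (fun n => expR (- en n * `|t|) * tr (u * pole a 1 t * pole k nu t) (t * (lam + nu * ln r))).
      by apply/funext => n; rewrite /w -mulrA trZ.
    rewrite -[X in _ --> X]mul1r; apply: cvgM; last exact: cvg_cst.
    rewrite -[X in _ --> X]expR0; apply: continuous_cvg; first exact: continuous_expR.
    have -> : (0 : R) = - 0 * `|t| by rewrite oppr0 mul0r.
    by apply: cvgM; [apply: cvgN; exact: cvg_harmonic|exact: cvg_cst].
  - by have [] := is_int_cauchyZ (expR (k * ln r) * l1norm u * C1 * C2).
  - apply: aeW => t n _; rewrite /ft /= lee_fin normrM (ger0_norm (expR_ge0 _)) -!mulrA.
    rewrite ler_wpM2l ?expR_ge0 //; apply: (le_trans (ler_tr _ _)).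
    rewrite -/(l1norm _) l1normE.
    apply: (@le_trans _ _ (l1norm (u * (pole a 1 t * pole k nu t)))).
      by rewrite ler_piMl ?l1norm_ge0 // -expR0 ler_expR mulNr oppr_le0 mulr_ge0 // ltW.
    apply: (le_trans (l1normM _ _)); rewrite ler_wpM2l ?l1norm_ge0 //.
    apply: (le_trans (l1normM _ _)).
    apply: (@le_trans _ _ (C1 / (1 + `|t|) * (C2 / (1 + `|t|)))).
      by apply: ler_pM; rewrite ?l1norm_ge0.
    rewrite mulrACA [leRHS]mulrA ler_wpM2l ?mulr_ge0 // -expr2; exact: inv_sqr_le.
have E n : (\int[mu]_(x in `]0%R, r[) fx n x = \int[mu]_(t in [set: R]) ft n t)%E.
  by have [[_ ->] [_ ->]] := cP n.
have Efx : (\int[mu]_(x in `]0%R, r[) gx x = \int[mu]_(t in [set: R]) gt t)%E.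
  apply: cvg_unique cx _ => //.
  by apply: cvg_trans ct; apply: near_eq_cvg; near=> n; rewrite /= E.
have fin : (\int[mu]_(t in [set: R]) gt t)%E \is a fin_num.
  exact: integrable_fin_num.
exists (fine (\int[mu]_(t in [set: R]) gt t)%E); split; split=> //; rewrite fineK //.
Unshelve. all: end_near.
Qed.

End Poles.

(** * The delta-integral of a monomial and its Mellin inversion *)

Section SimplexIntegral.
Variables (R : realType) (c : R).
Hypothesis c1_gt0 : 0 < c + 1.
Local Notation mu := lebesgue_measure.
Local Notation RT := (measurableTypeR R).
Local Notation msr := (@measurable _ RT).
Implicit Types (u : R[i]) (x t r p L : R) (es : seq nat).

(** Each variable adds c + e + 1: e from the monomial, c from the factor p^c of [delta_formula] when
    p becomes p x, and 1 from integrating. *)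
Definition exponent es : R := (size es)%:R * c + (sumn (map S es))%:R.

Fixpoint poles es t : R[i] :=
  if es is e :: es' then poles es' t * pole (exponent es) (size es)%:R t else 1.

(* The delta-integral over r > s_0 > ... > s_m > 0, p s_0 ... s_m = 1, of the
   monomial with exponents es. *)
Fixpoint simplex_delta es r p : R :=
  match es with
  | [::] => 0
  | [:: e] => if p^-1 < r then p^-1 ^+ e.+1 else 0
  | e :: es' => \int[mu]_(x in `]0, r[) (x ^+ e * simplex_delta es' x (p * x))
  end.

Lemma exponent_cons e es : exponent (e :: es) = exponent es + c + e.+1%:R.
Proof. by rewrite /exponent /= natrD -[(size es).+1%:R]natr1; ring. Qed.

Lemma exponent_gt0 es : es != [::] -> 0 < exponent es.
Proof.
elim: es => // e es IHes _; rewrite exponent_cons -natr1.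
case: (eqVneq es [::]) => [->|/IHes es0].
  rewrite {1}/exponent /= mul0r !add0r; have := c1_gt0; have : 0 <= e%:R :> R by []; lra.
have : 0 <= e%:R :> R by []; have := c1_gt0; lra.
Qed.

Lemma natpow_expR x n : 0 < x -> x ^+ n = expR (n%:R * ln x).
Proof. by move=> x0; rewrite expRM_natl lnK. Qed.

(** Only Re u enters because the transform is real: the values of [poles] at t and -t are
    conjugate. *)
Definition inversion es (kp : R -> R) :=
  (forall u L, is_int [set: R] (fun t => tr (u * poles es t) (t * L))
    (complex.Re u * (2 * pi * kp L))).

(** A scaling law: apart from powers of p and r, the delta-integral depends on p and r^(size es)
    through their product, whose logarithm is the Fourier variable. *)
Definition delta_formula es (kp : R -> R) :=
  (forall r p, 0 < r -> 0 < p ->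
    simplex_delta es r p = expR (c * ln p + exponent es * ln r) *
      kp (ln p + (size es)%:R * ln r)).

(** The exchange of integrals is a hypothesis because it has two sources: [two_poles] for the second
    variable, [fubini_step] for the later ones. *)
Lemma delta_step e es (kp : R -> R) : es != [::] ->
  delta_formula es kp ->
  (forall u L r, 0 < r -> exists cu,
    is_int `]0, r[ (fun x => expR ((exponent (e :: es) - 1) * ln x) *
      (complex.Re u * (2 * pi * kp (L + (size (e :: es))%:R * ln x)))) cu /\
    is_int [set: R] (fun t => expR (exponent (e :: es) * ln r) *
      tr (u * poles (e :: es) t) (t * (L + (size (e :: es))%:R * ln r))) cu) ->
  (forall r p, 0 < r -> 0 < p -> is_int `]0, r[
     (fun x => x ^+ e * simplex_delta es x (p * x)) (simplex_delta (e :: es) r p)) /\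
  exists kp', inversion (e :: es) kp' /\ delta_formula (e :: es) kp'.
Proof.
move=> es0 HK HR; set k := exponent (e :: es) in HR *; set nu := (size (e :: es))%:R in HR *.
have mT : msr setT by [].
have mD r : msr `]0, r[ by exact: measurable_itv.
(* u = 1 suffices: by the identity in x, the integral for any u is Re u times this one. *)
pose kp' L := (2 * pi)^-1 * \int[mu]_(t in [set: R]) tr (1 * poles (e :: es) t) (t * L).
have pi2 : 2 * pi != 0 :> R by rewrite mulf_neq0 // gt_eqF // pi_gt0.
have inv1 L : is_int [set: R] (fun t => tr (1 * poles (e :: es) t) (t * L)) (2 * pi * kp' L).
  have [cu [_ [I _]]] := HR 1 L 1 ltr01.
  rewrite /kp' mulrA mulfV // mul1r; apply: is_int_Rintegral => //.
  by apply: (eq_integrable mT _ _ _ I) => t _; rewrite /= ln1 !mulr0 expR0 mul1r addr0.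
have val1 L r : 0 < r -> is_int `]0, r[ (fun x => expR ((k - 1) * ln x) *
    (2 * pi * kp (L + nu * ln x))) (expR (k * ln r) * (2 * pi * kp' (L + nu * ln r))).
  move=> r0; have [cu [I1 I2]] := HR 1 L r r0.
  rewrite (is_int_unique (is_intZ (expR (k * ln r)) mT (inv1 _)) I2).
  by apply: (is_int_ext (mD r) _ I1) => x _; rewrite /= mul1r.
have inv : inversion (e :: es) kp'.
  move=> u L; have [cu [I1 I2]] := HR u L 1 ltr01.
  have := is_intZ (complex.Re u) (mD 1) (val1 L 1 ltr01).
  rewrite ln1 !mulr0 expR0 mul1r addr0 => I3.
  have E : complex.Re u * (2 * pi * kp' L) = cu.
    apply: is_int_unique I3 _; apply: (is_int_ext (mD 1) _ I1) => x _; ring.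
  rewrite E; apply: (is_int_ext mT _ I2) => t _.
  by rewrite ln1 !mulr0 expR0 mul1r addr0.
have main r p : 0 < r -> 0 < p -> is_int `]0, r[
    (fun x => x ^+ e * simplex_delta es x (p * x))
    (expR (c * ln p + k * ln r) * kp' (ln p + nu * ln r)).
  move=> r0 p0.
  have := is_intZ (expR (c * ln p) * (2 * pi)^-1) (mD r) (val1 (ln p) r r0).
  have -> : expR (c * ln p) / (2 * pi) * (expR (k * ln r) * (2 * pi * kp' (ln p + nu * ln r))) =
      expR (c * ln p + k * ln r) * kp' (ln p + nu * ln r).
    by rewrite expRD -mulrA [_^-1 * _]mulrCA (mulKf pi2) mulrA.
  apply: is_int_ext => // x; rewrite /= in_itv /= => /andP[x0 _].
  rewrite HK ?mulr_gt0 // lnM ?posrE // natpow_expR //.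
  have -> : ln p + ln x + (size es)%:R * ln x = ln p + nu * ln x.
    by rewrite /nu /= -natr1; ring.
  transitivity (expR (c * ln p) * expR ((k - 1) * ln x) * kp (ln p + nu * ln x)).
    by rewrite -!mulrA; congr (_ * _); rewrite mulrCA [2 * (pi * _)]mulrA (mulKf pi2).
  rewrite mulrA -!expRD; congr (expR _ * _).
  by rewrite /k exponent_cons -natr1; ring.
have KE r p : 0 < r -> 0 < p -> simplex_delta (e :: es) r p =
    expR (c * ln p + k * ln r) * kp' (ln p + nu * ln r).
  move=> r0 p0; rewrite -(is_int_RintegralE (main r p r0 p0)).
  by case: es es0 {HK HR k nu kp' inv1 val1 inv main}.
split; last by exists kp'; split.
by move=> r p r0 p0; rewrite KE //; exact: main.
Qed.

Lemma poles_bound es : es != [::] ->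
  exists2 C : R, 0 <= C & forall t, l1norm (poles es t) <= C * (1 + `|t|)^-1 ^+ size es.
Proof.
elim: es => // e es IHes _.
have [C2 C20 H2] := l1norm_pole (exponent_gt0 (isT : e :: es != [::]))
   (ltr0Sn R (size es) : 0 < (size (e :: es))%:R).
have [C C0 H] : exists2 C : R, 0 <= C & forall t, l1norm (poles es t) <= C * (1 + `|t|)^-1 ^+ size es.
  case: (eqVneq es [::]) => [->|/IHes //].
  by exists 1 => // t; rewrite /l1norm /= normr1 normr0 expr0 addr0 mulr1.
exists (C * C2) => [|t]; first exact: mulr_ge0.
apply: (le_trans (l1normM _ _)).
apply: (@le_trans _ _ (C * (1 + `|t|)^-1 ^+ size es * (C2 / (1 + `|t|)))).
  by apply: ler_pM; rewrite ?l1norm_ge0 //; exact: H2.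
by rewrite /= exprS le_eqVlt; apply/orP; left; apply/eqP; ring.
Qed.

Lemma poles_cauchy es : (1 < size es)%N ->
  exists2 C : R, 0 <= C & forall t, l1norm (poles es t) <= C * (1 + t ^+ 2)^-1.
Proof.
move=> es1; have es0 : es != [::] by case: (es) es1.
have [C C0 H] := poles_bound es0; exists C => // t.
apply: (le_trans (H t)); rewrite ler_wpM2l //; apply: (le_trans _ (inv_sqr_le t)).
rewrite -(subnKC es1) exprD ler_piMr ?exprn_ge0 ?invr_ge0 ?addr_ge0 //.
by rewrite exprn_ile1 ?invr_ge0 ?addr_ge0 // invf_le1 ?ltr_pwDl // lerDl.
Qed.

Lemma cmeasurable_poles es : cmeasurable (poles es).
Proof.
elim: es => [|e es IHes]; first exact: cmeasurable_cst.
exact: (cmeasurable_M IHes (cmeasurable_pole _ (exponent_gt0 (isT : e :: es != [::])))).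
Qed.

(** The first clause feeds the iterated integral, the second the vertical integral. The induction
    starts at two variables, with [pole_fun] as the kernel of the single pole. *)
Theorem delta_inversion e es : es != [::] ->
  (forall r p, 0 < r -> 0 < p -> is_int `]0, r[
     (fun x => x ^+ e * simplex_delta es x (p * x)) (simplex_delta (e :: es) r p)) /\
  exists kp, inversion (e :: es) kp /\ delta_formula (e :: es) kp.
Proof.
elim: es e => // e2 es IHes e _.
case: (eqVneq es [::]) => [->|es0].
  have a0 : 0 < exponent [:: e2] by exact: exponent_gt0.
  apply: (delta_step (kp := pole_fun (exponent [:: e2]))) => //.
    move=> r p r0 p0; rewrite /simplex_delta /pole_fun /= mul1r -lnM ?posrE //.
    have -> : (0 < ln (p * r)) = (p^-1 < r).
      rewrite -ln1 ltr_ln ?posrE ?mulr_gt0 //.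
      by rewrite -[RHS](ltr_pM2l p0) mulfV // gt_eqF.
    case: ifP => _; last by rewrite mulr0.
    rewrite natpow_expR ?invr_gt0 // lnV ?posrE // lnM ?posrE // -expRD; congr expR.
    by rewrite /exponent /= addn0; ring.
  move=> u L r r0.
  have k0 : 0 < exponent [:: e; e2] by exact: exponent_gt0.
  have [cu [H1 H2]] := two_poles L u a0 k0 (ltr0Sn R 1) r0.
  exists cu; split; first exact: H1.
  apply: (is_int_ext _ _ H2) => // t _ /=.
  by rewrite mul1r mulrA.
have [_ [kp [inv form]]] := IHes e2 es0.
apply: (delta_step (kp := kp)) => // u L r r0.
have k0 : 0 < exponent [:: e, e2 & es] by exact: exponent_gt0.
have es1 : (1 < size (e2 :: es))%N by case: (es) es0.
have [C C0 H] := poles_cauchy es1.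
have [] := @fubini_step R (exponent [:: e, e2 & es]) (size [:: e, e2 & es])%:R L r
  (fun t => u * poles (e2 :: es) t) (fun t => l1norm u * C * (1 + t ^+ 2)^-1) (l1norm u * C * pi)
  (fun L => complex.Re u * (2 * pi * kp L)) r0 k0.
- exact: (cmeasurable_M (cmeasurable_cst u) (cmeasurable_poles _)).
- move=> t; apply: (le_trans (l1normM _ _)); rewrite -mulrA ler_wpM2l ?l1norm_ge0 //; exact: H.
- exact: is_int_cauchyZ.
- by move=> L'; exact: inv.
move=> cu [H1 H2]; exists cu; split => //.
by apply: (is_int_ext _ _ H2) => // t _ /=; rewrite !mulrA.
Qed.

End SimplexIntegral.

(** * The Gamma function *)

Section GammaFunction.
Variable R : realType.
Local Notation mu := lebesgue_measure.
Local Notation RT := (measurableTypeR R).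
Local Notation msr := (@measurable _ RT).
Implicit Types (u z : R[i]) (x y t : R).

Let m0y : msr `]0, +oo[. Proof. exact: open_msr (@itv0y_open R). Qed.

Lemma ln_le_sub1 x : 0 < x -> ln x <= x - 1.
Proof.
move=> x0; have := @le_ln1Dx R (x - 1).
by rewrite (addrC 1) subrK; apply; lra.
Qed.

Lemma ln_le_linear (e x : R) : 0 < e -> 0 <= x ->
  exists C, forall t, 0 < t -> x * ln t <= e * t + C.
Proof.
move=> e0; rewrite le_eqVlt => /predU1P[<-|x0].
  by exists 0 => t t0; rewrite mul0r addr0 mulr_ge0 // ltW.
exists (x * (ln (x / e) - 1)) => t t0.
have xe : 0 < x / e by rewrite divr_gt0.
have H := ln_le_sub1 (divr_gt0 t0 xe); rewrite ln_div ?posrE // in H.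
have E : e * t = x * (t / (x / e)) by field; rewrite !gt_eqF.
rewrite E -mulrDr ler_pM2l //; lra.
Qed.

(** The exponent is x and not x - 1, so that the boundary term t^z e^(-t) of the functional equation
    is covered too. *)
Definition gamma_density (x t : R) := expR (x * ln t) * expR (- t).

Lemma gamma_density_cvg0 x : 0 < x -> gamma_density x t @[t --> 0^'+] --> (0 : R).
Proof.
move=> x0; rewrite -[X in _ --> X](mul0r (expR (- 0))).
apply: cvgM; first exact: cvgr_expRln.
apply: cvg_at_right_filter; apply: continuous_cvg; first exact: continuous_expR.
by apply: cvgN; exact: cvg_id.
Qed.

Lemma gamma_density_cvgy x : 0 <= x -> gamma_density x t @[t --> +oo] --> (0 : R).
Proof.
move=> x0; have h0 : 0 < 1 / 2 :> R by [].
have [C HC] := ln_le_linear h0 x0.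
apply: (@squeeze0_near _ _ _ _ _ (fun t => expR (- (1 / 2) * t)) (expR C)).
  near=> t; rewrite /gamma_density -expRD ger0_norm ?expR_ge0 // -expRD ler_expR.
  have t0 : 0 < t by near: t; exact: nbhs_pinfty_gt.
  by have := HC t t0; lra.
exact: cvgr_expRM.
Unshelve. all: end_near.
Qed.

(** The majorant t^(x-1) / (1 + t)^(x+1) is chosen for its elementary primitive (t / (1 + t))^x / x;
    e^(-t) is below a multiple of (1 + t)^(-x-1). *)
Lemma is_int_gamma_bound x : 0 < x -> exists C l,
  is_int `]0, +oo[ (fun t => C * expR ((x - 1) * ln t - (x + 1) * ln (1 + t))) l /\
  forall t, 0 < t -> gamma_density (x - 1) t <=
     C * expR ((x - 1) * ln t - (x + 1) * ln (1 + t)).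
Proof.
move=> x0.
have x1 : 0 <= x + 1 by rewrite addr_ge0 // ltW.
have [C HC] := ln_le_linear ltr01 x1.
pose F t := x^-1 * expR (x * (ln t - ln (1 + t))).
have I : is_int `]0, +oo[ (fun t => expR ((x - 1) * ln t - (x + 1) * ln (1 + t))) (x^-1 * 1 - 0).
  apply: (@ftc0y_ge0 R _ F).
  - by move=> t _; exact: expR_ge0.
  - move=> t t0; have t1 : 0 < 1 + t by rewrite addr_gt0.
    have dl := is_derive1_ln t0; have dl1 := is_derive1_ln t1.
    rewrite /F; apply: is_derive_eq; rewrite /GRing.scale /=.
    have -> : (x - 1) * ln t - (x + 1) * ln (1 + t) =
       x * (ln t - ln (1 + t)) - ln t - ln (1 + t) by ring.
    rewrite !expRB !lnK ?posrE //.
    by field; rewrite !gt_eqF.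
  - move=> t t0; have t1 : 0 < 1 + t by rewrite addr_gt0.
    have dl := is_derive1_ln t0; have dl1 := is_derive1_ln t1; exact: ex_derive.
  - apply: (@squeeze0_near _ _ _ _ _ (fun t => expR (x * ln t)) x^-1); last exact: cvgr_expRln.
    near=> t; have t0 : 0 < t by near: t; exact: nbhs_right_gt.
    rewrite /F ger0_norm; last by rewrite mulr_ge0 ?expR_ge0 // invr_ge0 ltW.
    rewrite ler_pM2l ?invr_gt0 // ler_expR ler_pM2l // lerBlDr lerDl.
    by rewrite ln_ge0 // lerDl ltW.
  - apply: cvgM; first exact: cvg_cst.
    rewrite -[X in _ --> X]expR0; apply: continuous_cvg; first exact: continuous_expR.
    rewrite -(mulr0 x); apply: cvgM; first exact: cvg_cst.
    apply: (@squeeze0_near _ _ _ _ _ (fun t => t^-1) 1).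
      near=> t; have t0 : 0 < t by near: t; exact: nbhs_pinfty_gt.
      have t1 : 0 < 1 + t by rewrite addr_gt0.
      rewrite ler0_norm ?subr_le0 ?ler_ln ?posrE ?lerDr // opprB mul1r.
      rewrite -ln_div ?posrE //; apply: (le_trans (ln_le_sub1 (divr_gt0 t1 t0))).
      by rewrite mulrDl mul1r divff ?gt_eqF // addrK.
    apply/gtr0_cvgV0; last exact: cvg_id.
    exact: nbhs_pinfty_gt.
exists (expR (C + 1)), (expR (C + 1) * (x^-1 * 1 - 0)); split; first exact: is_intZ.
move=> t t0; rewrite /gamma_density -!expRD ler_expR.
have := HC (1 + t) (addr_gt0 ltr01 t0); lra.
Unshelve. all: end_near.
Qed.

Lemma ler_ce_density u z t : `|ce u (z - 1) (ln t) * expR (- t)| <=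
  (`|complex.Re u| + `|complex.Im u|) * gamma_density (complex.Re z - 1) t.
Proof.
rewrite normrM (ger0_norm (expR_ge0 _)) /gamma_density mulrA ler_wpM2r ?expR_ge0 //.
by have := ler_ce u (z - 1) (ln t); case: z.
Qed.

Lemma is_derive_gammaf u z t : 0 < t ->
  is_derive t 1 (fun t => ce u z (ln t) * expR (- t))
    (ce (u * z) (z - 1) (ln t) * expR (- t) - ce u z (ln t) * expR (- t)).
Proof.
move=> t0; have dc := is_derive_ce_ln u z t0; apply: is_derive_eq.
rewrite /GRing.scale /=; ring.
Qed.

Lemma derivable_gammaf u z t : 0 < t -> derivable (fun t => ce u z (ln t) * expR (- t)) t 1.
Proof. by move=> t0; exact: (@ex_derive _ _ _ _ _ _ _ (is_derive_gammaf u z t0)). Qed.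

Lemma gammaf_integrable u z : 0 < complex.Re z ->
  mu.-integrable `]0, +oo[ (EFin \o (fun t => ce u (z - 1) (ln t) * expR (- t))).
Proof.
move=> z0; have [C [l [I H]]] := is_int_gamma_bound z0.
apply: (dom_integrable m0y _ _ (is_intZ (`|complex.Re u| + `|complex.Im u|) m0y I)).
  apply: derivable_measurable; first exact: itv0y_open.
  by move=> t; rewrite /= in_itv /= andbT; exact: derivable_gammaf.
move=> t; rewrite /= in_itv /= andbT => t0; apply: (le_trans (ler_ce_density _ _ _)).
by rewrite ler_wpM2l ?addr_ge0 // H.
Qed.

Lemma is_int_Gamma u z : 0 < complex.Re z ->
  is_int `]0, +oo[ (fun t => ce u (z - 1) (ln t) * expR (- t)) (complex.Re (u * Gamma z)).
Proof.
move=> z0; have I w := is_int_Rintegral (gammaf_integrable w z0) m0y.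
apply: is_int_eq (I u).
have E : (fun t => ce u (z - 1) (ln t) * expR (- t)) =
  (fun t => complex.Re u * (ce 1 (z - 1) (ln t) * expR (- t)) +
    (- complex.Im u) * (ce (- 'i) (z - 1) (ln t) * expR (- t))).
  by apply/funext => t; rewrite /ce /tr /=; ring.
rewrite {1}E.
rewrite (is_int_RintegralE (is_intD m0y (is_intZ _ m0y (I 1)) (is_intZ _ m0y (I (- 'i))))).
case: u {E} => a b; rewrite /Gamma /Cintegral /=; congr (_ * _ + _).
  by congr Rintegral; apply/funext => t; rewrite /ce /tr /cpow /=; ring.
rewrite mulNr; congr (- (_ * _)).
by congr Rintegral; apply/funext => t; rewrite /ce /tr /cpow /=; ring.
Qed.

Lemma complex_Re_inj (v w : R[i]) : (forall u, complex.Re (u * v) = complex.Re (u * w)) -> v = w.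
Proof.
move=> H; have := H 1; have := H 'i; rewrite !mul1r; case: v w {H} => a b [c d] /=.
by rewrite !mul0r !mul1r !sub0r => /oppr_inj -> ->.
Qed.

Lemma gammaf_cvg0 (F : set_system R) (FF : Filter F) u z :
  gamma_density (complex.Re z) t @[t --> F] --> (0 : R) ->
  ce u z (ln t) * expR (- t) @[t --> F] --> (0 : R).
Proof.
apply: (@squeeze0 _ _ _ _ _ _ (`|complex.Re u| + `|complex.Im u|)) => t.
by have := ler_ce_density u (z + 1) t; rewrite addrK; case: z => a b /=; rewrite addrK.
Qed.

(** The derivative of t^z e^(-t) integrates to 0, both boundary values being 0. *)
Lemma GammaS z : 0 < complex.Re z -> Gamma (z + 1) = z * Gamma z.
Proof.
move=> z0; apply: complex_Re_inj => u.
have z10 : 0 < complex.Re (z + 1) by case: z z0 => a b /= a0; rewrite addr_gt0.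
have I1 := is_int_Gamma (u * z) z0; have I2 := is_int_Gamma u z10; rewrite addrK in I2.
have I3 := is_intD m0y I1 (is_intZ (- 1) m0y I2).
pose f t := ce (u * z) (z - 1) (ln t) * expR (- t) - ce u z (ln t) * expR (- t).
have {}I3 : is_int `]0, +oo[ f (complex.Re (u * z * Gamma z) + -1 * complex.Re (u * Gamma (z + 1))).
  by apply: is_int_ext I3 => // t _; rewrite mulN1r.
have I4 : is_int `]0, +oo[ f (0 - 0).
  apply: (@ftc0y R f (fun t => ce u z (ln t) * expR (- t)) 0 0).
  - by have [] := I3.
  - by move=> t t0; exact: is_derive_gammaf.
  - by move=> t t0; apply: derivableB; apply: derivable_gammaf.
  - apply: gammaf_cvg0; exact: gamma_density_cvg0.
  - by apply: gammaf_cvg0; apply: gamma_density_cvgy; exact: ltW.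
have := is_int_unique I3 I4; rewrite subr0 mulN1r => /subr0_eq <-.
by rewrite mulrA.
Qed.

Lemma Gamma1 : Gamma (1 : R[i]) = 1.
Proof.
apply: complex_Re_inj => u.
have := is_int_Gamma u (z := 1) ltr01; rewrite subrr => I.
apply: is_int_unique I _.
have := is_intZ (complex.Re u) m0y (is_int_expR (@ltr01 R)).
rewrite invr1 mulr1 mulr1; case: u => a b /=.
apply: is_int_ext => // t _.
by rewrite /ce /tr /= !mul0r expR0 cos0 sin0 mulN1r; ring.
Qed.

End GammaFunction.

(** * Non-vanishing of Gamma on the right half-plane *)

Section GammaNonvanishing.
Variable R : realType.
Local Notation RT := (measurableTypeR R).
Local Notation msr := (@measurable _ RT).
Implicit Types (u z : R[i]) (x y t : R).

Let m0y : msr `]0, +oo[. Proof. exact: open_msr (@itv0y_open R). Qed.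

Lemma is_int_le (D : set R) (f g : R -> R) (l k : R) : msr D ->
  (forall t, D t -> f t <= g t) -> is_int D f l -> is_int D g k -> l <= k.
Proof.
move=> mD fg If Ig; rewrite -(is_int_RintegralE If) -(is_int_RintegralE Ig).
by apply: le_Rintegral => //; [have [] := If|have [] := Ig].
Qed.

Lemma sqr_sin_le x : sin x ^+ 2 <= x ^+ 2.
Proof.
wlog x0 : x / 0 <= x.
  move=> H; case: (leP 0 x) => [|/ltW]; first exact: H.
  by rewrite -oppr_ge0 => /H; rewrite sinN !sqrrN.
have [|c _ E] := @MVT_segment R sin cos 0 x x0.
  by apply: continuous_subspaceT; exact: continuous_sin.
move: E; rewrite sin0 !subr0 => ->; rewrite exprMn ler_piMl ?sqr_ge0 //.
Qed.

Lemma cos_ge x : 1 - x ^+ 2 <= cos x.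
Proof.
have := sqr_sin_le (x / 2); rewrite sin2cos2 exprMn.
have -> : cos x = cos (x / 2 + x / 2) by rewrite -splitr.
rewrite cosD -!expr2 sin2cos2; have := sqr_ge0 x; move: (x ^+ 2) (cos _ ^+ 2) => a b.
rewrite exprVn; lra.
Qed.

(** From 1 - 1/x <= ln x <= x - 1. The bound is a Laurent polynomial, so against the Gamma density
    it integrates to Gamma values at neighbouring points. *)
Lemma sqr_ln_le x : 0 < x -> ln x ^+ 2 <= (x - 1) ^+ 2 + (x^-1 - 1) ^+ 2.
Proof.
move=> x0; have := ln_le_sub1 x0.
have := @ln_le_sub1 R x^-1; rewrite invr_gt0 x0 lnV ?posrE // => /(_ isT).
move: (ln x) (x^-1) => l v H1 H2; have := sqr_ge0 (x - 1); have := sqr_ge0 (v - 1).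
case: (leP 0 l) => l0; nra.
Qed.

Definition rgamma x := complex.Re (Gamma x%:C).

Lemma is_int_rgamma x : 0 < x -> is_int `]0, +oo[ (gamma_density (x - 1)) (rgamma x).
Proof.
move=> x0; have := is_int_Gamma 1 (z := x%:C) x0; rewrite mul1r.
apply: is_int_ext => // t _.
by rewrite /ce /tr /gamma_density /= subr0 mul0r cos0 sin0 !mul1r !mulr0 subr0 mulr1.
Qed.

Lemma rgammaS x : 0 < x -> rgamma (x + 1) = x * rgamma x.
Proof.
move=> x0; rewrite /rgamma; have := GammaS (z := x%:C) x0.
rewrite (_ : x%:C + 1 = (x + 1)%:C) ?rmorphD ?rmorph1 // => ->.
by case: (Gamma _) => a b /=; rewrite mul0r subr0.
Qed.

(** On ]0, 1[ the factor e^(-t) is at least e^(-1), which leaves the integral of t^(x-1). *)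
Lemma rgamma_gt0 x : 0 < x -> 0 < rgamma x.
Proof.
move=> x0.
have m01 : msr `]0, 1[ by exact: measurable_itv.
have I := is_int_power 1 (z := x%:C) ltr01 x0.
have {}I := is_intZ (expR (- 1)) m01 I.
have {}I := is_int_restrict m0y m01 _ I.
rewrite ln1 in I.
suff : expR (- 1) * ce (1 / x%:C) x%:C 0 <= rgamma x.
  apply: lt_le_trans; rewrite mulr_gt0 ?expR_gt0 //.
  rewrite div1r -(fmorphV (real_complex R)) /ce /tr !mulr0 expR0 cos0 sin0 /=.
  by rewrite mul1r mulr1 mulr0 subr0 invr_gt0.
apply: (is_int_le m0y _ (I _) (is_int_rgamma x0)); last first.
  by move=> t /=; rewrite !in_itv /= andbT => /andP[].
move=> t t0; rewrite patchE; case: ifPn => [|_]; last by rewrite mulr_ge0 ?expR_ge0.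
rewrite inE /= in_itv /= => /andP[_ t1].
rewrite /ce /tr /gamma_density /= subr0 mul0r cos0 sin0 !mul1r mulr0 subr0 mulr1 mulrC.
by rewrite ler_wpM2l ?expR_ge0 // ler_expR lerN2 ltW.
Qed.

(* cos a >= 1 - a^2 and (ln s)^2 <= (s - 1)^2 + (1/s - 1)^2, with s = t/x,
   bound Re (x^(-iy) Gamma (x + iy)) below by a combination of real Gamma
   values. *)
Lemma Gamma_neq0_far x y : 6 * y ^+ 2 + 10 <= x -> Gamma (x +i* y) != 0.
Proof.
move=> xy; have y20 := sqr_ge0 y.
have x10 : 10 <= x by move: y20 xy; lra.
have x0 : 0 < x by lra.
(* The factor x^(-iy) makes the phase vanish at t = x, near which the density concentrates. *)
set u := cis (- (y * ln x)).
have I := is_int_Gamma u (z := x +i* y) x0.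
suff : 0 < complex.Re (u * Gamma (x +i* y)).
  by apply: contraTneq => ->; rewrite mulr0 ltxx.
have g1 : 0 < x - 2 by lra.
have g2 : 0 < x - 1 by lra.
have g3 : 0 < x + 1 by lra.
have g4 : 0 < x + 2 by lra.
have J1 := is_int_rgamma g1; have J2 := is_int_rgamma g2; have J3 := is_int_rgamma x0.
have J4 := is_int_rgamma g3; have J5 := is_int_rgamma g4.
have := rgamma_gt0 g1.
have := rgammaS g1; have := rgammaS g2; have := rgammaS x0; have := rgammaS g3.
have -> : x + 1 + 1 = x + 2 by ring.
have -> : x - 1 + 1 = x by ring.
have -> : x - 2 + 1 = x - 1 by ring.
move=> E5 E4 E3 E2; move: E5 E4 E3 J1 J2 J3 J4 J5; rewrite E2.
move: (rgamma (x - 2)) (rgamma (x + 2)) (rgamma (x + 1)) (rgamma x) => g a4 a3 a2.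
move=> -> -> -> J1 J2 J3 J4 J5 g0.
(* The coefficients are those of 1 - y^2 ((t/x - 1)^2 + (x/t - 1)^2) in powers of t. *)
have J := is_intD m0y (is_intD m0y (is_intD m0y (is_intD m0y
  (is_intZ (- (y ^+ 2) * x ^+ 2) m0y J1) (is_intZ (2 * y ^+ 2 * x) m0y J2))
  (is_intZ (1 - 2 * y ^+ 2) m0y J3)) (is_intZ (2 * y ^+ 2 / x) m0y J4))
  (is_intZ (- (y ^+ 2) / x ^+ 2) m0y J5).
apply: lt_le_trans (is_int_le m0y _ J I); last first.
  move=> t; rewrite /= in_itv /= andbT => t0.
  rewrite /gamma_density.
  have -> : (x + 2 - 1) * ln t = (x - 1) * ln t + ln t + ln t by ring.
  have -> : (x + 1 - 1) * ln t = (x - 1) * ln t + ln t by ring.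
  have -> : (x - 2 - 1) * ln t = (x - 1) * ln t - ln t - ln t by ring.
  have -> : (x - 1 - 1) * ln t = (x - 1) * ln t - ln t by ring.
  rewrite !expRD !expRN !lnK ?posrE // -expRN.
  have -> : ce u (x +i* y - 1) (ln t) = expR ((x - 1) * ln t) * cos (y * ln (t / x)).
    rewrite ln_div ?posrE // mulrBr cosB /ce /tr /u /cis /= cosN sinN subr0; ring.
  have xt0 : 0 < t / x by rewrite divr_gt0.
  have H1 := cos_ge (y * ln (t / x)); have H2 := sqr_ln_le xt0.
  have {}H1 : 1 - y ^+ 2 * ((t / x - 1) ^+ 2 + ((t / x)^-1 - 1) ^+ 2) <= cos (y * ln (t / x)).
    by apply: le_trans H1; rewrite lerD2l lerN2 exprMn ler_wpM2l.
  have := ler_wpM2l (expR_ge0 (- t)) (ler_wpM2l (expR_ge0 ((x - 1) * ln t)) H1).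
  rewrite [X in _ <= X]mulrC => H; apply: le_trans H; rewrite le_eqVlt; apply/orP; left; apply/eqP.
  move: (expR _) (expR _) => a b; field.
  by rewrite !gt_eqF.
have -> : - y ^+ 2 * x ^+ 2 * g + 2 * y ^+ 2 * x * ((x - 2) * g) +
    (1 - 2 * y ^+ 2) * ((x - 1) * ((x - 2) * g)) +
    2 * y ^+ 2 / x * (x * ((x - 1) * ((x - 2) * g))) +
    - y ^+ 2 / x ^+ 2 * ((x + 1) * (x * ((x - 1) * ((x - 2) * g)))) =
    g / x * ((x - 1) * (x - 2) * (x - y ^+ 2) - y ^+ 2 * (x * (x + 2))).
  by field; rewrite gt_eqF.
rewrite mulr_gt0 ?divr_gt0 //.
move: (y ^+ 2) y20 xy => Y Y0 xY.
(* The hypothesis makes x - 6 Y and x - 10 nonnegative, and this form shows the sign. *)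
have -> : (x - 1) * (x - 2) * (x - Y) - Y * (x * (x + 2)) =
    ((x - 6 * Y) * (x ^+ 2 + (x - 1) * x + 2) +
     x * (4 * x * (x - 10) + 23 * x + 10)) / 6 by field.
have h1 : 0 <= x - 6 * Y by rewrite subr_ge0 (le_trans _ xY) // lerDl.
have h2 : 0 <= x - 10 by rewrite subr_ge0.
rewrite divr_gt0 // ltr_wpDl //.
  by rewrite mulr_ge0 // addr_ge0 // addr_ge0 ?sqr_ge0 // mulr_ge0 ?(ltW x0) ?(ltW g2).
rewrite mulr_gt0 // ltr_wpDl // addr_ge0 //; last by rewrite mulr_ge0 ?(ltW x0).
by rewrite mulr_ge0 // mulr_ge0 ?(ltW x0).
Qed.

(** By the functional equation a zero at z is a zero at every z + n. The imaginary part stays fixed,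
    so the region of [Gamma_neq0_far] is reached. *)
Theorem Gamma_neq0 z : 0 < complex.Re z -> Gamma z != 0.
Proof.
move=> z0; apply/eqP => Gz0.
have H n : 0 < complex.Re (z + n%:R) /\ Gamma (z + n%:R) = 0.
  elim: n => [|n [IHn0 IHn]]; first by rewrite addr0.
  rewrite -addn1 natrD addrA; split; last by rewrite GammaS // IHn mulr0.
  by move: IHn0; case: (z + n%:R) => a b /= a0; rewrite addr_gt0.
case: z z0 Gz0 H => x y x0 _ H.
have [n /ltW Hn] : exists n : nat, 6 * y ^+ 2 + 10 < n%:R.
  by exists (Num.bound (6 * y ^+ 2 + 10)); apply: archi_boundP; have := sqr_ge0 y; lra.
have xn : 6 * y ^+ 2 + 10 <= x + n%:R by rewrite (le_trans Hn) // lerDr ltW.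
have := Gamma_neq0_far xn; have [_] := H n.
rewrite (_ : x +i* y + n%:R = (x + n%:R) +i* y); first by move=> ->; rewrite eqxx.
by rewrite -(rmorph_nat (real_complex R)) /=; congr (_ +i* _); rewrite addr0.
Qed.

End GammaNonvanishing.

(** * The delta-integral and the vertical integral *)

Section IteratedIntegral.
Variable R : realType.
Local Notation mu := lebesgue_measure.
Local Notation RT := (measurableTypeR R).
Local Notation msr := (@measurable _ RT).
Implicit Types (x r p : R) (es : seq nat) (s : seq R) (T : seq (R * seq nat)).

Definition monomial es s : R := \prod_(i < size es) s`_i ^+ nth 0%N es i.

Lemma monomial_cons e es x s : monomial (e :: es) (x :: s) = x ^+ e * monomial es s.
Proof. by rewrite /monomial /= big_ord_recl. Qed.

Definition monomial_sum T s : R := \sum_(t <- T) t.1 * monomial t.2 s.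

Lemma pos_integral0 n : pos_integral (fun _ : n.-tuple R => 0%E) = 0%E.
Proof.
elim: n => //= n IHn; rewrite -[RHS](@integral0 _ _ R mu `]0, +oo[%classic).
by apply: eq_integral => x _; exact: IHn.
Qed.

(** The induction keeps r and p free: the outer variable x becomes the next bound, multiplies p, and
    its power passes into the coefficients. The sum may be signed because each monomial is
    integrable. *)
Lemma pos_integral_monomial_sum n T r p : all (fun t => size t.2 == n.+1) T ->
  0 < r -> 0 < p ->
  pos_integral (fun s : n.-tuple R =>
    let q := p * \prod_(x <- s) x in
    ((if path >%R r (rcons (rcons s q^-1) 0) then monomial_sum T (rcons s q^-1) else 0)
       * q^-1)%:E) =
  (\sum_(t <- T) t.1 * simplex_delta t.2 r p)%:E.
Proof.
elim: n T r p => [|n IHn] T r p Tn r0 p0 /=.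
  rewrite big_nil mulr1 invr_gt0 p0 !andbT; congr EFin.
  transitivity ((if p^-1 < r then monomial_sum T [:: p^-1] * p^-1 else 0)).
    by case: ifP; rewrite ?mul0r.
  rewrite /monomial_sum -[RHS]/(\sum_(t <- T) t.1 * simplex_delta t.2 r p).
  have -> : (if p^-1 < r then (\sum_(t <- T) t.1 * monomial t.2 [:: p^-1]) / p else 0) =
     \sum_(t <- T) (if p^-1 < r then t.1 * monomial t.2 [:: p^-1] / p else 0).
    by case: ifP => _; rewrite ?mulr_suml // big1.
  apply: eq_big_seq => -[k es] /(allP Tn) /=; case: es => [|e [|]] //= _.
  by rewrite monomial_cons /monomial /= big_ord0 mulr1 exprSr; case: ifP; rewrite ?mulr0 // mulrA.
have mD : msr `]0, r[ by exact: measurable_itv.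
(* c = 0 is one admissible choice: only the first clause of [delta_inversion], in which c does not
   occur, is applied. *)
have c0 : 0 < 0 + 1 :> R by rewrite add0r.
have m0y : msr `]0, +oo[ by exact: measurable_itv.
pose f x : R := \sum_(t <- T) t.1 * (x ^+ head 0%N t.2 * simplex_delta (behead t.2) x (p * x)).
have If : is_int `]0, r[ f (\sum_(t <- T) t.1 * simplex_delta t.2 r p).
  apply: is_int_sum => // -[k es] /(allP Tn) /=; case: es => // e es /eqP[ens].
  apply: is_intZ => //; have es0 : es != [::] by case: (es) ens.
  by have [H _] := delta_inversion (c := 0) c0 e es0; exact: H.
have sub : (`]0, r[%classic : set R) `<=` `]0, +oo[%classic.
  by move=> x /=; rewrite !in_itv /= andbT => /andP[].
have [_ <-] := is_int_restrict m0y mD sub If.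
apply: eq_integral => x; rewrite inE /= in_itv /= andbT => x0.
rewrite patchE; case: ifPn; rewrite ?inE ?notin_setE /= in_itv /= x0 /=; last first.
  move=> /negP/negbTE xr; apply: etrans (pos_integral0 n); congr pos_integral.
  by apply/funext => s /=; rewrite xr mul0r.
move=> xr; have px0 : 0 < p * x by rewrite mulr_gt0.
pose T' := [seq (t.1 * x ^+ head 0%N t.2, behead t.2) | t <- T].
have T'n : all (fun t => size t.2 == n.+1) T'.
  by rewrite all_map; apply: sub_all Tn => -[k [|e es]].
have := IHn T' x (p * x) T'n x0 px0; rewrite big_map /=.
have -> : \sum_(t <- T) t.1 * x ^+ head 0%N t.2 * simplex_delta (behead t.2) x (p * x) = f x.
  by apply: eq_bigr => t _; rewrite mulrA.
move=> <-; congr pos_integral; apply/funext => s /=.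
rewrite big_cons mulrA xr /=; congr (_ * _)%:E; case: ifP => // _.
rewrite /monomial_sum big_map; apply: eq_big_seq => -[k es] /(allP Tn) /=.
by case: es => // e es _; rewrite monomial_cons mulrA.
Qed.

End IteratedIntegral.

(** * Convergence along a vertical line with independent ends *)

Section VerticalLimit.
Variable R : realType.
Local Notation mu := lebesgue_measure.
Local Notation RT := (measurableTypeR R).
Local Notation msr := (@measurable _ RT).
Implicit Types (u w : R[i]) (x y t r L : R) (es : seq nat).

Local Notation both_ends := (filter_prod (ninfty_nbhs R) (pinfty_nbhs R)).

Let mT : msr setT. Proof. by []. Qed.
Let mseg x y : msr `[x, y]. Proof. exact: measurable_itv. Qed.

Lemma normC_le (z e : R[i]) : complex.Im e = 0 -> l1norm z <= complex.Re e -> `|z| <= e.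
Proof.
case: z e => a b [e e'] /= ->; rewrite /l1norm normc_def /= lecE /= eqxx => /(le_trans _); apply.
rewrite -[leRHS]ger0_norm ?addr_ge0 // -sqrtr_sqr ler_wsqrtr //.
by rewrite sqrrD !real_normK ?num_real // addrAC lerDl mulrn_wge0 // mulr_ge0.
Qed.

(** The norm on R[i] is itself complex-valued, so a radius e is a complex number with zero imaginary
    part; half of its real part goes to each component. *)
Lemma complex_cvg (T : Type) (F : set_system T) (FF : Filter F) (f : T -> R[i]) (l : R[i]) :
  complex.Re (f x) @[x --> F] --> complex.Re l ->
  complex.Im (f x) @[x --> F] --> complex.Im l ->
  (f x : R[i]^o) @[x --> F] --> (l : R[i]^o).
Proof.
move=> fR fI; apply/cvgrPdist_le => e; rewrite ltcE => /andP[/eqP Ie Re0].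
have e20 : 0 < complex.Re e / 2 by rewrite divr_gt0.
near=> x.
have hR : `|complex.Re l - complex.Re (f x)| <= complex.Re e / 2.
  by near: x; move/cvgrPdist_le : fR; apply.
have hI : `|complex.Im l - complex.Im (f x)| <= complex.Re e / 2.
  by near: x; move/cvgrPdist_le : fI; apply.
apply: normC_le => //; apply: le_trans (_ : complex.Re e / 2 + complex.Re e / 2 <= _).
  by apply: le_trans (lerD hR hI); case: (l) (f x) => a b [].
by rewrite -splitr.
Unshelve. all: end_near.
Qed.

Lemma both_endsP : \forall p \near both_ends, p.1 < p.2.
Proof.
exists ([set x | x < 0], [set x | 0 < x]) => /=.
  by split; [exact: nbhs_ninfty_lt|exact: nbhs_pinfty_gt].
by move=> [p q] /= [p0 q0]; exact: lt_trans q0.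
Qed.

Lemma cvg_right (f : R -> R) (l : R) : f x @[x --> +oo] --> l -> f p.2 @[p --> both_ends] --> l.
Proof. by move=> H; apply: (cvg_comp _ _ _ H); exact: cvg_snd. Qed.

Lemma cvg_left (f : R -> R) (l : R) : f x @[x --> -oo] --> l -> f p.1 @[p --> both_ends] --> l.
Proof. by move=> H; apply: (cvg_comp _ _ _ H); exact: cvg_fst. Qed.

Lemma cvgNy_atan : atan x @[x --> -oo] --> (- (pi / 2) : R).
Proof.
have -> : @atan R = (fun x => - atan (- x)) by apply/funext => x; rewrite atanN opprK.
apply: cvgN; apply: (cvg_comp _ _ _ (@cvgy_atan R)).
by apply/cvgNry; exact: cvg_id.
Qed.

Lemma is_int_cauchy_segment x y : x < y -> is_int `[x, y] (fun t => (1 + t ^+ 2)^-1) (atan y - atan x).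
Proof.
move=> xy; apply: (@ftc_segment R _ (@atan R) _ _ xy).
move=> t _; apply: derivableV; last by [].
by rewrite gt_eqF // ltr_pwDl // sqr_ge0.
Qed.

(** The omitted tails are at most C (pi - (atan y - atan x)) for the segment [x, y], which tends to
    0 however the ends move. *)
Lemma cvg_segments (g : R -> R) (l C : R) : is_int setT g l ->
  (forall t, `|g t| <= C * (1 + t ^+ 2)^-1) ->
  \int[mu]_(t in `[p.1, p.2]) g t @[p --> both_ends] --> l.
Proof.
move=> Ig gC; apply/subr_cvg0.
apply: (@squeeze0_near _ _ _ _ _ (fun p => pi - (atan p.2 - atan p.1)) C).
  near=> p; have p12 : p.1 < p.2 by near: p; exact: both_endsP.
  have sub : `[p.1, p.2]%classic `<=` (setT : set R) by [].
  have Igs : is_int `[p.1, p.2] g (\int[mu]_(t in `[p.1, p.2]) g t).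
    by apply: is_int_Rintegral => //; apply: (integrableS mT) => //; have [] := Ig.
  have I1 := is_intD mT (is_int_restrict mT (mseg _ _) sub Igs) (is_intZ (- 1) mT Ig).
  have I2 := is_intZ C mT (is_intD mT (@is_int_cauchy R) (is_intZ (- 1) mT
    (is_int_restrict mT (mseg _ _) sub (is_int_cauchy_segment p12)))).
  have H t : `|(g \_ `[p.1, p.2]) t + -1 * g t| <=
     C * ((1 + t ^+ 2)^-1 + -1 * ((fun t => (1 + t ^+ 2)^-1) \_ `[p.1, p.2]) t).
    rewrite !patchE; case: ifP => _; first by rewrite !mulN1r !subrr mulr0 normr0.
    by rewrite add0r mulN1r normrN mulr0 addr0.
  rewrite !mulN1r in I1 I2.
  rewrite ler_norml -[X in - X]mulr1 -[- (_ * 1)]mulrN mulrC; apply/andP; split.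
    apply: (is_int_le mT _ (is_intZ (- 1) mT I2) I1) => t _.
    by rewrite [leLHS]mulN1r; have := H t; rewrite ler_norml => /andP[].
  apply: (is_int_le mT _ I1 I2) => t _; exact: le_trans (ler_norm _) (H t).
rewrite (_ : 0 = pi - (pi / 2 - - (pi / 2))); last by lra.
apply: cvgB; first exact: cvg_cst.
apply: cvgB; [apply: cvg_right; exact: cvgy_atan|apply: cvg_left; exact: cvgNy_atan].
Unshelve. all: end_near.
Qed.

End VerticalLimit.

(** * Vertical integrals of products of poles *)

Section VerticalPoles.
Variables (R : realType) (c : R).
Hypothesis c1_gt0 : 0 < c + 1.
Local Notation mu := lebesgue_measure.
Local Notation RT := (measurableTypeR R).
Local Notation msr := (@measurable _ RT).
Implicit Types (u w : R[i]) (x y t r L : R) (es : seq nat).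

Local Notation both_ends := (filter_prod (ninfty_nbhs R) (pinfty_nbhs R)).

Let mT : msr setT. Proof. by []. Qed.
Let mseg x y : msr `[x, y]. Proof. exact: measurable_itv. Qed.

Lemma cvg_norm1V (F : set_system R) (FF : Filter F) :
  (forall A : R, \forall x \near F, A <= `|x|) -> (1 + `|x|)^-1 @[x --> F] --> (0 : R).
Proof.
move=> H; apply/(@gtr0_cvgV0 _ _ _ _ (fun x => 1 + `|x|)).
  by near=> x; rewrite ltr_pwDl.
apply/cvgryPge => A; near=> x; apply: (@le_trans _ _ `|x|); last by rewrite lerDr.
by near: x; exact: H.
Unshelve. all: end_near.
Qed.

Lemma cvgy_norm1V : (1 + `|x|)^-1 @[x --> +oo] --> (0 : R).
Proof.
apply: cvg_norm1V => A; near=> x; apply: (@le_trans _ _ x); last exact: ler_norm.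
by near: x; apply: nbhs_pinfty_ge; exact: num_real.
Unshelve. all: end_near.
Qed.

Lemma cvgNy_norm1V : (1 + `|x|)^-1 @[x --> -oo] --> (0 : R).
Proof.
apply: cvg_norm1V => A; near=> x; rewrite -normrN.
apply: (@le_trans _ _ (- x)); last exact: ler_norm.
by rewrite lerNr; near: x; apply: nbhs_ninfty_le; exact: num_real.
Unshelve. all: end_near.
Qed.

(** Integrability on segments is included because a sum of integrands is split before the limit is
    taken. *)
Definition vertical_limit es L (k : R) := forall u,
  (forall x y, mu.-integrable `[x, y] (EFin \o (fun t => tr (u * poles c es t) (t * L)))) /\
  \int[mu]_(t in `[p.1, p.2]) tr (u * poles c es t) (t * L) @[p --> both_ends] -->
    complex.Re u * (2 * pi * k).

Lemma vertical_limit_integrable es kp L : (1 < size es)%N -> inversion c es kp ->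
  vertical_limit es L (kp L).
Proof.
move=> es1 inv u; have I := inv u L; split.
  by move=> x y; apply: (integrableS mT) => //; have [] := I.
have [C C0 H] := poles_cauchy c1_gt0 es1.
apply: (cvg_segments (C := l1norm u * C) I) => t; apply: (le_trans (ler_tr _ _)).
by apply: (le_trans (l1normM _ _)); rewrite -mulrA ler_wpM2l ?l1norm_ge0.
Qed.

(** The value that identifies the double pole in [vertical_limit1]: on s_0 s_1 = 1 equal exponents
    cancel and 1 / x remains, for x > 1. *)
Lemma simplex_delta_double e r : 0 < r ->
  simplex_delta [:: e; e] r 1 = if 1 < r then ln r else 0.
Proof.
move=> r0; have mr : msr `]0, r[ by exact: measurable_itv.
have m1r : msr `]1, r[ by exact: measurable_itv.
have E x : 0 < x -> x ^+ e * simplex_delta [:: e] x (1 * x) = if 1 < x then x^-1 else 0.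
  move=> x0 /=; rewrite mul1r.
  have -> : (x^-1 < x) = (1 < x).
    apply/idP/idP => H; last by rewrite (lt_trans _ H) // invf_lt1.
    by rewrite ltNge; apply: contraTN H => x1; rewrite -leNgt (le_trans x1) // invf_ge1.
  case: ifP => _; last by rewrite mulr0.
  by rewrite exprS mulrCA -exprMn mulfV ?gt_eqF // expr1n mulr1.
case: ltP => r1; last first.
  have : is_int `]0, r[ (fun x => x ^+ e * simplex_delta [:: e] x (1 * x)) 0.
    apply: is_int_ext (is_int0 mr) => // x; rewrite /= in_itv /= => /andP[x0 xr].
    by rewrite E // ltNge (ltW (lt_le_trans xr r1)).
  by move/is_int_RintegralE.
have I : is_int `]1, r[ (fun x => x^-1) (ln r).
  have I : is_int `[1, r] (fun x => x^-1) (ln r - ln 1).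
    have x0 x : x \in `[1, r] -> 0 < x.
      by rewrite in_itv /= => /andP[x1 _]; exact: lt_le_trans x1.
    apply: (@ftc_segment R _ (@ln R) 1 r r1) => x /x0 x0'; first exact: is_derive1_ln.
    by apply: derivableV; [rewrite gt_eqF|].
  rewrite ln1 subr0 in I; have [I1 _] := I.
  have I2 : mu.-integrable `]1, r[ (EFin \o (fun x : R => x^-1)).
    apply: (integrableS (mseg 1 r) m1r _ I1) => x /=; exact: subset_itv_oo_cc.
  apply: is_int_eq (is_int_Rintegral I2 m1r).
  rewrite -(is_int_RintegralE I) Rintegral_itv_bndo_bndc //.
  rewrite Rintegral_itv_obnd_cbnd //; apply: (integrableS (mseg 1 r) _ _ I1).
    exact: measurable_itv.
  by move=> x /=; rewrite !in_itv /= => /andP[/ltW -> ->].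
have sub : (`]1, r[%classic : set R) `<=` `]0, r[%classic.
  by move=> x /=; rewrite !in_itv /= => /andP[x1 ->]; rewrite (lt_trans _ x1).
rewrite -(is_int_RintegralE (is_int_restrict mr m1r sub I)).
apply: eq_Rintegral => x; rewrite inE /= in_itv /= => /andP[x0 xr].
by rewrite [LHS]E // patchE mem_setE in_itv /= xr andbT.
Qed.

(* e^(itL) / (k + it) is the derivative of e^(itL) / (iL (k + it)), up to the
   absolutely integrable e^(itL) / (L (k + it)^2). *)
Lemma vertical_limit1 e r : 0 < r -> r != 1 ->
  vertical_limit [:: e] (ln r) (expR (- exponent c [:: e] * ln r) * simplex_delta [:: e] r 1).
Proof.
move=> r0 r1 u; set k := exponent c [:: e]; set L := ln r.
have k0 : 0 < k by exact: exponent_gt0.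
have L0 : L != 0 by rewrite ln_eq0.
have D0 t : k ^+ 2 + t ^+ 2 != 0 by rewrite gt_eqF // ltr_pwDl ?sqr_ge0 // exprn_gt0.
have [_ [kp [inv form]]] := delta_inversion c1_gt0 e (isT : [:: e] != [::]).
have pE t : poles c [:: e] t = pole k 1 t by rewrite /= mul1r.
(* Equal exponents make the two poles proportional, with ratio 1/2. *)
have p2E t : poles c [:: e; e] t = 2^-1 * pole k 1 t ^+ 2.
  have -> : pole k 1 t ^+ 2 = pole k 1 t * pole k 1 t by [].
  rewrite /= mul1r mulrCA; congr (_ * _); rewrite /pole -invfM; congr (_^-1).
  rewrite exponent_cons.
  have -> : exponent c [:: e] + c + e.+1%:R = 2 * k.
    by rewrite /k /exponent /= addn0; ring.
  by apply/eqP; rewrite eq_complex /=; apply/andP; split; apply/eqP; ring.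
(* w = u / (iL), so [G] is the real part of the boundary term. *)
pose w : R[i] := u * (0 +i* (- L^-1)).
pose G t := tr (w * pole k 1 t) (t * L).
pose g2 t := tr (u * (2 / L)%:C * poles c [:: e; e] t) (t * L).
have dD t : is_derive t 1 (fun t => (k ^+ 2 + t ^+ 2)^-1) (- (2 * t) / (k ^+ 2 + t ^+ 2) ^+ 2).
  have dF : is_derive t 1 (fun t => k ^+ 2 + t ^+ 2) (2 * t).
    by apply: is_derive_eq; rewrite /GRing.scale /=; ring.
  apply: is_derive_eq (is_deriveV (f := fun t => k ^+ 2 + t ^+ 2) (D0 t) dF) _.
  by rewrite /GRing.scale /=; field; exact: D0.
have gE : (fun t => tr (u * poles c [:: e] t) (t * L)) = (fun t =>
    ((complex.Re u * k + complex.Im u * t) * cos (t * L) -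
     (complex.Im u * k - complex.Re u * t) * sin (t * L)) * (k ^+ 2 + t ^+ 2)^-1).
  apply/funext => t; rewrite pE /pole mul1r invC /tr; case: (u) => a b /=.
  by move: (cos _) (sin _) => C S; field; exact: D0.
have GE : G = (fun t =>
    ((complex.Im u * k - complex.Re u * t) * cos (t * L) +
     (complex.Re u * k + complex.Im u * t) * sin (t * L)) * (k ^+ 2 + t ^+ 2)^-1 * L^-1).
  apply/funext => t; rewrite /G /w /pole mul1r invC /tr; case: (u) => a b /=.
  by move: (cos _) (sin _) => C S; field; rewrite L0 D0.
have g2E : g2 = (fun t =>
    ((complex.Re u * (k ^+ 2 - t ^+ 2) + 2 * complex.Im u * k * t) * cos (t * L) -
     (complex.Im u * (k ^+ 2 - t ^+ 2) - 2 * complex.Re u * k * t) * sin (t * L)) *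
     (k ^+ 2 + t ^+ 2)^-1 * (k ^+ 2 + t ^+ 2)^-1 * L^-1).
  apply/funext => t; rewrite /g2 p2E expr2 /pole mul1r invC /tr.
  have -> : 2^-1 = (2^-1)%:C :> R[i] by rewrite fmorphV rmorph_nat.
  case: (u) => a b /=.
  by move: (cos _) (sin _) => C S; field; rewrite L0 D0.
have dG t : is_derive t 1 G (tr (u * poles c [:: e] t) (t * L) - g2 t).
  rewrite GE g2E; move/(congr1 (fun f => f t)): gE => /= ->.
  have dDt := dD t; apply: is_derive_eq; rewrite /GRing.scale /=.
  by move: (cos _) (sin _) => C S; field; rewrite L0 D0.
have dg t : derivable (fun t => tr (u * poles c [:: e] t) (t * L) - g2 t) t 1.
  apply: derivableB; first by rewrite gE; have dDt := dD t; exact: ex_derive.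
  by rewrite g2E; have dDt := dD t; exact: ex_derive.
have [Ig2 cg2] := vertical_limit_integrable L (ltn0Sn 1 : (1 < size [:: e; e])%N) inv (u * (2 / L)%:C).
have Is x y : x < y -> is_int `[x, y] (fun t => tr (u * poles c [:: e] t) (t * L))
    (G y - G x + \int[mu]_(t in `[x, y]) g2 t).
  move=> xy; have I1 := ftc_segment xy (fun t _ => dG t) (fun t _ => dg t).
  have I2 := is_int_Rintegral (Ig2 x y) (mseg x y).
  by apply: is_int_ext (is_intD (mseg x y) I1 I2) => // t _; rewrite subrK.
split.
  move=> x y; case: (ltP x y) => xy; first by have [] := Is x y xy.
  have [xs _] := Is (x - 1) (x + 1) ltac:(lra).
  apply: (integrableS _ _ _ xs) => // t; rewrite /= !in_itv /= => /andP[xt ty].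
  by apply/andP; split; lra.
have cG : G p.2 - G p.1 + \int[mu]_(t in `[p.1, p.2]) g2 t @[p --> both_ends] -->
    complex.Re (u * (2 / L)%:C) * (2 * pi * kp L).
  have [C C0 HC] := l1norm_pole k0 (@ltr01 R).
  have GC t : `|G t| <= (l1norm w * C) * (1 + `|t|)^-1.
    by apply: (le_trans (ler_tr _ _)); apply: (le_trans (l1normM _ _)); rewrite -mulrA ler_wpM2l ?l1norm_ge0.
  rewrite -[X in _ --> X]add0r; apply: cvgD => //.
  rewrite -[X in _ --> X](subr0 0); apply: cvgB.
    apply: cvg_right; exact: (squeeze0 _ GC cvgy_norm1V).
  apply: cvg_left; exact: (squeeze0 _ GC cvgNy_norm1V).
have -> : complex.Re u * (2 * pi * (expR (- k * L) * simplex_delta [:: e] r 1)) =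
   complex.Re (u * (2 / L)%:C) * (2 * pi * kp L).
  (* With the bound e^(L/2), the square root of r, the phase of two variables is L, that of one
     variable with bound r. *)
  have := form (expR (L / 2)) 1 (expR_gt0 _) ltr01; rewrite simplex_delta_double ?expR_gt0 //.
  have -> : exponent c [:: e; e] = 2 * k.
    by rewrite exponent_cons /k /exponent /= addn0; ring.
  rewrite expRK ln1 mulr0 !add0r (_ : 2 * k * (L / 2) = k * L); last by field.
  rewrite (_ : (size [:: e; e])%:R * (L / 2) = L); last by rewrite /=; field.
  have -> : (1 < expR (L / 2)) = (1 < r).
    by rewrite expR_gt1 pmulr_lgt0 ?invr_gt0 // -expR_gt1 lnK.
  have -> : complex.Re (u * (2 / L)%:C) = complex.Re u * (2 / L).
    by case: (u) => a b /=; rewrite mulr0 subr0.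
  rewrite [simplex_delta _ _ _]/= invr1 expr1n => E.
  have {E} : kp L = expR (- k * L) * (if 1 < r then L / 2 else 0).
    by rewrite E mulrA -expRD mulNr addNr expR0 mul1r.
  move=> ->; case: ifP => _; last by rewrite !mulr0.
  by move: (expR _) (pi) => A P; field.
apply: cvg_trans cG; apply: near_eq_cvg; near=> p.
have p12 : p.1 < p.2 by near: p; exact: both_endsP.
by rewrite (is_int_RintegralE (Is _ _ p12)).
Unshelve. all: end_near.
Qed.

Lemma vertical_limit_simplex_delta es r : es != [::] -> 0 < r -> (size es = 1%N -> r != 1) ->
  vertical_limit es ((size es)%:R * ln r)
    (expR (- exponent c es * ln r) * simplex_delta es r 1).
Proof.
case: es => // e [|e' es] _ r0 hr.
  by rewrite mul1r; apply: vertical_limit1 => //; exact: hr.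
have [_ [kp [inv form]]] := delta_inversion c1_gt0 e (isT : e' :: es != [::]).
rewrite form // mulrA -expRD ln1 mulr0 !add0r mulNr addNr expR0 mul1r.
exact: vertical_limit_integrable.
Qed.

Lemma vertical_limit_sum (I : eqType) (T : seq I) (a : I -> R) (es : I -> seq nat)
    L (k : I -> R) : (forall i, i \in T -> vertical_limit (es i) L (k i)) -> forall u,
  \int[mu]_(t in `[p.1, p.2]) (\sum_(i <- T) a i * tr (u * poles c (es i) t) (t * L))
    @[p --> both_ends] --> complex.Re u * (2 * pi * \sum_(i <- T) a i * k i).
Proof.
move=> H u; pose h i t := tr (u * poles c (es i) t) (t * L).
have E p : \int[mu]_(t in `[p.1, p.2]) (\sum_(i <- T) a i * h i t) =
    \sum_(i <- T) a i * \int[mu]_(t in `[p.1, p.2]) h i t.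
  apply: is_int_RintegralE; apply: is_int_sum => // i iT; apply: is_intZ => //.
  by apply: is_int_Rintegral => //; have [] := H i iT u.
have {E}-> : (fun p : R * R => \int[mu]_(t in `[p.1, p.2]) (\sum_(i <- T) a i * h i t)) =
    (fun p => \sum_(i <- T) a i * \int[mu]_(t in `[p.1, p.2]) h i t) by exact/funext.
have -> : complex.Re u * (2 * pi * \sum_(i <- T) a i * k i) =
    \sum_(i <- T) a i * (complex.Re u * (2 * pi * k i)).
  by rewrite !mulr_sumr; apply: eq_bigr => i _; ring.
elim: (T) H => [|i T' IHT] H.
  by rewrite big_nil; under eq_fun do rewrite big_nil; exact: cvg_cst.
rewrite big_cons; under eq_fun do rewrite big_cons.
apply: cvgD; last by apply: IHT => j jT; apply: H; rewrite inE jT orbT.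
by apply: cvgM; [exact: cvg_cst|have [] := H i (mem_head _ _) u].
Qed.

End VerticalPoles.

(** * From Selberg's formula to the line integrand *)

Section Assembly.
Variable R : realType.
Implicit Types (z : R[i]) (t r : R).

Lemma natC (n : nat) : n%:R = (n%:R)%:C :> R[i].
Proof. by rewrite rmorph_nat. Qed.

Lemma halfC (n : nat) : n%:R / 2 = (n%:R / 2)%:C :> R[i].
Proof. by rewrite rmorphM fmorphV !rmorph_nat. Qed.

Lemma Gamma_selberg b N z : b.+1 \in [:: 1; 2; 4]%N -> 0 < complex.Re z ->
  let a (j : nat) := Gamma ((2 + b.+1 * j)%:R / 2 : R[i]) in
  \prod_(j < N) (a j * a j.+1 / a 1%N) *
  \prod_(j < N) (Gamma (z + (b.+1 * j)%:R / 2) / Gamma (z + (2 + b.+1 * (N - 1 + j))%:R / 2)) =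
  N`!%:R * \sum_(t <- Selberg.terms N b.+1) t.1%:~R *
    \prod_(i < N) ((N - i)%:R * z + (\sum_(k < N | (i <= k)%N) t.2 k)%:R)^-1.
Proof.
move=> hb z0 a.
pose dom z := is_true (0 < complex.Re z).
have dom_half z' n : dom z' -> dom (z' + n%:R / 2).
  by rewrite /dom halfC; case: z' => x y /= x0; rewrite ltr_pwDl.
have dom_pos n : dom (n.+1%:R / 2) by rewrite /dom halfC /= divr_gt0.
have dom_generic z' : dom z' -> Selberg.generic z'.
  rewrite /dom => z'0 l k l0; apply: contraTneq z'0 => E.
  have := congr1 (fun w => complex.Re w) E.
  rewrite !natC; case: z' {E} => x y /= E; apply/negP => x0; move: E; apply/eqP.
  by rewrite mul0r subr0 gt_eqF // ltr_pwDl // mulr_gt0 ?ltr0n.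
have S := Selberg.selberg_simplex dom_half dom_pos dom_generic (@Gamma1 R)
  (@GammaS R) (@Gamma_neq0 R) hb (leqnn N) z0.
have H1 := Selberg.Gam_den_neq0 b dom_half (@Gamma_neq0 R) N z0.
have aE j : a j != 0 by apply: Gamma_neq0; exact: dom_pos.
rewrite -Selberg.terms_simplex in S.
rewrite !prodf_div prodr_const card_ord.
rewrite -/(Selberg.Gam_num (@Gamma R) b N z) -/(Selberg.Gam_den (@Gamma R) b N z).
move: S H1 (expf_neq0 N (aE 1%N)); rewrite -/(a 1%N).
move: (Selberg.Gam_den _ _ _ _) (Selberg.Gam_num _ _ _ _) (a 1%N ^+ N) => D P A S D0 A0.
apply: (mulIf D0); apply: (mulIf A0); rewrite S.
by move: (\prod_(j < N) _) => Q; field; rewrite D0 A0.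
Qed.

Section Exponents.
Variables (c : R) (b n : nat).
Local Notation N := n.+1.

(** The exponents of sigma_k: b = beta - 1 from the weight, and 2 m_k because the expansion is in
    squares. *)
Definition term_exponents (m : {ffun 'I_N -> nat}) : seq nat :=
  mkseq (fun k => b + 2 * m (inord k))%N N.

Lemma size_term_exponents m : size (term_exponents m) = N.
Proof. exact: size_mkseq. Qed.

Lemma polesE es t : poles c es t =
  \prod_(i < size es) pole (exponent c (drop i es)) (size es - i)%:R t.
Proof.
elim: es => [|e es IHes]; first by rewrite big_ord0.
rewrite big_ord_recl [LHS]/= IHes mulrC drop0 subn0; congr (_ * _).
Qed.

Lemma exponent_drop m i : (i <= N)%N -> exponent c (drop i (term_exponents m)) =
  (N - i)%:R * (c + b.+1%:R) + 2 * (\sum_(k < N | (i <= k)%N) m k)%:R.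
Proof.
move=> iN; rewrite /exponent size_drop size_term_exponents /term_exponents /mkseq -map_drop.
rewrite drop_iota add0n -map_comp sumnE big_map -/(index_iota i N) /=.
have -> : (\sum_(i <= k < N) (b + 2 * m (inord k)).+1 =
    (N - i) * b.+1 + 2 * \sum_(k < N | (i <= k)%N) m k)%N.
  rewrite (eq_bigr (fun k => b.+1 + 2 * m (inord k)))%N; last by move=> k _; rewrite addSn.
  rewrite big_split /= sum_nat_const_nat -big_distrr /=; congr (_ + 2 * _)%N.
  by rewrite big_geq_mkord; apply: eq_bigr => k _; rewrite inord_val.
by rewrite natrD !natrM; ring.
Qed.

(** Working with squares doubles the exponents, so each pole is half a factor of Selberg's sum: this
    is the 2^(-N) of A_N. *)
Lemma poles_term m t : let z : R[i] := ((c + b.+1%:R) +i* t) / 2 in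
  poles c (term_exponents m) t = 2 ^- N *
  \prod_(i < N) ((N - i)%:R * z + (\sum_(k < N | (i <= k)%N) m k)%:R)^-1.
Proof.
move=> z; rewrite polesE size_term_exponents -exprVn.
rewrite -[X in 2^-1 ^+ X]card_ord -prodr_const -big_split /=; apply: eq_bigr => i _.
rewrite exponent_drop; last exact: ltnW.
have z2 : 2 * z = (c + b.+1%:R) +i* t by rewrite /z mulrC divfK ?pnatr_eq0.
rewrite /pole -invfM; congr (_^-1); rewrite [RHS]mulrDr [2 * (_ * z)]mulrCA z2 !natC.
by apply/eqP; rewrite eq_complex /=; apply/andP; split; apply/eqP; ring.
Qed.

Lemma monomial_term m (s : N.-tuple R) :
  monomial (term_exponents m) s = (\prod_(l < N) tnth s l ^+ b) * \prod_(l < N) (tnth s l ^+ 2) ^+ m l.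
Proof.
rewrite /monomial size_term_exponents -big_split /=; apply: eq_bigr => l _.
by rewrite nth_mkseq // inord_val (tnth_nth 0) exprD exprM.
Qed.

End Exponents.

Lemma JN_simplex_delta b n r : 0 < r -> JN b.+1 n r =
  (\sum_(m <- Selberg.terms n.+1 b.+1) m.1%:~R * simplex_delta (term_exponents b m.2) r 1)%:E.
Proof.
move=> r0.
pose T : seq (R * seq nat) :=
  [seq (m.1%:~R, term_exponents b m.2) | m <- Selberg.terms n.+1 b.+1].
have Tn : all (fun m => size m.2 == n.+1) T.
  by rewrite all_map; apply/allP => m _; apply/eqP; exact: size_term_exponents.
have intE (s : n.+1.-tuple R) : integrand b.+1 s = monomial_sum T s.
  rewrite /integrand /monomial_sum big_map /= subn1 /= (Selberg.termsE _ (fun i => tnth s i ^+ 2)).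
  rewrite mulr_sumr; apply: eq_bigr => t _; rewrite monomial_term; ring.
have := pos_integral_monomial_sum Tn r0 ltr01; rewrite big_map /= => <-.
rewrite /JN /delta_integral; congr pos_integral; apply/funext => s /=.
rewrite mul1r big_tuple patchE intE.
set q := \prod_(i < n) _.
have -> : ([tuple of rcons s q^-1] \in region r) = path >%R r (rcons (rcons s q^-1) 0).
  by apply/idP/idP; rewrite inE.
by [].
Qed.

(** The Gamma factors of A_N complete those of the integrand to [Gamma_selberg] at z = (s - 1 +
    beta) / 2, and N! cancels. The line Re s = c corresponds to the parameter c - 1 of [poles]. *)
Lemma AN_line_integrand b n r (c : R) t : b.+1 \in [:: 1; 2; 4]%N -> 0 < r -> 0 < c ->
  AN b.+1 n r * line_integrand b.+1 n r (c +i* t) =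
  (r ^+ (n.+1 * b + b.+1 * n.+1 * n) * expR (n.+1%:R * c * ln r))%:C *
  \sum_(m <- Selberg.terms n.+1 b.+1) m.1%:~R *
    (poles (c - 1) (term_exponents b m.2) t * cis (t * (n.+1%:R * ln r))).
Proof.
move=> hb r0 c0; set N := n.+1.
pose z : R[i] := ((c - 1 + b.+1%:R) +i* t) / 2.
have zE : z = ((c - 1 + b.+1%:R) / 2) +i* (t / 2).
  have -> : z = ((c - 1 + b.+1%:R) +i* t) * (2^-1)%:C by rewrite fmorphV rmorph_nat.
  by apply/eqP; rewrite eq_complex /=; apply/andP; split; apply/eqP; ring.
have z0 : 0 < complex.Re z.
  rewrite zE /= divr_gt0 // (_ : c - 1 + b.+1%:R = c + b%:R) ?ltr_pwDl //.
  by rewrite -natr1; ring.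
have S := Gamma_selberg N hb z0.
have -> : \sum_(m <- Selberg.terms N b.+1) m.1%:~R *
    (poles (c - 1) (term_exponents b m.2) t * cis (t * (N%:R * ln r))) =
  cis (t * (N%:R * ln r)) * 2 ^- N * (\sum_(m <- Selberg.terms N b.+1) m.1%:~R *
    \prod_(i < N) ((N - i)%:R * z + (\sum_(k < N | (i <= k)%N) m.2 k)%:R)^-1).
  by rewrite mulr_sumr; apply: eq_bigr => m _; rewrite poles_term -/z; ring.
have N0 : N`!%:R != 0 :> R[i] by rewrite pnatr_eq0 -lt0n fact_gt0.
rewrite -[X in _ * (_ * X)](mulKf N0) -S.
rewrite /AN /line_integrand !subn1 !succnK.
have -> : cpow r (N%:R * (c +i* t)) = (expR (N%:R * c * ln r))%:C * cis (t * (N%:R * ln r)).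
  by rewrite natC /cpow /cis /= !mul0r subr0 addr0 -(mulrA _ t) [t * (_ * _)]mulrCA [t * ln r]mulrC !mulrA.
set P1 := \prod_(j < N) (_ * _ / _); set P2 := \prod_(j < N) (_ / _).
set Q1 := \prod_(j < N) _; set Q2 := \prod_(j < N) _.
have aE j : Gamma (1 + j%:R * (b.+1%:R / 2) : R)%:C = Gamma ((2 + b.+1 * j)%:R / 2 : R[i]).
  by rewrite halfC natrD natrM; congr (Gamma _%:C); field.
have a1E : Gamma (1 + b.+1%:R / 2 : R)%:C = Gamma ((2 + b.+1 * 1)%:R / 2 : R[i]).
  by rewrite -aE mul1r.
have -> : P1 = Q1 by apply: eq_bigr => j _; rewrite !aE a1E.
have -> : P2 = Q2.
  apply: eq_bigr => j _; rewrite /z -!mulrDl.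
  have e1 : (j.+1 * b.+1)%:R = b.+1%:R + (b.+1 * j)%:R :> R by rewrite -natrD mulSn mulnC.
  have e2 : ((N + j) * b.+1)%:R + 2 = b.+1%:R + (2 + b.+1 * (N - 1 + j))%:R :> R.
    by rewrite -!natrD subn1 addnCA -mulnS -addSn mulnC addnC.
  have -> : c +i* t - 1 + (j.+1 * b.+1)%:R = (c - 1 + b.+1%:R) +i* t + (b.+1 * j)%:R.
    by rewrite !natC e1; apply/eqP; rewrite eq_complex /= oppr0 !addr0 !addrA !eqxx.
  have -> : c +i* t + 1 + ((N + j) * b.+1)%:R =
      (c - 1 + b.+1%:R) +i* t + (2 + b.+1 * (N - 1 + j))%:R.
    rewrite !natC; apply/eqP; rewrite eq_complex /= !addr0 eqxx andbT; apply/eqP.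
    by rewrite -(addrA (c - 1)) -e2; ring.
  by rewrite subn1.
rewrite !rmorphM !fmorphV rmorphXn /= !rmorph_nat.
move: Q1 Q2 (cis _) (expR _)%:C (2 ^- N) (N`!%:R^-1) => A B C D P Q; ring.
Qed.

End Assembly.

Lemma AN_neq0 (R : realType) b n (r : R) : 0 < r -> AN b n r != 0.
Proof.
move=> r0; apply: mulf_neq0.
  rewrite -[0]/(0%:C) (inj_eq (@complexI R)) gt_eqF // mulr_gt0 ?exprn_gt0 //.
have G (a : R) : 0 <= a -> Gamma (1 + a)%:C != 0.
  by move=> a0; apply: Gamma_neq0; rewrite /= ltr_pwDl.
by apply/prodf_neq0 => j _; rewrite mulf_neq0 ?invr_eq0 ?mulf_neq0 ?G // ?mulr_ge0 // divr_ge0.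
Qed.

(** For N = 1 and r = 1 the integrand is 2 / (s - 1 + beta), whose integral diverges logarithmically
    when the ends move independently; [hdeg] excludes this case. Finiteness is asserted because
    [fine] maps infinity to 0. *)
Theorem proposition1 (R : realType) (beta n : nat) (r c : R)
    (hbeta : beta \in [:: 1; 2; 4]%N) (hr : 0 < r) (hc : 0 < c)
    (hdeg : ~ (n.+1 = 1%N /\ r = 1)) :
  JN beta n r \is a fin_num /\
  exists2 I : R[i],
    vertical_integral_to c (line_integrand beta n r) I &
    (fine (JN beta n r))%:C = AN beta n r / ((2 * pi)%:C * 'i%C) * I.
Proof.
case: beta hbeta => // b hb.
have c1_gt0 : 0 < c - 1 + 1 by rewrite subrK.
have A0 := AN_neq0 b.+1 n hr.
pose T := Selberg.terms n.+1 b.+1.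
pose es (m : int * {ffun 'I_n.+1 -> nat}) := term_exponents b m.2.
pose L := n.+1%:R * ln r.
pose rho := r ^+ (n.+1 * b + b.+1 * n.+1 * n) * expR (n.+1%:R * c * ln r).
pose k m := expR (- exponent (c - 1) (es m) * ln r) * simplex_delta (es m) r 1.
pose H := \sum_(m <- T) m.1%:~R * k m.
have JE : JN b.+1 n r = (rho * H)%:E.
  rewrite JN_simplex_delta // /H mulr_sumr; congr EFin; apply: eq_big_seq => m mT.
  rewrite mulrCA; congr (_ * _); rewrite /k mulrA.
  (* By [terms_degree] the exponent is the same for all monomials, so the power of r comes out of
     the sum. *)
  have -> : rho = expR (exponent (c - 1) (es m) * ln r).
    rewrite -[es m]drop0 exponent_drop // subn0 -(natrM _ 2) (Selberg.terms_degree mT).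
    rewrite /rho natpow_expR // -expRD; congr expR; rewrite /= natrD !natrM.
    by rewrite (_ : b.+1%:R = b%:R + 1) ?natr1 //; ring.
  by rewrite -expRD mulNr addrN expR0 mul1r.
have kv m : m \in T -> vertical_limit (c - 1) (es m) L (k m).
  have es0 : es m != [::] by rewrite -size_eq0 size_term_exponents.
  have := vertical_limit_simplex_delta c1_gt0 es0 hr.
  by rewrite size_term_exponents => V _; apply: V => N1; apply/eqP => r1; exact: hdeg.
(* The constant ratio of i times the line integrand to the sum of poles [h]; [AN_neq0] permits the
   division. *)
pose v : R[i] := 'i%C * rho%:C / AN b.+1 n r.
pose h t : R[i] := \sum_(m <- T) m.1%:~R * (poles (c - 1) (es m) t * cis (t * L)).
have fE t : line_integrand b.+1 n r (c +i* t) * 'i%C = v * h t.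
  apply: (mulfI A0); rewrite mulrA AN_line_integrand // /v -/rho.
  rewrite -[\sum_(m <- _) _]/(h t).
  by move: (h t) (AN _ _ _) A0 => x A A0; field.
have Reh w t : complex.Re (w * h t) =
    \sum_(m <- T) m.1%:~R * tr (w * poles (c - 1) (es m) t) (t * L).
  rewrite /h mulr_sumr raddf_sum; apply: eq_bigr => m _.
  by rewrite -trZ -Re_cis rmorph_int; congr complex.Re; ring.
rewrite JE; split=> //.
exists (v * (2 * pi * H)%:C).
  have Rec w : complex.Re (w * (2 * pi * H)%:C) = complex.Re w * (2 * pi * H).
    by case: w => x y /=; rewrite mulr0 subr0.
  have ImE (x : R[i]) : complex.Im x = complex.Re (- 'i * x) by case: x => x y /=; ring.
  have cvg_h w : \int[lebesgue_measure]_(t in `[p.1, p.2]) complex.Re (w * h t)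
      @[p --> filter_prod (ninfty_nbhs R) (pinfty_nbhs R)] --> complex.Re (w * (2 * pi * H)%:C).
    under eq_fun do under eq_Rintegral do rewrite Reh.
    by rewrite Rec; exact: vertical_limit_sum.
  rewrite /vertical_integral_to /Cintegral; apply: complex_cvg => /=.
    by under eq_fun do under eq_Rintegral do rewrite fE; exact: cvg_h.
  under eq_fun do under eq_Rintegral do rewrite ImE fE mulrA.
  by rewrite ImE mulrA; exact: cvg_h.
clearbody rho; rewrite /v [fine _]/= !rmorphM rmorph_nat.
have i0 : 'i%C != 0 :> R[i] by rewrite eq_complex /= oner_eq0 andbF.
move: (AN _ _ _) A0 ('i%C : R[i]) i0 => A A0 i i0.
have pi0 : (pi : R) != 0 by rewrite gt_eqF // pi_gt0.
by move: (pi : R) pi0 => p p0; field; rewrite A0 i0 fmorph_eq0.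
Qed.
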